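(* Let $b\in{\rm BMO}(\mathbb R^n)$ be real-valued and $X$ be a ball Banach function space on $\mathbb R^n$ such that the Hardy--Littlewood maximal operator $\mathcal M$ is bounded on $X$ and on its associate space $X'$. Let $\Omega\in L^\infty(\mathbb S^{n-1})$ be homogeneous of degree zero with $\int_{\mathbb S^{n-1}}\Omega\,d\sigma=0$, and suppose there exists an open set $\Lambda\subset\mathbb S^{n-1}$ such that $\Omega$ does not change sign on $\Lambda$. Let $\lambda\in(0,1)$, $\varepsilon_0\in(0,\infty)$ and $k_0\in(10\sqrt n,\infty)$. Then there exist positive constants $C$, $d_0$ and $\delta$ such that, for any ball $B(x_0,r_0)$ with $x_0\in\mathbb R^n$, $r_0\in(0,\infty)$, any point $x_1$ and sets $E,F,G$ forming an admissible configuration for $B(x_0,r_0)$ (with respect to $b,\Omega,\lambda,\varepsilon_0,k_0$), and any $d\in(0,\infty)$ with $d\ge d_0$, $$\big\|[b,T_\Omega](\mathbf 1_F)\,\mathbf 1_{B(x_0,2^{d+1}r_0)\setminus B(x_0,2^dr_0)}\big\|_X\le C\,2^{-\delta dn}\,d\,\|b\|_{{\rm BMO}(\mathbb R^n)}\|\mathbf 1_F\|_X,$$ where $C$ is independent of $d$ and $B(x_0,r_0)$, and $d_0$ is a large constant depending only on $k_0$.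
   Context: Ball Banach function space: let $\mathscr M(\mathbb R^n)$ be the set of all measurable functions on $\mathbb R^n$. A Banach space $X\subset\mathscr M(\mathbb R^n)$ (with $\|f\|_X=\infty$ for $f\notin X$) is a ball Banach function space if: $\|f\|_X=0$ implies $f=0$ a.e.; $|g|\le|f|$ a.e. implies $\|g\|_X\le\|f\|_X$; $0\le f_m\uparrow f$ a.e. implies $\|f_m\|_X\uparrow\|f\|_X$; $\mathbf 1_B\in X$ for every ball $B$; $\|f+g\|_X\le\|f\|_X+\|g\|_X$; and for every ball $B$ there is $C_{(B)}>0$ with $\int_B|f|\,dx\le C_{(B)}\|f\|_X$ for all $f\in X$. Associate space: $X':=\{f\in\mathscr M(\mathbb R^n):\|f\|_{X'}:=\sup_{\{g\in X:\|g\|_X=1\}}\|fg\|_{L^1(\mathbb R^n)}<\infty\}$. $\mathcal M(f)(x):=\sup_{B\ni x}\frac1{|B|}\int_B|f(y)|\,dy$, the supremum being over all balls $B$ containing $x$. $\mathbb S^{n-1}$ is the unit sphere with area measure $d\sigma$. Homogeneous of degree zero: $\Omega(\mu x)=\Omega(x)$ for $\mu\in(0,\infty)$, $x\in\mathbb S^{n-1}$, so $\Omega$ is defined on $\mathbb R^n\setminus\{0\}$. ${\rm BMO}(\mathbb R^n)$: locally integrable $f$ with $\|f\|_{{\rm BMO}(\mathbb R^n)}:=\sup_B\frac1{|B|}\int_B|f-f_B|\,dx<\infty$, sup over all balls, $f_B:=\frac1{|B|}\int_Bf$. Local mean oscillation: $\omega_\lambda(f;B):=\inf_{c\in\mathbb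 C}\{[(f-c)\mathbf 1_B]^*(\lambda|B|)\}$, where $f^*(t):=\inf\{\alpha\in(0,\infty):|\{x\in\mathbb R^n:|f(x)|>\alpha\}|<t\}$. Admissible configuration for $B=B(x_0,r_0)$: a point $x_1\in\mathbb R^n$ with $|x_1-x_0|=2k_0r_0$ and measurable sets $E\subset B(x_0,r_0)$ with $|E|=\frac\lambda2|B(x_0,r_0)|$, $F\subset B(x_1,r_0)$ with $|F|=\frac12|B(x_1,r_0)|$, and $G\subset E\times F$ with $|G|\ge\frac\lambda8|B(x_0,r_0)|^2$, such that: $\omega_\lambda(b;B)\le|b(x)-b(y)|$ for any $x\in E$ and $y\in F$; $\Omega(\frac{x-y}{|x-y|})$ and $b(x)-b(y)$ do not change sign on $E\times F$; and $|\Omega(\frac{x-y}{|x-y|})|\ge\varepsilon_0$ for any $(x,y)\in G$. $[b,T_\Omega]$ is the commutator $bT_\Omega(f)-T_\Omega(bf)$ of $b$ with the principal value singular integral $T_\Omega$ with kernel $\Omega(x-y)/|x-y|^n$; for a bounded measurable set $F$ and $x\notin\overline F$, $[b,T_\Omega](\mathbf 1_F)(x)=\int_F[b(x)-b(y)]\frac{\Omega(x-y)}{|x-y|^n}\,dy$. *)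

(* Defs.v *)
From HB Require Import structures.
From mathcomp Require Import all_boot all_order all_algebra.
From mathcomp Require Import complex.
From mathcomp Require Import all_classical all_reals all_analysis.
From mathcomp Require Import measurable_realfun.

Set Implicit Arguments.
Unset Strict Implicit.
Unset Printing Implicit Defensive.
Import Order.TTheory GRing.Theory Num.Theory.
Import numFieldNormedType.Exports Normc.

Local Open Scope classical_set_scope.
Local Open Scope ring_scope.
Local Open Scope complex_scope.

Definition rV_display : measure_display. Proof. exact. Qed.

Section rV_measurable.
Context (R : realType) (n : nat).

Let coord (i : 'I_n) (x : 'rV[R]_n) : R := x ord0 i.

Let rV_set0 : g_sigma_preimage coord set0.
Proof. exact: sigma_algebra0. Qed.

Let rV_setC A : g_sigma_preimage coord A -> g_sigma_preimage coord (~` A).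
Proof. exact: sigma_algebraC. Qed.

Let rV_bigcup (F : _^nat) : (forall i, g_sigma_preimage coord (F i)) ->
  g_sigma_preimage coord (\bigcup_i (F i)).
Proof. exact: sigma_algebra_bigcup. Qed.

HB.instance Definition _ := @isMeasurable.Build rV_display 'rV[R]_n
  (g_sigma_preimage coord) rV_set0 rV_setC rV_bigcup.

Lemma measurable_coord (i : 'I_n) :
  measurable_fun setT (fun x : 'rV[R]_n => x ord0 i : R).
Proof.
move=> _ Y mY; rewrite setTI; apply: sub_sigma_algebra => /=.
rewrite -bigcup_seq/=; exists i => /=; first by rewrite mem_index_enum.
by exists Y => //; rewrite setTI.
Qed.

Lemma measurable_fun_rV d (T : measurableType d) (f : T -> 'rV[R]_n) :
  (forall i, measurable_fun setT (fun t => f t ord0 i : R)) ->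
  measurable_fun setT f.
Proof.
move=> mf.
have sub : g_sigma_preimage (fun i => coord i \o f) `<=` measurable.
  apply: smallest_sub; first exact: sigma_algebra_measurable.
  move=> A; rewrite -bigcup_seq/= => -[i _ [B mB <-]].
  exact: mf.
move=> _ A mA; apply: sub.
rewrite g_sigma_preimage_comp; by exists A.
Qed.

End rV_measurable.

Lemma sigma_finite_prod d1 d2 (T1 : measurableType d1)
    (T2 : measurableType d2) (R : realType)
    (m1 : {sigma_finite_measure set T1 -> \bar R})
    (m2 : {sigma_finite_measure set T2 -> \bar R}) :
  sigma_finite setT (m1 \x m2)%E.
Proof.
have /sigma_finiteP[F [TF ndF Foo]] := sigma_finiteT m1.
have /sigma_finiteP[G [TG ndG Goo]] := sigma_finiteT m2.
exists (fun n => F n `*` G n).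
  rewrite -setXTT TF TG predeqE => -[x y]; split.
    move=> [/= [n _ Fnx] [k _ Gky]]; exists (maxn n k) => //; split.
    - by move: x Fnx; exact/subsetPset/ndF/leq_maxl.
    - by move: y Gky; exact/subsetPset/ndG/leq_maxr.
  by move=> [n _ []/= ? ?]; split; exists n.
move=> k; have [? ?] := Foo k; have [? ?] := Goo k.
split; first exact: measurableX.
by rewrite product_measure1E// lte_mul_pinfty// ge0_fin_numE.
Qed.

Section lebesgue_rV.
Context (R : realType).

Definition consv n (p : measurableTypeR R * 'rV[R]_n) : 'rV[R]_n.+1 :=
  row_mx p.1%:M p.2 : 'rV[R]_(1 + n).

Lemma measurable_consv n : measurable_fun setT (@consv n).
Proof.
apply: measurable_fun_rV => i; case: (splitP (i : 'I_(1 + n))) => j ij.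
- rewrite (_ : (fun t => _) = fst); first exact: measurable_fst.
  apply/funext => -[a v]; rewrite /consv /=.
  have -> : i = lshift n j by exact/val_inj.
  by apply: etrans (row_mxEl _ _ _ _) _; rewrite mxE (ord1 j).
- rewrite (_ : (fun t => _) = (fun v : 'rV[R]_n => v ord0 j) \o snd).
    apply: measurableT_comp; [exact: measurable_coord|exact: measurable_snd].
  apply/funext => -[a v]; rewrite /consv /=.
  have -> : i = rshift 1 j by exact/val_inj.
  exact: row_mxEr.
Qed.

Definition unconsv n (v : 'rV[R]_n.+1) : measurableTypeR R * 'rV[R]_n :=
  (v ord0 ord0, \row_j v ord0 (lift ord0 j)).

Lemma consvK n : cancel (@consv n) (@unconsv n).
Proof.
move=> [a v]; rewrite /unconsv /consv /=; congr pair.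
  rewrite (_ : ord0 = lshift n ord0 :> 'I_(1 + n)); last exact/val_inj.
  by apply: etrans (row_mxEl _ _ _ _) _; rewrite mxE.
apply/rowP => j; rewrite mxE.
rewrite (_ : lift ord0 j = rshift 1 j :> 'I_(1 + n)); last exact/val_inj.
exact: row_mxEr.
Qed.

Lemma measurable_unconsv n : measurable_fun setT (@unconsv n).
Proof.
apply: measurable_fun_pair; first exact: measurable_coord.
apply: measurable_fun_rV => j.
under eq_fun do rewrite mxE.
exact: measurable_coord.
Qed.

Section step.
Variables (n : nat) (mu : {sigma_finite_measure set 'rV[R]_n -> \bar R}).

Definition leb_step : set 'rV[R]_n.+1 -> \bar R :=
  pushforward (@lebesgue_measure R \x mu)%E (@consv n).

Let leb_step0 : leb_step set0 = 0%E.
Proof. by rewrite /leb_step /pushforward preimage_set0 measure0. Qed.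

Let leb_step_ge0 A : (0 <= leb_step A)%E.
Proof. exact: (measure_ge0 (@lebesgue_measure R \x mu)%E). Qed.

Let leb_step_sigma_additive : semi_sigma_additive leb_step.
Proof.
move=> F mF tF mUF; rewrite /leb_step.
by apply: measure_semi_sigma_additive => //; exact: measurable_consv.
Qed.

HB.instance Definition _ := isMeasure.Build _ _ _ leb_step
  leb_step0 leb_step_ge0 leb_step_sigma_additive.

Let leb_step_sigma_finite : sigma_finite setT leb_step.
Proof.
have [F TF mF] := sigma_finite_prod (@lebesgue_measure R) mu.
exists (fun k => @unconsv n @^-1` F k); first by rewrite -preimage_bigcup -TF.
move=> k; have [mFk Fkoo] := mF k; split.
  by rewrite -[X in measurable X]setTI; exact: measurable_unconsv.
rewrite /leb_step /pushforward -comp_preimage.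
rewrite (_ : _ \o _ = id) ?preimage_id//.
exact/funext/consvK.
Qed.

HB.instance Definition _ := Measure_isSigmaFinite.Build _ _ _ leb_step
  leb_step_sigma_finite.

End step.

Fixpoint borel_lebesgue n : {sigma_finite_measure set 'rV[R]_n -> \bar R} :=
  match n with
  | 0 => dirac (0 : 'rV[R]_0)
  | n'.+1 => leb_step (borel_lebesgue n')
  end.


End lebesgue_rV.

Section euclidean.
Context (R : realType) (n : nat).
Implicit Types x c : 'rV[R]_n.

(* The library's norm on ['rV_n] is the sup norm. *)
Definition enorm x : R := Num.sqrt (\sum_(i < n) x ord0 i ^+ 2).

Definition eball c (r : R) : set 'rV[R]_n := [set x | enorm (x - c) < r].

Definition sphere : set 'rV[R]_n := [set x | enorm x = 1].

Definition unitv x : 'rV[R]_n := (enorm x)^-1 *: x.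

Definition punctured_ball : set 'rV[R]_n := [set x | 0 < enorm x < 1].

Lemma measurable_enorm : measurable_fun setT enorm.
Proof.
apply: (@measurableT_comp _ _ _ _ _ _ (@Num.sqrt R)).
  apply: continuous_measurable_fun; exact: sqrt_continuous.
apply: measurable_sum => i.
by apply: measurable_funX; exact: measurable_coord.
Qed.

Lemma measurable_unitv : measurable_fun setT unitv.
Proof.
apply: measurable_fun_rV => i.
rewrite (_ : (fun x => _) = (fun x => (enorm x `^ (-1)) * x ord0 i)).
  apply: (@measurable_funM _ _ _ _ (fun x => enorm x `^ (-1))).
    apply: (@measurableT_comp _ _ _ _ _ _ (fun r : R => r `^ (-1))).
      exact: measurable_powR.
    exact: measurable_enorm.
  exact: measurable_coord.
by apply/funext => x; rewrite mxE powR_inv1// sqrtr_ge0.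
Qed.

Lemma measurable_punctured_ball : measurable punctured_ball.
Proof.
rewrite (_ : punctured_ball = enorm @^-1` `]0, 1[).
  by rewrite -[X in measurable X]setTI; exact: measurable_enorm.
by apply/seteqP; split => x /=; rewrite in_itv.
Qed.

End euclidean.

Section measures.
Context (R : realType) (n : nat).

(* Carathéodory-extending the Borel measures completes them. *)
Definition leb_space : measurableType _ :=
  caratheodory_type (mu_ext (borel_lebesgue R n)).

Definition leb : {measure set leb_space -> \bar R} :=
  @completed_measure_extension _ _ _ (borel_lebesgue R n).

Definition leb2_space : measurableType _ :=
  caratheodory_type (mu_ext (borel_lebesgue R n \x borel_lebesgue R n)%E).

Definition leb2 : {measure set leb2_space -> \bar R} :=
  @completed_measure_extension _ _ _ (borel_lebesgue R n \x borel_lebesgue R n)%E.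

(* The surface measure is
   sigma(A) = n |{x : 0 < |x| < 1, x/|x| \in A}|, that is, dx = r^(n-1) dr dsigma
   in polar coordinates. *)
Definition cone_measure : set 'rV[R]_n -> \bar R :=
  pushforward (mrestr (borel_lebesgue R n) (@measurable_punctured_ball R n))
    (@unitv R n).

Let cone_measure0 : cone_measure set0 = 0%E.
Proof. by rewrite /cone_measure /pushforward preimage_set0 measure0. Qed.

Let cone_measure_ge0 A : (0 <= cone_measure A)%E.
Proof. exact: (measure_ge0 (mrestr _ (@measurable_punctured_ball R n))). Qed.

Let cone_measure_sigma_additive : semi_sigma_additive cone_measure.
Proof.
move=> F mF tF mUF; rewrite /cone_measure.
by apply: measure_semi_sigma_additive => //; exact: measurable_unitv.
Qed.

HB.instance Definition _ := isMeasure.Build _ _ _ cone_measure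
  cone_measure0 cone_measure_ge0 cone_measure_sigma_additive.

Definition borel_area : {measure set 'rV[R]_n -> \bar R} :=
  mscale n%:R%:nng cone_measure.

Definition area_space : measurableType _ := caratheodory_type (mu_ext borel_area).

Definition area : {measure set area_space -> \bar R} :=
  @completed_measure_extension _ _ _ borel_area.

End measures.

Section complex_valued.
Context d (T : measurableType d) (R : realType).
Implicit Types (D : set T) (f : T -> R[i]).

Definition cmeasurable D f :=
  measurable_fun D (fun x => complex.Re (f x)) /\
  measurable_fun D (fun x => complex.Im (f x)).

Definition cintegral (mu : {measure set T -> \bar R}) D f : R[i] :=
  (\int[mu]_(x in D) complex.Re (f x)) +i* (\int[mu]_(x in D) complex.Im (f x)).

End complex_valued.

Section function_spaces.
Context (R : realType) (n : nat).
Local Notation Rn := 'rV[R]_n.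
Implicit Types (f g b Omega : Rn -> R[i]) (N : (Rn -> R[i]) -> \bar R)
  (B E F : set Rn).

Definition lmeasurable f := cmeasurable (T := leb_space R n) setT f.

Definition cindic (A : set Rn) : Rn -> R[i] := fun x => (\1_A x)%:C.

Local Notation mu := (leb R n).

(* [N f] is the norm of [f] in X, with [N f = +oo] when [f] is not in X. *)
Record ball_Banach N : Prop := BallBanach {
  bB_measurable f : (N f < +oo)%E -> lmeasurable f ;
  bB_ge0 f : (0 <= N f)%E ;
  bB_scale (c : R[i]) f : (N f < +oo)%E ->
    N (fun x => c * f x) = ((normc c)%:E * N f)%E ;
  bB_complete (u : nat -> Rn -> R[i]) :
    (forall k, (N (u k) < +oo)%E) ->
    (forall e : R, 0 < e -> exists K, forall p q, (K <= p)%N -> (K <= q)%N ->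
      (N (fun x => u p x - u q x)%R < e%:E)%E) ->
    exists2 f, (N f < +oo)%E &
      (fun k => N (fun x => u k x - f x)) @ \oo --> (0 : \bar R) ;
  bB_definite f : N f = 0%E -> {ae mu, forall x, f x = 0} ;
  bB_lattice f g : lmeasurable f -> lmeasurable g ->
    {ae mu, forall x, normc (g x) <= normc (f x)} -> (N g <= N f)%E ;
  bB_Fatou (u : nat -> Rn -> R) (v : Rn -> R) :
    (forall k, lmeasurable (fun x => (u k x)%:C)) ->
    lmeasurable (fun x => (v x)%:C) ->
    {ae mu, forall x, [/\ forall k, 0 <= u k x,
       nondecreasing_seq (u ^~ x) & u ^~ x @ \oo --> v x]} ->
    nondecreasing_seq (fun k => N (fun x => (u k x)%:C)) /\
    (fun k => N (fun x => (u k x)%:C)) @ \oo --> N (fun x => (v x)%:C) ;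
  bB_ball (c : Rn) (r : R) : 0 < r -> (N (cindic (eball c r)) < +oo)%E ;
  bB_triangle f g : lmeasurable f -> lmeasurable g ->
    (N (fun x => f x + g x)%R <= N f + N g)%E ;
  bB_integrable (c : Rn) (r : R) : 0 < r -> exists2 C : R, 0 < C &
    forall f, (N f < +oo)%E ->
      (\int[mu]_(x in eball c r) (normc (f x))%:E <= C%:E * N f)%E
}.

Definition associate_norm N f : \bar R :=
  ereal_sup [set (\int[mu]_x (normc (f x * g x)%R)%:E)%E | g in [set g | N g = 1%E]].

Definition ball_mean (c : Rn) (r : R) (h : Rn -> \bar R) : \bar R :=
  (((fine (mu (eball c r)))^-1)%R%:E * \int[mu]_(y in eball c r) h y)%E.

Definition maximal f (x : Rn) : \bar R :=
  ereal_sup [set z | exists c r, [/\ 0 < r, eball c r x &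
    z = ball_mean c r (fun y => (normc (f y))%:E)]].

(* [maximal f] takes values in [0, +oo]; being in X, it is finite a.e. *)
Definition maximal_bounded N := exists2 C : R, 0 < C &
  forall f, lmeasurable f -> (N f < +oo)%E ->
    {ae mu, forall x, (maximal f x < +oo)%E} /\
    (N (fun x => (fine (maximal f x))%:C) <= C%:E * N f)%E.

Definition ball_avg (c : Rn) (r : R) f : R[i] :=
  ((fine (mu (eball c r)))^-1)%:C * cintegral mu (eball c r) f.

Definition BMO_norm f : \bar R :=
  ereal_sup [set z | exists c r, 0 < r /\
    z = ball_mean c r (fun x => (normc (f x - ball_avg c r f))%:E)].

Definition locally_integrable f := lmeasurable f /\
  forall c r, 0 < r -> (\int[mu]_(x in eball c r) (normc (f x))%:E < +oo)%E.

Definition BMO f := locally_integrable f /\ (BMO_norm f < +oo)%E.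

Definition rearrangement f (t : \bar R) : \bar R :=
  ereal_inf [set a%:E | a in [set a : R |
    0 < a /\ (mu [set x | (a < normc (f x))%R] < t)%E]].

Definition mean_oscillation (lambda : R) f (c : Rn) (r : R) : \bar R :=
  ereal_inf [set rearrangement (fun x => (f x - z) * cindic (eball c r) x)
    (lambda%:E * mu (eball c r))%E | z in [set: R[i]]].

Definition homogeneous0 Omega := forall (t : R) (x : Rn),
  0 < t -> sphere x -> Omega (t *: x) = Omega x.

Definition sphere_open (L : set Rn) :=
  exists2 U : set Rn, open U & L = U `&` @sphere R n.

Definition Linfty_sphere Omega :=
  cmeasurable (T := area_space R n) (@sphere R n) Omega /\
  exists M : R, {ae area R n, forall x, sphere x -> normc (Omega x) <= M}.

(* The order of [R[i]] only compares numbers with the same imaginary part: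
   a function of constant sign is real-valued. *)
Definition constant_sign (T : Type) (A : set T) (h : T -> R[i]) :=
  (forall x, A x -> 0 <= h x) \/ (forall x, A x -> h x <= 0).

Definition kernel Omega (z : Rn) : R[i] := Omega z / (enorm z ^+ n)%:C.

Definition truncated_integral Omega f (x : Rn) (eps : R) : R[i] :=
  cintegral mu [set y | eps < enorm (x - y)] (fun y => kernel Omega (x - y) * f y).

Definition singular_integral Omega f (x : Rn) : R[i] :=
  lim (complex.Re (truncated_integral Omega f x eps) @[eps --> 0^'+]) +i*
  lim (complex.Im (truncated_integral Omega f x eps) @[eps --> 0^'+]).

Definition commutator b Omega f (x : Rn) : R[i] :=
  b x * singular_integral Omega f x -
  singular_integral Omega (fun y => b y * f y) x.

Definition admissible b Omega (lambda eps0 k0 : R) (x0 : Rn) (r0 : R) (x1 : Rn)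
    E F (G : set (Rn * Rn)) :=
  [/\ enorm (x1 - x0) = 2 * k0 * r0,
      [/\ measurable (E : set (leb_space R n)), E `<=` eball x0 r0 &
          mu E = ((lambda / 2)%R%:E * mu (eball x0 r0))%E],
      [/\ measurable (F : set (leb_space R n)), F `<=` eball x1 r0 &
          mu F = ((2^-1)%R%:E * mu (eball x1 r0))%E],
      [/\ measurable (G : set (leb2_space R n)), G `<=` E `*` F &
          ((lambda / 8)%R%:E * (mu (eball x0 r0) * mu (eball x0 r0)) <=
            leb2 R n G)%E] &
      [/\ forall x y, E x -> F y ->
            (mean_oscillation lambda b x0 r0 <= (normc (b x - b y)%R)%:E)%E,
          constant_sign (E `*` F) (fun p => Omega (unitv (p.1 - p.2))),
          constant_sign (E `*` F) (fun p => b p.1 - b p.2) &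
          forall x y, G (x, y) -> eps0 <= normc (Omega (unitv (x - y)))]].

End function_spaces.

(* Main.v *)
(* On the annulus the principal value is an honest integral over F, so for every
   constant c
     |[b,T](1_F)(x)| <= C 2^(-dn) r0^(-n) (|F| |b(x) - c| + int_F |b - c|).
   Take c to be the mean of b over a cube Q of side about 2^d r0 containing the
   annulus. Three facts bound the X-norm of the right-hand side.
   (A) ||(b - b_Q) 1_Q||_X <= C ||b||_BMO ||1_Q||_X. By duality (the Lorentz-Luxemburg
       theorem) it suffices to bound int_Q |b - b_Q| g for g in X'; a stopping-time
       argument on a binary tree of boxes bounds it by ||b||_BMO int_Q M g, and M is
       bounded on X'.
   (B) ||1_(2^L Q)||_X <= (2^(Ln) / 2) ||1_Q||_X for some L. Since M 1_Q >= c 2^(-jn) on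
       2^j Q, the integral of M 1_Q over 2^L Q grows linearly in L, and applying M
       once more gains a factor 1/L over the trivial growth 2^(Ln). Iterating d/L
       times gives the decay, with delta = 1/(L n).
   (C) int_F |b - b_Q| <= C d ||b||_BMO r0^n, by telescoping over dilated cubes. *)
Require Import Defs.
From HB Require Import structures.
From mathcomp Require Import all_boot all_order all_algebra.
From mathcomp Require Import complex ring lra.
From mathcomp Require Import all_classical all_reals all_analysis.
From mathcomp Require Import measurable_realfun.
Import Order.TTheory GRing.Theory Num.Theory.
Import numFieldNormedType.Exports Normc.

Local Open Scope classical_set_scope.
Local Open Scope ring_scope.
Local Open Scope complex_scope.

Set Implicit Arguments.
Unset Strict Implicit.
Unset Printing Implicit Defensive.

(** * Completion of a measure *)

(** The volume of the annulus exactly offsets the kernel bound 2^(-dn): with the trivial growth of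
    norms of indicators, (A) and (C) would give no decay, so the whole gain comes from (B). Its
    source is a logarithmic divergence: M 1_Q decays like an inverse volume, and all dyadic shells
    around Q carry comparable mass. The factor d counts the doublings between F and the annulus.

    In (A) a first-power bound against g suffices: stopped boxes fill at most half of their
    ancestor, and the averages of g over them are summed into a maximal function along the tree.

    The technical obstacle is measurability. Lebesgue measure is a completion, whereas Tonelli is
    applied to the Borel product; Omega is controlled only almost everywhere on the sphere.
    Functions are therefore replaced by Borel versions off null sets before a parameter is
    integrated out. Measurability of M f is read off from the finiteness of its norm in X, and on
    the side of X' a measurable minorant of M g is integrated instead. *)

Section completion.
Context d (T : measurableType d) (R : realType).
Variable mu : {measure set T -> \bar R}.

Let C : measurableType _ := caratheodory_type (mu_ext mu).
Local Notation cmu := (@completed_measure_extension _ _ _ mu).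

Lemma completed_measurable (A : set T) : measurable A -> measurable (A : set C).
Proof. exact: caratheodory_measurable_mu_ext. Qed.

Lemma completedE (A : set T) : measurable A -> cmu A = mu A.
Proof. exact: measurable_mu_extE. Qed.

(** Intersecting countable covers whose measures exceed the outer measure by at most 1/(k+1) gives a
    hull of exactly that measure. *)
Lemma mu_ext_hull (A : set T) :
  exists H, [/\ measurable H, A `<=` H & mu H = mu_ext mu A].
Proof.
have [Aoo|Aoo] := eqVneq (mu_ext mu A) +oo%E.
  exists setT; split => //; rewrite Aoo; apply/eqP; rewrite -leye_eq -Aoo.
  by rewrite -(measurable_mu_extE mu measurableT); exact: le_mu_ext.
have Afin : mu_ext mu A \is a fin_num.
  by rewrite ge0_fin_numE ?mu_ext_ge0// ltey.
have cov (k : nat) : exists B, [/\ measurable B, A `<=` B &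
    (mu B <= mu_ext mu A + (k.+1%:R^-1)%:E)%E].
  have k0 : 0 < k.+1%:R^-1 :> R by rewrite invr_gt0.
  have [_ [F [mF AF] <-] ltF] := lb_ereal_inf_adherent k0 Afin.
  exists (\bigcup_i F i); split => //; first exact: bigcupT_measurable.
  apply: (le_trans _ (ltW ltF)).
  apply: measure_sigma_subadditive => //; exact: bigcupT_measurable.
have {cov}[B /all_and3[mB AB muB]] := choice cov.
exists (\bigcap_i B i); split.
- exact: bigcapT_measurable.
- by move=> x Ax i _; exact: AB.
- apply/eqP; rewrite eq_le; apply/andP; split; last first.
    rewrite -(measurable_mu_extE mu); last exact: bigcapT_measurable.
    by apply: le_mu_ext => x Ax i _; exact: AB.
  apply/lee_addgt0Pr => e e0.
  have [k ke] : exists k : nat, k.+1%:R^-1 < e.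
    near \oo => k; exists k; near: k; exact: near_infty_natSinv_lt (PosNum e0).
  apply: (le_trans _ (le_trans (muB k) _)).
    apply: le_measure; rewrite ?inE//; first exact: bigcapT_measurable.
    exact: bigcap_inf.
  by rewrite leeD2l// lee_fin ltW.
Unshelve. all: by end_near. Qed.

Lemma completed_null_hull (N : set T) : cmu N = 0%E ->
  exists H, [/\ measurable H, N `<=` H & mu H = 0%E].
Proof. by move=> N0; have [H [? ? HN]] := mu_ext_hull N; exists H; split => //; rewrite HN. Qed.

Lemma completed_negligibleP (N : set T) :
  cmu.-negligible N <-> mu.-negligible N.
Proof.
split=> [[A [mA A0 NA]]|[A [mA A0 NA]]].
  have [H [mH AH H0]] := completed_null_hull A0.
  by exists H; split => //; exact: subset_trans AH.
exists A; split => //; last by rewrite -A0 completedE.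
exact: completed_measurable.
Qed.

Hypothesis sfmu : sigma_finite setT mu.

(** On a piece [F k] of finite measure the hull of [A] exceeds it by a null set; removing a
    measurable null hull of this excess leaves a measurable set. The union of these null hulls
    serves for [A]. *)
Lemma completed_measurableP (A : set T) : measurable (A : set C) ->
  exists N, [/\ measurable N, mu N = 0%E & measurable (A `\` N)].
Proof.
move=> mA; have /sigma_finiteP[F [TF ndF Foo]] := sfmu.
have piece (k : nat) : exists N, [/\ measurable N, mu N = 0%E &
    measurable ((A `&` F k) `\` N)].
  have [mFk Fkoo] := Foo k.
  have mAF : measurable (A `&` F k : set C).
    by apply: measurableI => //; exact: completed_measurable.
  have AFoo : (mu_ext mu (A `&` F k) < +oo)%E.
    apply: (@le_lt_trans _ _ (mu_ext mu (F k))).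
      by apply: le_mu_ext; exact: subIsetr.
    by rewrite measurable_mu_extE.
  have [H [mH AH HA]] := mu_ext_hull (A `&` F k).
  have HA0 : cmu (H `\` (A `&` F k)) = 0%E.
    rewrite measureD//=.
    - rewrite setIidr// completedE// HA subee//.
      by rewrite ge0_fin_numE ?mu_ext_ge0.
    - exact: completed_measurable.
    - by rewrite completedE// HA.
  have [N [mN HN N0]] := completed_null_hull HA0.
  exists N; split => //.
  rewrite (_ : _ `\` N = H `\` N); first exact: measurableD.
  apply/seteqP; split => x [Hx Nx]; split => //; first exact: AH.
  by apply: contrapT => AFx; apply: Nx; exact: HN.
have {piece}[N /all_and3[mN N0 mAN]] := choice piece.
exists (\bigcup_k N k); split.
- exact: bigcupT_measurable.
- apply/negligibleP; first exact: bigcupT_measurable.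
  apply: negligible_bigcup => k; exact: (negligibleP mu (mN _)).2 (N0 _).
- rewrite (_ : _ `\` _ = \bigcup_k ((A `&` F k) `\` N k) `\` \bigcup_k N k).
    apply: measurableD; exact: bigcupT_measurable.
  apply/seteqP; split => x [].
    move=> Ax Nx; split => //.
    have : setT x by [].
    by rewrite TF => -[k _ Fkx]; exists k => //; split => // Nkx; apply: Nx; exists k.
  by move=> [k _ [[Ax _] _]] Nx.
Qed.

(** One null set per rational level makes every superlevel set measurable, and rational levels
    determine [f]. On the exceptional set the function becomes 0, so that set lies in the superlevel
    sets of negative levels only. *)
Lemma completed_measurable_funP (f : T -> R) :
  measurable_fun setT (f : C -> R) ->
  exists N, [/\ measurable N, mu N = 0%E &
    measurable_fun setT (fun x => f x * \1_(~` N) x)].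
Proof.
move=> mf.
have piece (q : rat) : exists N, [/\ measurable N, mu N = 0%E &
    measurable ([set x | ratr q < f x] `\` N)].
  apply: completed_measurableP.
  rewrite (_ : [set x | _] = setT `&` f @^-1` `]ratr q, +oo[).
    by apply: mf => //; exact: measurable_itv.
  by rewrite setTI; apply/seteqP; split => x /=; rewrite in_itv/= andbT.
have [N /all_and3[mN N0 mfN]] := choice piece.
(* [unpickle] enumerates the rationals; [odflt 0] merely repeats [N 0] at indices that code
   nothing. *)
pose M := \bigcup_k N (odflt 0 (unpickle k)).
have mM : measurable M by exact: bigcupT_measurable.
exists M; split => //.
  apply/negligibleP => //; apply: negligible_bigcup => k.
  exact: (negligibleP mu (mN _)).2 (N0 _).
have NM q : N q `<=` M by move=> x Nx; exists (pickle q) => //; rewrite pickleK.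
apply: (measurability _ (RGenOInfty.measurableE R)) => //.
move=> _ [_ [a ->] <-]; rewrite setTI.
rewrite (_ : _ @^-1` _ = (\bigcup_q (if a < ratr q then
    ([set x | ratr q < f x] `\` N q) `\` M else set0)) `|` (if a < 0 then M else set0)).
  apply: measurableU; last by case: ifP.
  by apply: bigcupT_measurable_rat => q; case: ifP => // _; exact: measurableD.
apply/seteqP; split => x /=.
  rewrite in_itv/= andbT indicE; have [Mx|Mx] := pselect (M x).
    by rewrite memNset ?mulr0// => a0; right; rewrite a0.
  rewrite mem_set// mulr1 => afx; left.
  have [q aq qf] : exists2 q : rat, a < ratr q & ratr q < f x.
    by have [q] := rat_in_itvoo afx; rewrite in_itv/= => /andP[]; exists q.
  by exists q => //; rewrite aq; split=> //; split=> // Nx; apply: Mx; exact: NM Nx.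
move=> [[q _]|].
  case: ifPn => // aq [[/= qf _] Mx].
  by rewrite in_itv/= andbT indicE mem_set// mulr1 (lt_trans aq).
case: ifPn => // a0 Mx.
by rewrite in_itv/= andbT indicE memNset ?mulr0//.
Qed.

(** The identity from the completed space to the original one is measurable and carries the
    completed measure to [mu]. *)
Lemma completed_ge0_integral (f : T -> \bar R) : measurable_fun setT f ->
  (forall x, 0 <= f x)%E -> (\int[cmu]_x f x = \int[mu]_x f x)%E.
Proof.
move=> mf f0.
have mid : measurable_fun setT (idfun : C -> T).
  by move=> _ A mA; rewrite setTI; exact: completed_measurable.
transitivity (\int[pushforward cmu (idfun : C -> T)]_x f x)%E.
  by rewrite ge0_integral_pushforward// preimage_setT.
apply: eq_measure_integral => A mA _.
exact: completedE.
Qed.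

Lemma completed_integral (f : T -> \bar R) : measurable_fun setT f ->
  (\int[cmu]_x f x = \int[mu]_x f x)%E.
Proof.
move=> mf; rewrite [LHS]integralE [RHS]integralE.
rewrite (completed_ge0_integral (measurable_funepos mf))//.
by rewrite (completed_ge0_integral (measurable_funeneg mf)).
Qed.

Lemma completed_measurable_fun (f : T -> R) : measurable_fun setT f ->
  measurable_fun setT (f : C -> R).
Proof.
move=> mf _ A mA; rewrite setTI; apply: completed_measurable.
by rewrite -[X in measurable X]setTI; exact: mf.
Qed.

End completion.

(** * Lebesgue measure under affine maps *)

Section lebesgue_affine.
Context (R : realType).
Local Notation leb1 := (@lebesgue_measure R).

Definition affine1 (t c : R) : measurableTypeR R -> measurableTypeR R :=
  fun y => c + t * y.

Lemma measurable_affine1 t c : measurable_fun setT (affine1 t c).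
Proof.
apply: (@measurable_funD _ _ _ _ (cst c) (fun y => t * y)) => //.
exact: (@measurable_funM _ _ _ _ (cst t) id).
Qed.

(** By uniqueness of Lebesgue measure: [|t|] times the image measure has the right value on
    half-open intervals. A negative [t] exchanges the closed and the open end, hence two
    computations. *)
Lemma lebesgue_measure_affine t c (A : set (measurableTypeR R)) : t != 0 ->
  measurable A -> leb1 (affine1 t c @^-1` A) = (`|t|^-1%:E * leb1 A)%E.
Proof.
move=> t0 mA.
pose p : {measure set (measurableTypeR R) -> \bar R} :=
  measure_function_pushforward__canonical__measure_function_Measure leb1 (measurable_affine1 t c).
pose m : {measure set (measurableTypeR R) -> \bar R} := mscale (NngNum (normr_ge0 t)) p.
have -> : leb1 A = m A.
  apply: lebesgue_measure_unique => //= _ [[a b]] _ <-.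
  rewrite /m /= /mscale /= /pushforward.
  have [tp|tn] := ltrP 0 t.
    rewrite (_ : _ @^-1` _ = `](a - c) / t, (b - c) / t]%classic); last first.
      apply/seteqP; split => x /=; rewrite /affine1 !in_itv/=.
        by rewrite ltr_pdivrMr// ler_pdivlMr// ltrBlDl lerBrDl mulrC.
      by rewrite ltr_pdivrMr// ler_pdivlMr// ltrBlDl lerBrDl mulrC.
    rewrite !lebesgue_measure_itv/= !lte_fin.
    rewrite ltr_pM2r ?invr_gt0// ltrD2r; case: ifPn => _; last by rewrite mule0.
    rewrite -!EFinD -EFinM gtr0_norm//; congr EFin; field; exact: lt0r_neq0.
  have {t0 tn} tn : t < 0 by rewrite lt_neqAle t0.
  rewrite (_ : _ @^-1` _ = `[(b - c) / t, (a - c) / t[%classic); last first.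
    apply/seteqP; split => x /=; rewrite /affine1 !in_itv/=.
      by rewrite ler_ndivrMr// ltr_ndivlMr// ltrBlDl lerBrDl mulrC andbC.
    by rewrite ler_ndivrMr// ltr_ndivlMr// ltrBlDl lerBrDl mulrC andbC.
  rewrite !lebesgue_measure_itv/= !lte_fin.
  rewrite ltr_nM2r ?invr_lt0// ltrD2r; case: ifPn => _; last by rewrite mule0.
  rewrite -!EFinD -EFinM ltr0_norm//; congr EFin; field; exact: ltr0_neq0.
rewrite /m /= /mscale/= /pushforward muleA -EFinM mulVf ?mul1e//.
by rewrite normr_eq0.
Qed.

Local Notation lebn := (borel_lebesgue R).

Lemma borel_lebesgueS n (A : set 'rV[R]_n.+1) :
  lebn n.+1 A = (leb1 \x lebn n)%E (@consv R n @^-1` A).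
Proof. by []. Qed.

Definition affine n (t : R) (c : 'rV[R]_n) : 'rV[R]_n -> 'rV[R]_n :=
  fun y => c + t *: y.

Lemma measurable_affine n t (c : 'rV[R]_n) : measurable_fun setT (affine t c).
Proof.
apply: measurable_fun_rV => i.
rewrite (_ : (fun x => _) = (fun x : 'rV[R]_n => c ord0 i + t * x ord0 i)).
  apply: (@measurable_funD _ _ _ _ (cst _)) => //.
  apply: (@measurable_funM _ _ _ _ (cst t)) => //.
  exact: measurable_coord.
by apply/funext => x; rewrite !mxE.
Qed.

Lemma consvE0 n (p : measurableTypeR R * 'rV[R]_n) : consv p ord0 ord0 = p.1.
Proof. exact: (congr1 fst (consvK p)). Qed.

Lemma consvES n (p : measurableTypeR R * 'rV[R]_n) j :
  consv p ord0 (lift ord0 j) = p.2 ord0 j.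
Proof. by have /(congr1 snd)/rowP/(_ j) := consvK p; rewrite mxE. Qed.

Lemma eq_unconsv n (v w : 'rV[R]_n.+1) : unconsv v = unconsv w -> v = w.
Proof.
move=> [vw0 /rowP vw]; apply/rowP => i; case: (unliftP ord0 i) => [j|] ->//.
by have := vw j; rewrite !mxE.
Qed.

Lemma affineE n t (c y : 'rV[R]_n) i0 i : affine t c y i0 i = c i0 i + t * y i0 i.
Proof. by rewrite !mxE. Qed.

Lemma affine_consv n t (c : 'rV[R]_n.+1) :
  affine t c \o @consv R n =
  @consv R n \o (fun p => (affine1 t (unconsv c).1 p.1, affine t (unconsv c).2 p.2)).
Proof.
apply/funext => p /=; apply: eq_unconsv; rewrite consvK /unconsv; congr pair.
  by rewrite affineE consvE0.
by apply/rowP => j; rewrite mxE [LHS]affineE [RHS]affineE mxE consvES !(ord1 0).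
Qed.

(** Induction on the dimension: through [consv] the map acts on each factor separately, and
    uniqueness of the product measure reduces the claim to rectangles. *)
Lemma borel_lebesgue_affine n t (c : 'rV[R]_n) (A : set 'rV[R]_n) : t != 0 ->
  measurable A -> lebn n (affine t c @^-1` A) = ((`|t|^-1 ^+ n)%:E * lebn n A)%E.
Proof.
move=> t0; elim: n => [|n IH] in c A *.
  move=> mA; rewrite expr0 mul1e; congr (lebn 0 _).
  by apply/seteqP; split => x; rewrite /= (thinmx0 (affine _ _ _)) (thinmx0 x).
move=> mA; rewrite !borel_lebesgueS -comp_preimage affine_consv comp_preimage.
set f := (X in X @^-1` _).
have mf : measurable_fun setT f.
  apply/prod_measurable_funP; split.
    exact: (measurableT_comp (@measurable_affine1 t _) measurable_fst).
  exact: (measurableT_comp (@measurable_affine n t _) measurable_snd).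
pose p : {measure set _ -> \bar R} :=
  measure_function_pushforward__canonical__measure_function_Measure
    (leb1 \x lebn n)%E mf.
have tn0 : 0 <= `|t| ^+ n.+1 by rewrite exprn_ge0.
pose m : {measure set _ -> \bar R} := mscale (NngNum tn0) p.
have mcA : measurable (@consv R n @^-1` A).
  by rewrite -[X in measurable X]setTI; exact: measurable_consv.
have mE : (leb1 \x lebn n)%E (@consv R n @^-1` A) = m (@consv R n @^-1` A).
  apply: product_measure_unique => // A1 A2 mA1 mA2; rewrite /m/= /mscale/= /pushforward.
  rewrite (_ : f @^-1` _ = (affine1 t (unconsv c).1 @^-1` A1) `*` (affine t (unconsv c).2 @^-1` A2))//.
  rewrite product_measure1E; last 2 first.
    by rewrite -[X in measurable X]setTI; exact: measurable_affine1.
    by rewrite -[X in measurable X]setTI; exact: measurable_affine.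
  rewrite /= lebesgue_measure_affine// IH// muleACA muleA -EFinM.
  rewrite -(muleA _ (leb1 A1)) (muleA _%:E _%:E) -EFinM -exprS -exprMn.
  by rewrite mulfV ?normr_eq0// expr1n mul1e.
rewrite mE /m/= /mscale/= /pushforward muleA -EFinM -exprMn mulVf ?normr_eq0//.
by rewrite expr1n mul1e.
Qed.

Definition box n (a b : 'rV[R]_n) : set 'rV[R]_n :=
  [set x | forall i, a ord0 i <= x ord0 i < b ord0 i].

Lemma measurable_box n (a b : 'rV[R]_n) : measurable (box a b).
Proof.
rewrite (_ : box a b = \bigcap_i ((fun x : 'rV[R]_n => x ord0 i) @^-1` `[a ord0 i, b ord0 i[)).
  apply: fin_bigcap_measurable => // i _.
  rewrite -[X in measurable X]setTI; exact: measurable_coord.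
apply/seteqP; split => x /= h i => [_|].
  by rewrite /= in_itv/=; exact: h.
by have := h i I; rewrite /= in_itv.
Qed.

Lemma borel_lebesgue_box n (a b : 'rV[R]_n) :
  (forall i, a ord0 i <= b ord0 i) ->
  lebn n (box a b) = (\prod_(i < n) (b ord0 i - a ord0 i))%:E.
Proof.
elim: n => [|n IH] in a b *.
  by move=> _; rewrite big_ord0 /= diracE mem_set// => -[].
move=> ab; rewrite borel_lebesgueS.
rewrite (_ : _ @^-1` _ = `[a ord0 ord0, b ord0 ord0[%classic `*` box (unconsv a).2 (unconsv b).2).
  rewrite product_measure1E//; last exact: measurable_box.
  rewrite /= lebesgue_measure_itv/= lte_fin IH; last by move=> i; rewrite !mxE.
  rewrite big_ord_recl EFinM; congr (_ * _)%E.
    have := ab ord0; rewrite le_eqVlt => /predU1P[->|->//].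
    by rewrite ltxx subrr.
  by congr EFin; apply: eq_bigr => i _; rewrite !mxE.
apply/seteqP; split => p /=.
  move=> h; split; first by have := h ord0; rewrite consvE0 in_itv.
  by move=> i; have := h (lift ord0 i); rewrite consvES !mxE.
move=> [p1 p2] i; case: (unliftP ord0 i) => [j|] ->.
  by have := p2 j; rewrite consvES !mxE.
by rewrite consvE0; move: p1; rewrite in_itv.
Qed.

End lebesgue_affine.

(** * Stopping times on binary trees of sets *)

Section real_integrable.
Context d (T : measurableType d) (R : realType).
Variable mu : {measure set T -> \bar R}.
Implicit Types (D : set T) (f g h : T -> R).
Local Notation rint D f := (mu.-integrable D (EFin \o f)).

Lemma rintD D f g : measurable D -> rint D f -> rint D g ->
  rint D (fun x => f x + g x).
Proof. by move=> mD fi gi; have := integrableD mD fi gi; apply: eq_integrable. Qed.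

Lemma rintB D f g : measurable D -> rint D f -> rint D g ->
  rint D (fun x => f x - g x).
Proof. by move=> mD fi gi; have := integrableB mD fi gi; apply: eq_integrable. Qed.

Lemma rintZ D (c : R) f : measurable D -> rint D f -> rint D (fun x => c * f x).
Proof. by move=> mD fi; have := integrableZl mD c fi; apply: eq_integrable. Qed.

Lemma rint_cst D (c : R) : measurable D -> (mu D < +oo)%E -> rint D (cst c).
Proof. move=> mD Doo; apply: (measurable_bounded_integrable mD Doo) => //.
exact: bounded_cst. Qed.

Lemma rint_norm D f : rint D f -> rint D (fun x => `|f x|).
Proof. exact: integrable_norm. Qed.

Lemma rint_measurable D f : measurable D -> rint D f -> measurable_fun D f.
Proof. by move=> mD /integrableP[/measurable_EFinP]. Qed.

Lemma rint_le D f g : measurable D -> measurable_fun D f -> rint D g ->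
  (forall x, D x -> `|f x| <= `|g x|) -> rint D f.
Proof.
move=> mD mf gi fg; apply: (le_integrable mD _ _ gi); first exact/measurable_EFinP.
by move=> x Dx; rewrite /= lee_fin fg.
Qed.

Lemma rint_bounded D f (M : R) : measurable D -> (mu D < +oo)%E ->
  measurable_fun D f -> (forall x, D x -> `|f x| <= M) -> rint D f.
Proof.
move=> mD Doo mf fM; apply: (rint_le mD mf (rint_cst M mD Doo)) => x Dx.
exact: (le_trans (fM x Dx) (ler_norm _)).
Qed.

Lemma rintMb D f g (M : R) : measurable D -> rint D f -> measurable_fun D g ->
  (forall x, D x -> `|g x| <= M) -> rint D (fun x => f x * g x).
Proof.
move=> mD fi mg gM; apply: (rint_le mD _ (rintZ M mD fi)).
  apply: measurable_funM => //; exact: rint_measurable fi.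
move=> x Dx; rewrite !normrM mulrC ler_wpM2r//.
exact: (le_trans (gM x Dx) (ler_norm _)).
Qed.

Lemma rintS D E f : measurable D -> measurable E -> E `<=` D ->
  rint D f -> rint E f.
Proof. by move=> mD mE ED; exact: integrableS. Qed.

Lemma Rintegral_le_subset D E f : measurable D -> measurable E -> E `<=` D ->
  rint D f -> (forall x, D x -> 0 <= f x) ->
  \int[mu]_(x in E) f x <= \int[mu]_(x in D) f x.
Proof.
move=> mD mE ED fi f0; apply: fine_le.
- by apply: integrable_fin_num => //; exact: rintS fi.
- exact: integrable_fin_num.
- by apply: ge0_subset_integral => //; case/integrableP: fi.
Qed.

Lemma Rintegral_EFin D f : measurable D -> rint D f ->
  (\int[mu]_(x in D) f x)%:E = (\int[mu]_(x in D) (f x)%:E)%E.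
Proof. by move=> mD fi; rewrite fineK//; exact: integrable_fin_num. Qed.

End real_integrable.

(** * The stopping-time estimate on a tree *)

Section tree.
Context d (T : measurableType d) (R : realType).
Variable mu : {measure set T -> \bar R}.
Local Notation rint D f := (mu.-integrable D (EFin \o f)).
Variables (B : Type) (S : B -> set T) (ch : bool -> B -> B).
Hypothesis mS : forall P, measurable (S P).
Hypothesis chU : forall P, S P = S (ch false P) `|` S (ch true P).
Hypothesis chI : forall P, [disjoint S (ch false P) & S (ch true P)].
Local Notation V P := (fine (mu (S P))).
Hypothesis finS : forall P, (mu (S P) < +oo)%E.
Hypothesis V_gt0 : forall P, 0 < V P.
Hypothesis V_half : forall e P, V (ch e P) = V P / 2.

Local Notation I f P := (\int[mu]_(x in S P) (f x)).

Definition tavg (f : T -> R) P : R := I f P / V P.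

Fixpoint leafsum (h : B -> R) N P : R :=
  if N is N'.+1 then leafsum h N' (ch false P) + leafsum h N' (ch true P)
  else h P.

Lemma ch_sub e P : S (ch e P) `<=` S P.
Proof. by rewrite (chU P); case: e => x ?; [right|left]. Qed.

Lemma leafsum_le h1 h2 : (forall P, h1 P <= h2 P) ->
  forall N P, leafsum h1 N P <= leafsum h2 N P.
Proof. by move=> h12; elim=> //= N IH P; apply: lerD. Qed.

Lemma leafsumD h1 h2 N P :
  leafsum (fun P => h1 P + h2 P) N P = leafsum h1 N P + leafsum h2 N P.
Proof. by elim: N P => //= N IH P; rewrite !IH addrACA. Qed.

Lemma leafsumZ c h N P : leafsum (fun P => c * h P) N P = c * leafsum h N P.
Proof. by elim: N P => //= N IH P; rewrite !IH mulrDr. Qed.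

Lemma tree_split f P : rint (S P) f -> I f P = I f (ch false P) + I f (ch true P).
Proof.
move=> fi; rewrite {1}(chU P) Rintegral_setU//; first by rewrite -chU.
Qed.

Lemma tavg_dist f c P : rint (S P) f ->
  `|tavg f P - c| * V P <= \int[mu]_(x in S P) `|f x - c|.
Proof.
move=> fi; have ci := rint_cst c (mS P) (finS P).
rewrite -[X in _ * X]gtr0_norm// -normrM mulrBl divfK ?gt_eqF//.
rewrite -Rintegral_cst// -RintegralB//; apply: le_normr_Rintegral => //.
exact: rintB.
Qed.

Variables (f g : T -> R) (G : R).
Hypothesis fi : forall P, rint (S P) f.
Hypothesis mg : measurable_fun setT g.
Hypothesis g0 : forall x, 0 <= g x.
Hypothesis gG : forall x, g x <= G.

Let gi P : rint (S P) g.
Proof.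
apply: (@rint_bounded _ _ _ _ _ _ G) => //; first exact: measurable_funTS.
by move=> x _; rewrite ger0_norm.
Qed.

Let fci c P : rint (S P) (fun x => `|f x - c|).
Proof. by apply: rint_norm; apply: rintB => //; exact: rint_cst. Qed.

Let fcgi c P : rint (S P) (fun x => `|f x - c| * g x).
Proof.
apply: (@rintMb _ _ _ _ _ _ _ G) => //; first exact: measurable_funTS.
by move=> x _; rewrite ger0_norm.
Qed.

(** Integral over [S P] of the maximal function built from the averages of [g] on the first [N + 1]
    levels of the tree, floored at [m]. *)
Fixpoint treemax N P m : R :=
  if N is N'.+1 then treemax N' (ch false P) (Num.max m (tavg g P)) +
                     treemax N' (ch true P) (Num.max m (tavg g P))
  else V P * Num.max m (tavg g P).

Lemma treemax_mono N P m1 m2 : m1 <= m2 -> treemax N P m1 <= treemax N P m2.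
Proof.
elim: N P m1 m2 => [|N IH] P m1 m2 m12 /=.
  by rewrite ler_wpM2l ?fine_ge0// ge_max le_max m12/= le_max lexx orbT.
have h : Num.max m1 (tavg g P) <= Num.max m2 (tavg g P).
  by rewrite ge_max le_max m12/= le_max lexx orbT.
by apply: lerD; apply: IH.
Qed.

Lemma treemax_ge N P m : m * V P <= treemax N P m.
Proof.
elim: N P m => [|N IH] P m /=.
  by rewrite mulrC ler_wpM2l ?fine_ge0// le_max lexx.
apply: (@le_trans _ _ (m * V (ch false P) + m * V (ch true P))).
  by rewrite !V_half; lra.
apply: lerD; apply: le_trans (IH _ _); rewrite ler_wpM2r ?fine_ge0//;
  by rewrite le_max lexx.
Qed.

(** The first level already raises the floor to at least [tavg g P], so restarting at a stopped box
    with that average as the new floor does not increase the sum. *)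
Lemma treemax_avg N P m : treemax N P (tavg g P) <= treemax N P m.
Proof.
case: N => [|N] /=; rewrite maxxx.
  by rewrite ler_wpM2l ?fine_ge0// le_max lexx orbT.
by apply: lerD; apply: treemax_mono; rewrite le_max lexx orbT.
Qed.

Local Notation A c P := (\int[mu]_(x in S P) `|f x - c|).
Local Notation Ag c P := (\int[mu]_(x in S P) (`|f x - c| * g x)).
Definition tosc P := A (tavg f P) P.
Definition toscg P := Ag (tavg f P) P.

Lemma Ag_avg c P : Ag c P <= `|tavg f P - c| * I g P + toscg P.
Proof.
rewrite -RintegralZl// -RintegralD//; last exact: rintZ.
apply: le_Rintegral => //; first by apply: rintD => //; exact: rintZ.
move=> x _; rewrite -mulrDl ler_wpM2r//.
by rewrite (le_trans (ler_distD (tavg f P) _ _))// addrC.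
Qed.

(* [m] is the average of [g] over the last stopping box, and [c] that of [f].
   A box is stopped when the mean of [|f - c|] exceeds [2 kappa]; the stopped
   boxes fill at most half of their ancestor, hence the term
   [m * (A c P - 2 kappa V P)], which pays for the part already stopped. *)
Lemma tree_bound (kappa : R) : 0 <= kappa ->
  (forall P, tosc P <= kappa * V P) ->
  forall N P c m, 0 <= m -> `|tavg f P - c| <= 4 * kappa ->
  Ag c P <= 4 * kappa * I g P +
    4 * (2 * kappa * treemax N P m - 2 * kappa * m * V P + m * A c P) +
    leafsum toscg N P.
Proof.
move=> k0 osck; elim=> [|N IH] P c m m0 ck.
  apply: (le_trans (Ag_avg c P)); rewrite /=.
  have h1 : `|tavg f P - c| * I g P <= 4 * kappa * I g P.
    by rewrite ler_wpM2r// Rintegral_ge0.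
  have h2 : m * V P <= treemax 0 P m by exact: treemax_ge.
  have h3 : 0 <= m * A c P by rewrite mulr_ge0// Rintegral_ge0.
  rewrite /= in h2; nra.
(* Used twice: with the given [c] and [m] when [P] is not stopped, and with the averages over [P]
   just after a stop. *)
have nonstop c' m' : 0 <= m' -> A c' P <= 2 * kappa * V P ->
  Ag c' P <= 4 * kappa * I g P +
    4 * (2 * kappa * treemax N.+1 P m' - 2 * kappa * m' * V P + m' * A c' P) +
    leafsum toscg N.+1 P.
  move=> m'0 Ac'.
  (* Halving the volume at most doubles the mean of [|f - c'|], which is at most [2 * kappa] on [P];
     this is the [4 * kappa] of the invariant. *)
  have child e : `|tavg f (ch e P) - c'| <= 4 * kappa.
    rewrite -(ler_pM2r (V_gt0 (ch e P))).
    apply: (le_trans (tavg_dist c' (fi _))).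
    apply: (@le_trans _ _ (A c' P)); last by rewrite V_half; lra.
    by apply: Rintegral_le_subset => //; exact: ch_sub.
  have := lerD (IH _ _ _ m'0 (child false)) (IH _ _ _ m'0 (child true)).
  rewrite -tree_split//; move/le_trans; apply.
  rewrite (tree_split (gi P)) (tree_split (fci c' P)) /=.
  have hm : m' <= Num.max m' (tavg g P) by rewrite le_max lexx.
  have := treemax_mono N (ch false P) hm.
  have := treemax_mono N (ch true P) hm.
  rewrite !V_half; nra.
have [Ac|/ltW Ac] := leP (A c P) (2 * kappa * V P); first exact: nonstop.
apply: (le_trans (Ag_avg c P)).
have gP0 : 0 <= tavg g P.
  by apply: divr_ge0; [exact: Rintegral_ge0|exact: fine_ge0].
have osc2 : tosc P <= 2 * kappa * V P.
  by rewrite (le_trans (osck P))// ler_wpM2r ?fine_ge0//; lra.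
(* A stopped box restarts with its own averages as [c] and [m]; its oscillation is small enough that
   it is not stopped again. *)
have := nonstop (tavg f P) _ gP0 osc2.
have h1 : `|tavg f P - c| * I g P <= 4 * kappa * I g P.
  by rewrite ler_wpM2r// Rintegral_ge0.
have := treemax_avg N.+1 P m.
have Ig : I g P = tavg g P * V P by rewrite divfK// gt_eqF.
have := osck P; rewrite -/(toscg P) -/(tosc P).
move: Ac h1 gP0 m0 k0; rewrite Ig.
move: (tavg g P) (V P) (tosc P) (toscg P) (A c P) => gp v o og a.
move: (treemax N.+1 P gp) (treemax N.+1 P m) (leafsum _ _ _) => t1 t2 l.
move: (`|_| * _) => u Ac h1 gP0 m0 k0 ho ht hn.
(* The restarted bound contains [4 * gp * (o - 2 * kappa * v)], at most [- 4 * kappa * gp * v],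
   which cancels the cost [u] of moving the centre from [c] to the average. The old term in [m] is
   nonnegative precisely because the box was stopped. *)
have h3 : 0 <= m * (a - 2 * kappa * v) by rewrite mulr_ge0// subr_ge0.
have h4 : gp * o <= gp * (kappa * v) by rewrite ler_wpM2l.
have h5 : kappa * t1 <= kappa * t2 by rewrite ler_wpM2l.
lra.
Qed.

End tree.

(** * L1 convergence of averages along the tree *)

Section density.
Context d (T : measurableType d) (R : realType).
Variable mu : {measure set T -> \bar R}.
Local Notation rint D f := (mu.-integrable D (EFin \o f)).
Variables (B : Type) (S : B -> set T) (ch : bool -> B -> B).
Hypothesis mS : forall P, measurable (S P).
Hypothesis chU : forall P, S P = S (ch false P) `|` S (ch true P).
Hypothesis chI : forall P, [disjoint S (ch false P) & S (ch true P)].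
Local Notation V P := (fine (mu (S P))).
Hypothesis finS : forall P, (mu (S P) < +oo)%E.
Hypothesis V_gt0 : forall P, 0 < V P.
Local Notation osc f := (tosc mu S f).
Local Notation leafsum := (leafsum ch).

Lemma tosc_ge0 f P : 0 <= osc f P.
Proof. exact: Rintegral_ge0. Qed.

Lemma tosc_le f c P : rint (S P) f -> osc f P <= 2 * \int[mu]_(x in S P) `|f x - c|.
Proof.
move=> fi.
have dci : rint (S P) (fun x => `|f x - c|).
  by apply: rint_norm; apply: rintB => //; exact: rint_cst.
have dai : rint (S P) (fun x => `|f x - tavg mu S f P|).
  by apply: rint_norm; apply: rintB => //; exact: rint_cst.
have := tavg_dist mS finS V_gt0 c fi.
rewrite -Rintegral_cst// => h; rewrite mulr2n mulrDl mul1r.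
apply: le_trans (lerD h (lexx _)).
rewrite -RintegralD//; last exact: rint_cst.
apply: le_Rintegral => //; first by apply: rintD => //; exact: rint_cst.
by move=> x _; rewrite (le_trans (ler_distD c _ _))// addrC (distrC c).
Qed.

Lemma tavgD f h P : rint (S P) f -> rint (S P) h ->
  tavg mu S (fun x => f x + h x) P = tavg mu S f P + tavg mu S h P.
Proof. by move=> fi hi; rewrite /tavg RintegralD// mulrDl. Qed.

Lemma tavgZ c f P : rint (S P) f ->
  tavg mu S (fun x => c * f x) P = c * tavg mu S f P.
Proof. by move=> fi; rewrite /tavg RintegralZl// mulrA. Qed.

Lemma toscD f h P : rint (S P) f -> rint (S P) h ->
  osc (fun x => f x + h x) P <= osc f P + osc h P.
Proof.
move=> fi hi; rewrite /tosc tavgD// -RintegralD//.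
- apply: le_Rintegral => //.
  + by apply/rint_norm/rintB => //; [exact: rintD|exact: rint_cst].
  + by apply: rintD => //; apply/rint_norm/rintB => //; exact: rint_cst.
  + by move=> x _; rewrite opprD addrACA ler_normD.
- by apply/rint_norm/rintB => //; exact: rint_cst.
- by apply/rint_norm/rintB => //; exact: rint_cst.
Qed.

Lemma toscZ c f P : rint (S P) f -> osc (fun x => c * f x) P = `|c| * osc f P.
Proof.
move=> fi; rewrite /tosc tavgZ// -RintegralZl//.
  by apply: eq_Rintegral => x _; rewrite -mulrBr normrM.
by apply/rint_norm/rintB => //; exact: rint_cst.
Qed.

Variable P0 : B.

(** Convergence in L1 of the averages of [f] over the leaves to [f] itself: a Lebesgue
    differentiation theorem for the tree, in its weak L1 form. *)
Definition leaf_dense (f : T -> R) := forall e, 0 < e ->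
  exists N0, forall N, (N0 <= N)%N -> leafsum (osc f) N P0 <= e.

Definition box_integrable (f : T -> R) := forall P, rint (S P) f.

Lemma leaf_denseD f h : box_integrable f -> box_integrable h ->
  leaf_dense f -> leaf_dense h -> leaf_dense (fun x => f x + h x).
Proof.
move=> fi hi df dh e e0; have e20 : 0 < e / 2 by lra.
have [N1 hN1] := df _ e20; have [N2 hN2] := dh _ e20.
exists (maxn N1 N2) => N; rewrite geq_max => /andP[/hN1 h1 /hN2 h2].
rewrite [leRHS]splitr; apply: le_trans (lerD h1 h2); rewrite -leafsumD.
by apply: leafsum_le => P; exact: toscD.
Qed.

Lemma leaf_denseZ c f : box_integrable f -> leaf_dense f ->
  leaf_dense (fun x => c * f x).
Proof.
move=> fi df e e0.
have c1 : 0 < `|c| + 1 by rewrite ltr_wpDl.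
have [N0 hN] := df _ (divr_gt0 e0 c1); exists N0 => N /hN {}hN.
rewrite (_ : leafsum _ _ _ = `|c| * leafsum (osc f) N P0); last first.
  rewrite -leafsumZ; elim: N P0 {hN} => [|N IH] P /=; first exact: toscZ.
  by rewrite !IH.
apply: (@le_trans _ _ (`|c| * (e / (`|c| + 1)))); first exact: ler_wpM2l.
rewrite mulrA ler_pdivrMr// mulrC ler_wpM2l ?ltW//.
by rewrite ltrDl.
Qed.

Lemma leafsum_int f N P : box_integrable f ->
  leafsum (fun P => \int[mu]_(x in S P) f x) N P = \int[mu]_(x in S P) f x.
Proof.
by move=> fi; elim: N P => //= N IH P; rewrite !IH -(tree_split mS chU chI).
Qed.

(** The oscillation of [f] on a leaf is at most that of [h] plus twice the integral of [|f - h|],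
    and these integrals add up to the integral over the root whatever the depth. *)
Lemma leaf_dense_lim f : box_integrable f ->
  (forall e, 0 < e -> exists h, [/\ box_integrable h, leaf_dense h &
     \int[mu]_(x in S P0) `|f x - h x| <= e]) -> leaf_dense f.
Proof.
move=> fi fh e e0; have e4 : 0 < e / 4 by lra.
have [h [hi dh fhe]] := fh _ e4.
have e2 : 0 < e / 2 by lra.
have [N0 hN0] := dh _ e2; exists N0 => N /hN0 hN.
have fhi : box_integrable (fun x => f x - h x).
  by move=> P; exact: rintB.
have nfhi : box_integrable (fun x => `|f x - h x|).
  by move=> P; exact: rint_norm.
apply: (@le_trans _ _ (leafsum (fun P => 2 * (\int[mu]_(x in S P) `|f x - h x|) + osc h P) N P0)).
  apply: leafsum_le => P.
  have fE : (fun x => f x - h x + h x) = f by apply/funext => x; rewrite subrK.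
  have := toscD (fhi P) (hi P); rewrite fE => /le_trans; apply.
  rewrite lerD2r; have := tosc_le 0 (fhi P).
  by under eq_Rintegral do rewrite subr0.
rewrite leafsumD leafsumZ leafsum_int//; lra.
Qed.

Fixpoint leaf_saturated (A : set T) N P : Prop :=
  if N is N'.+1 then leaf_saturated A N' (ch false P) /\ leaf_saturated A N' (ch true P)
  else S P `<=` A \/ S P `<=` ~` A.

Lemma leaf_saturatedS A N P : leaf_saturated A N P -> leaf_saturated A N.+1 P.
Proof.
elim: N P => [|N IH] P; last by move=> /= [h1 h2]; split; exact: IH.
have hs := ch_sub chU.
by move=> /= [] h; split; [left|left|right|right];
  exact: subset_trans (hs _ _) h.
Qed.

Lemma leaf_saturated_le A N M P : (N <= M)%N ->
  leaf_saturated A N P -> leaf_saturated A M P.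
Proof.
by move/subnK <-; elim: (M - N)%N => // k IH h; exact/leaf_saturatedS/IH.
Qed.

Lemma leaf_saturatedI A A' N P : leaf_saturated A N P -> leaf_saturated A' N P ->
  leaf_saturated (A `&` A') N P.
Proof.
elim: N P => [|N IH] P /=.
  move=> [h|h]; last by move=> _; right=> x /h; apply: contra_not => -[].
  move=> [h'|h']; first by left=> x Sx; split; [exact: h|exact: h'].
  by right => x /h'; apply: contra_not => -[].
by move=> [? ?] [? ?]; split; exact: IH.
Qed.

Lemma box_integrable_indic (A : set T) : measurable A -> box_integrable \1_A.
Proof.
move=> mA P; apply: (@rint_bounded _ _ _ _ _ _ 1) => //.
  by move=> x _; rewrite ger0_norm ?indicE//; case: (_ \in _).
Qed.

Lemma leaf_dense_saturated A N : measurable A -> leaf_saturated A N P0 ->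
  leaf_dense \1_A.
Proof.
move=> mA sA e e0; exists N => M NM.
rewrite (_ : leafsum _ _ _ = 0) ?ltW//.
have {sA} := leaf_saturated_le NM sA; elim: M P0 {NM} => [|M IH] P /=; last first.
  by move=> [/IH-> /IH->]; rewrite addr0.
move=> h; apply/eqP; rewrite eq_le tosc_ge0 andbT.
pose c : R := if pselect (S P `<=` A) then 1 else 0.
apply: le_trans (tosc_le c (box_integrable_indic mA P)) _.
rewrite (_ : \int[mu]_(x in S P) _ = \int[mu]_(x in S P) (cst 0 x)).
  by rewrite Rintegral_cst// mul0r mulr0.
apply: eq_Rintegral => x /set_mem Sx; rewrite /c /=; case: pselect => SA.
  by rewrite indicE mem_set ?subrr ?normr0//; exact: SA.
by case: h => // h; rewrite indicE memNset ?subrr ?normr0//; exact: h.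
Qed.

(** Sets decided on [S P0] at some finite depth: a pi-system whose indicators do not oscillate on
    deep leaves. Outside [S P0] such a set is an arbitrary measurable set. *)
Definition leaf_algebra : set (set T) :=
  [set A | measurable A /\ exists N, leaf_saturated A N P0].

Lemma leaf_dense_lambda :
  lambda_system setT [set A | measurable A /\ leaf_dense \1_A].
Proof.
split.
- by move=> A _ x _.
- by split; [exact: measurableT|apply: (@leaf_dense_saturated _ 0%N); [exact: measurableT|left]].
- move=> A A' A'A [mA dA] [mA' dA']; split; first exact: measurableD.
  rewrite (_ : \1_(A `\` A') = (fun x => \1_A x + (-1) * \1_A' x)).
    apply: leaf_denseD; [exact: box_integrable_indic| |exact: dA|].
      by move=> P; apply: rintZ => //; exact: box_integrable_indic.
    by apply: leaf_denseZ; [exact: box_integrable_indic|exact: dA'].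
  apply/funext => x; rewrite mulN1r !indicE in_setD.
  have [xA'|xA'] := boolP (x \in A').
    by rewrite (mem_set (A'A x (set_mem xA')))/= subrr.
  by rewrite andbT subr0.
- move=> F ndF HF; have mF k : measurable (F k) by have [] := HF k.
  have mU : measurable (\bigcup_k F k) by exact: bigcupT_measurable.
  split; first exact: mU.
  apply: leaf_dense_lim; first exact: box_integrable_indic.
  move=> e e0.
  have cv : mu (S P0 `&` F k) @[k --> \oo] --> mu (S P0 `&` \bigcup_k F k).
    rewrite setI_bigcupr; apply: nondecreasing_cvg_mu => //.
    - by move=> k; exact: measurableI.
    - by apply: bigcupT_measurable => k; exact: measurableI.
    - by move=> m n mn; have /subsetPset h := ndF _ _ mn; apply/subsetPset; exact: setIS.
  have SFfin (A : set T) : measurable A -> mu (S P0 `&` A) \is a fin_num.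
    move=> mA; rewrite ge0_fin_numE// (le_lt_trans _ (finS P0))//.
    by apply: le_measure; rewrite ?inE//; exact: measurableI.
  have /fine_cvgP[_ /cvgrPdist_le/(_ _ e0)[K _ hK]] :
    mu (S P0 `&` F k) @[k --> \oo] --> (fine (mu (S P0 `&` \bigcup_k F k)))%:E.
    by rewrite fineK//; exact: SFfin.
  exists \1_(F K); split; [exact: box_integrable_indic|by have [] := HF K|].
  have := hK K (leqnn _); apply: le_trans.
  rewrite (_ : \int[mu]_(x in S P0) _ =
     \int[mu]_(x in S P0) (\1_(\bigcup_k F k) x - \1_(F K) x)); last first.
    apply: eq_Rintegral => x _; rewrite ger0_norm// subr_ge0 !indicE ler_nat.
    by case: (boolP (x \in F K)) => // /set_mem FKx; rewrite mem_set//; exists K.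
  rewrite RintegralB//; [|exact: box_integrable_indic..].
  rewrite /Rintegral !integral_indic// ![_ `&` S P0]setIC /=.
  exact: ler_norm.
Qed.

(** Dynkin's pi-lambda argument, starting from sets that are unions of leaves inside the root. *)
Lemma leaf_dense_generated : <<s leaf_algebra >> `<=` [set A | measurable A /\ leaf_dense \1_A].
Proof.
apply: (lambda_system_subset _ leaf_dense_lambda) => //.
- move=> A A' [mA [N sA]] [mA' [N' sA']]; split; first exact: measurableI.
  exists (maxn N N'); apply: leaf_saturatedI.
    exact: leaf_saturated_le (leq_maxl _ _) sA.
  exact: leaf_saturated_le (leq_maxr _ _) sA'.
- by move=> A [mA [N sA]]; split; [exact: mA|]; exact: leaf_dense_saturated sA.
Qed.

Hypothesis gen : forall A, measurable A ->
  exists A', [/\ <<s leaf_algebra >> A', A' `<=` A & mu (A `\` A') = 0%E].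

(** [gen] represents [A] only up to a null set, because [mu] will be a completed measure while the
    boxes produce Borel sets; changing [A] on a null set does not affect any integral. *)
Lemma leaf_dense_indic A : measurable A -> leaf_dense \1_A.
Proof.
move=> mA; have [A' [gA' A'A A0]] := gen mA.
have [mA' dA'] := leaf_dense_generated gA'.
apply: leaf_dense_lim; first exact: box_integrable_indic.
move=> e e0; exists \1_A'; split; [exact: box_integrable_indic|exact: dA'|].
rewrite (_ : \int[mu]_(x in S P0) _ = 0) ?ltW//.
rewrite (_ : \int[mu]_(x in S P0) _ = \int[mu]_(x in S P0) \1_(A `\` A') x); last first.
  apply: eq_Rintegral => x _; rewrite !indicE in_setD.
  have [xA'|xA'] := boolP (x \in A').
    by rewrite (mem_set (A'A x (set_mem xA')))/= subrr normr0.
  by rewrite andbT subr0 normr_nat.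
rewrite /Rintegral integral_indic//; last exact: measurableD.
suff -> : mu ((A `\` A') `&` S P0) = 0%E by [].
apply/eqP; rewrite -measure_le0 -A0; apply: le_measure; rewrite ?inE//.
  by apply: measurableI => //; exact: measurableD.
exact: measurableD.
Qed.

Lemma leaf_dense_sum (s : seq R) (F : R -> set T) :
  (forall y, measurable (F y)) ->
  box_integrable (fun x => \sum_(y <- s) y * \1_(F y) x) /\
  leaf_dense (fun x => \sum_(y <- s) y * \1_(F y) x).
Proof.
move=> mF; elim: s => [|y s [IHi IHd]].
  rewrite (_ : (fun x => _) = \1_set0); last first.
    by apply/funext => x; rewrite big_nil indic0.
  by split; [exact: box_integrable_indic|exact: leaf_dense_indic].
rewrite (_ : (fun x => _) = (fun x => y * \1_(F y) x + \sum_(y <- s) y * \1_(F y) x)); last first.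
  by apply/funext => x; rewrite big_cons.
have yi : box_integrable (fun x => y * \1_(F y) x).
  by move=> P; apply: rintZ => //; exact: box_integrable_indic.
split; first by move=> P; exact: rintD.
apply: leaf_denseD; [exact: yi|exact: IHi| |exact: IHd].
apply: leaf_denseZ; first exact: box_integrable_indic.
exact: leaf_dense_indic.
Qed.

Import HBSimple.

Lemma leaf_dense_sfun (f : {sfun T >-> R}) : box_integrable f /\ leaf_dense f.
Proof.
rewrite (_ : (f : T -> R) = (fun x => \sum_(y <- finmap.enum_fset (fset_set (range f))) y * \1_(f @^-1` [set y]) x)).
  by apply: leaf_dense_sum => y; exact: measurable_sfunP.
by apply/funext => x; rewrite [LHS]fimfunE fsbig_finite//=; exact: fimfunP.
Qed.

Lemma leaf_dense_integrable f : box_integrable f -> leaf_dense f.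
Proof.
move=> fi; apply: leaf_dense_lim => // e e0.
have [h [hi _ /fine_cvgP[_ /cvgrPdist_le/(_ _ e0)[K _ hK]]]] :=
  approximation_sfun_integrable (mS P0) (fi P0).
have [hKi hKd] := leaf_dense_sfun (h K).
exists (h K); split; [exact: hKi|exact: hKd|].
have := hK K (leqnn _); rewrite /= sub0r normrN; apply: le_trans.
exact: ler_norm.
Qed.

End density.

(** * From the stopping-time estimate to a dual bound *)

Section tree_duality.
Context d (T : measurableType d) (R : realType).
Variable mu : {measure set T -> \bar R}.
Local Notation rint D f := (mu.-integrable D (EFin \o f)).
Variables (B : Type) (S : B -> set T) (ch : bool -> B -> B).
Hypothesis mS : forall P, measurable (S P).
Hypothesis chU : forall P, S P = S (ch false P) `|` S (ch true P).
Hypothesis chI : forall P, [disjoint S (ch false P) & S (ch true P)].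
Local Notation V P := (fine (mu (S P))).
Hypothesis finS : forall P, (mu (S P) < +oo)%E.
Hypothesis V_gt0 : forall P, 0 < V P.
Hypothesis V_half : forall e P, V (ch e P) = V P / 2.
Variables (f g : T -> R) (G : R).
Hypothesis fi : forall P, rint (S P) f.
Hypothesis mg : measurable_fun setT g.
Hypothesis g0 : forall x, 0 <= g x.
Hypothesis gG : forall x, g x <= G.

(** The bridge to the Hardy-Littlewood maximal operator: at each point the integrand is the floor or
    an average of [g] over a box containing the point, and it is bounded and measurable by
    construction. *)
Lemma treemaxP N P m : exists s : T -> R, [/\ measurable_fun setT s,
  (exists M, forall x, `|s x| <= M), (forall x, m <= s x),
  (forall x, S P x -> s x = m \/ (exists2 P', S P' x & s x = tavg mu S g P')) &
  treemax mu S ch g N P m = \int[mu]_(x in S P) s x].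
Proof.
elim: N P m => [|N IH] P m /=.
  exists (cst (Num.max m (tavg mu S g P))); split => //.
  - by exists `|Num.max m (tavg mu S g P)|.
  - by move=> x; rewrite le_max lexx.
  - by move=> x Px; rewrite /cst maxEle; case: ifP => _; [right; exists P|left].
  - by rewrite Rintegral_cst// mulrC.
set m' := Num.max m _.
have [s0 [ms0 [M0 sM0] ms0' vs0 ->]] := IH (ch false P) m'.
have [s1 [ms1 [M1 sM1] ms1' vs1 ->]] := IH (ch true P) m'.
pose s x := if x \in S (ch false P) then s0 x else s1 x.
have mm' : m <= m' by rewrite le_max lexx.
have ms : measurable_fun setT s.
  apply: measurable_fun_ifT => //.
  by apply: (@measurable_fun_bool _ _ _ _ true); rewrite setTI
    (_ : _ @^-1` _ = S (ch false P))//; apply/seteqP; split => x /=;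
    [move/set_mem|move/mem_set].
have sM x : `|s x| <= Num.max M0 M1.
  by rewrite /s; case: ifP => _; rewrite le_max ?sM0 ?sM1 ?orbT.
exists s; split => //.
- by exists (Num.max M0 M1).
- by move=> x; rewrite /s; case: ifP => _; exact: le_trans mm' _.
- move=> x Px.
  have hm : s x = m' \/ (exists2 P', S P' x & s x = tavg mu S g P').
    rewrite /s; case: ifPn => [/set_mem/vs0//|/negP x0]; apply: vs1.
    by move: Px; rewrite chU => -[/mem_set|].
  case: hm => [->|]; last by right.
  by rewrite /m' maxEle; case: ifP => _; [right; exists P|left].
- rewrite [RHS](tree_split mS chU chI); last first.
    by apply: (@rint_bounded _ _ _ _ _ _ (Num.max M0 M1)) => //; exact: measurable_funTS.
  congr (_ + _); apply: eq_Rintegral => x Px; rewrite /s; first by rewrite Px.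
  case: ifPn => // P0; have /disj_setPS/(_ x) := chI P.
  by move=> h; exfalso; apply: h; split; exact: set_mem.
Qed.

Variable P0 : B.
Hypothesis dense_f : leaf_dense mu S ch P0 f.

(** The stopping-time bound is started at the root with its own average and [m = 0], so the terms in
    [m] vanish. There remain [4 * kappa] times the integral of [g] and [8 * kappa] times [treemax],
    whence 12. The leaf term is at most [G] times a leaf sum of oscillations, which is arbitrarily
    small at large depth. *)
Lemma tree_duality (kappa W : R) : 0 <= kappa ->
  (forall P, tosc mu S f P <= kappa * V P) ->
  (forall N, treemax mu S ch g N P0 0 <= W) ->
  \int[mu]_(x in S P0) (`|f x - tavg mu S f P0| * g x) <= 12 * kappa * W.
Proof.
move=> k0 osck gW; apply/ler_addgt0Pr => e e0.
have G0 : 0 <= G.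
  have [x Px] : exists x, S P0 x.
    apply: contrapT => /forallNP h; have := V_gt0 P0; rewrite (_ : S P0 = set0) ?measure0 ?ltxx//.
    by apply/seteqP; split => x // /h.
  exact: le_trans (g0 x) (gG x).
have G1 : 0 < G + 1 by rewrite ltr_wpDl.
have [N hN] := dense_f (divr_gt0 e0 G1).
have := tree_bound mS chU chI finS V_gt0 V_half fi mg g0 gG k0 osck N
  (P := P0) (c := tavg mu S f P0) (lexx 0).
rewrite subrr normr0 => /(_ (mulr_ge0 (ler0n _ _) k0)); move/le_trans; apply.
rewrite !mulr0 !mul0r !addr0 subr0.
have Ig : \int[mu]_(x in S P0) g x <= W.
  apply: le_trans (gW 0%N); rewrite /=.
  apply: (@le_trans _ _ (V P0 * tavg mu S g P0)).
    by rewrite mulrC divfK// gt_eqF.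
  by rewrite ler_wpM2l ?fine_ge0// le_max lexx orbT.
have {}hN : leafsum ch (toscg mu S f g) N P0 <= e.
  apply: (@le_trans _ _ (leafsum ch (fun P => G * tosc mu S f P) N P0)).
    apply: leafsum_le => P; rewrite /toscg /tosc.
    have fci : rint (S P) (fun x => `|f x - tavg mu S f P|).
      by apply: rint_norm; apply: rintB => //; exact: rint_cst.
    rewrite -RintegralZl//; apply: le_Rintegral => //.
    - apply: (@rintMb _ _ _ _ _ _ _ G) => //; first exact: measurable_funTS.
      by move=> x _; rewrite ger0_norm.
    - exact: rintZ.
    - by move=> x _; rewrite mulrC ler_wpM2r.
  rewrite leafsumZ; have := hN N (leqnn _).
  have L0 P : 0 <= leafsum ch (tosc mu S f) N P.
    elim: N P {hN} => [|N IH] P /=; first exact: tosc_ge0.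
    exact: addr_ge0.
  move/(ler_wpM2l G0)/le_trans; apply.
  by rewrite mulrA ler_pdivrMr// mulrC ler_wpM2l ?ltW// ltrDl.
have h1 : kappa * \int[mu]_(x in S P0) g x <= kappa * W by rewrite ler_wpM2l.
have h2 : kappa * treemax mu S ch g N P0 0 <= kappa * W by rewrite ler_wpM2l.
lra.
Qed.

End tree_duality.

(** * Boxes and balls in Euclidean space *)

Section euclidean_space.
Context (R : realType) (n : nat).
Local Notation Rn := 'rV[R]_n.
Local Notation lebB := (borel_lebesgue R n).
Local Notation mu := (leb R n).
Implicit Types (x y c : Rn) (A : set Rn).

Lemma leb_measurable A : measurable A -> measurable (A : set (leb_space R n)).
Proof. exact: completed_measurable. Qed.

Lemma lebE A : measurable A -> mu A = lebB A.
Proof. exact: completedE. Qed.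

Lemma measurable_affine_preimage t c A : measurable A -> measurable (affine t c @^-1` A).
Proof. by move=> mA; rewrite -[X in measurable X]setTI; exact: measurable_affine. Qed.

Lemma enorm_ge0 x : 0 <= enorm x. Proof. exact: sqrtr_ge0. Qed.

Lemma coord_le_enorm x i : `|x ord0 i| <= enorm x.
Proof.
rewrite -sqrtr_sqr ler_sqrt; last by apply: sumr_ge0 => j _; exact: sqr_ge0.
by rewrite (bigD1 i)//= lerDl sumr_ge0// => j _; exact: sqr_ge0.
Qed.

Lemma enorm_le x (M : R) : 0 <= M -> (forall i, `|x ord0 i| <= M) ->
  enorm x <= n%:R * M.
Proof.
move=> M0 xM; rewrite -[leRHS]ger0_norm ?mulr_ge0// -sqrtr_sqr ler_sqrt ?sqr_ge0//.
apply: (@le_trans _ _ (\sum_(i < n) M ^+ 2)).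
  by apply: ler_sum => i _; rewrite -real_normK ?num_real// lerXn2r// nnegrE.
rewrite sumr_const card_ord -[M ^+ 2 *+ n]mulr_natl exprMn ler_wpM2r ?sqr_ge0//.
by rewrite -natrX ler_nat; case: n => // k; rewrite expnS leq_pmulr.
Qed.

Lemma enormZ t x : enorm (t *: x) = `|t| * enorm x.
Proof.
rewrite /enorm -sqrtr_sqr -sqrtrM ?sqr_ge0//; congr Num.sqrt.
by rewrite mulr_sumr; apply: eq_bigr => i _; rewrite mxE exprMn.
Qed.

Lemma enorm0P x : enorm x = 0 -> x = 0.
Proof.
move=> x0; apply/rowP => i; rewrite mxE.
by apply/eqP; rewrite -normr_le0 -x0; exact: coord_le_enorm.
Qed.

Lemma measurable_eball c r : measurable (eball c r).
Proof.
rewrite (_ : eball c r = affine 1 (- c) @^-1` (@enorm R n @^-1` `]-oo, r[)).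
  apply: measurable_affine_preimage; rewrite -[X in measurable X]setTI.
  exact: measurable_enorm.
by apply/seteqP; split => x; rewrite /= in_itv/= /affine scale1r addrC.
Qed.

Definition cube c (h : R) : set Rn :=
  box (\row_i (c ord0 i - h)) (\row_i (c ord0 i + h)).

Lemma cubeP c h x : cube c h x <-> forall i, c ord0 i - h <= x ord0 i < c ord0 i + h.
Proof. by split => xc i; have := xc i; rewrite !mxE. Qed.

Lemma eball_sub_cube c r : eball c r `<=` cube c r.
Proof.
move=> x xc; apply/cubeP => i; have := le_lt_trans (coord_le_enorm _ i) xc.
by rewrite !mxE ltr_norml => /andP[]; lra.
Qed.

Lemma leb_box (a b : Rn) : (forall i, a ord0 i <= b ord0 i) ->
  mu (box a b) = (\prod_(i < n) (b ord0 i - a ord0 i))%:E.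
Proof. by move=> ab; rewrite lebE ?borel_lebesgue_box//; exact: measurable_box. Qed.

Lemma leb_cube c h : 0 <= h -> mu (cube c h) = ((2 * h) ^+ n)%:E.
Proof.
move=> h0; rewrite leb_box; last by move=> i; rewrite !mxE; lra.
rewrite (eq_bigr (fun=> 2 * h)); last by move=> i _; rewrite !mxE; lra.
by rewrite prodr_const card_ord.
Qed.

Hypothesis n0 : (0 < n)%N.
Let n0R : 0 < n%:R :> R. Proof. by rewrite ltr0n. Qed.

Lemma cube_sub_eball c h r : 0 <= h -> n%:R * h < r -> cube c h `<=` eball c r.
Proof.
move=> h0 hr x /cubeP xc; apply: le_lt_trans hr; apply: enorm_le => // i.
by have := xc i; rewrite !mxE ler_norml; lra.
Qed.

Lemma eball_lty c r : (mu (eball c r) < +oo)%E.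
Proof.
apply: (@le_lt_trans _ _ (mu (cube c `|r|))); last by rewrite leb_cube// ltry.
apply: le_measure; rewrite ?inE.
- by apply: leb_measurable; exact: measurable_eball.
- by apply: leb_measurable; exact: measurable_box.
- apply: subset_trans (@eball_sub_cube _ `|r|) => x xr.
  exact: (lt_le_trans xr (ler_norm _)).
Qed.

Definition ballvol c r : R := fine (mu (eball c r)).

Lemma ballvolE c r : mu (eball c r) = (ballvol c r)%:E.
Proof. by rewrite fineK// ge0_fin_numE// eball_lty. Qed.

Lemma ballvol_le c r : 0 <= r -> ballvol c r <= (2 * r) ^+ n.
Proof.
move=> r0; rewrite -lee_fin -ballvolE -(leb_cube c)//.
apply: le_measure; rewrite ?inE.
- by apply: leb_measurable; exact: measurable_eball.
- by apply: leb_measurable; exact: measurable_box.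
- exact: eball_sub_cube.
Qed.

Lemma ballvol_ge c r : 0 < r -> (r / n%:R) ^+ n <= ballvol c r.
Proof.
move=> r0; rewrite -lee_fin -ballvolE.
(* Half-side of an inscribed cube: its points have norm at most [n * (r / (2 * n)) = r / 2].
   Comparison with cubes replaces the exact volume of the ball throughout. *)
have h0 : 0 <= r / (2 * n%:R) by rewrite divr_ge0 ?mulr_ge0// ltW.
rewrite (_ : (r / n%:R) ^+ n = (2 * (r / (2 * n%:R))) ^+ n); last first.
  by congr (_ ^+ n); field; rewrite gt_eqF.
rewrite -(leb_cube c)//.
apply: le_measure; rewrite ?inE.
- by apply: leb_measurable; exact: measurable_box.
- by apply: leb_measurable; exact: measurable_eball.
- apply: cube_sub_eball => //.
  by rewrite (_ : _ * _ = r / 2); [lra|field; rewrite gt_eqF].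
Qed.

Lemma ballvol_gt0 c r : 0 < r -> 0 < ballvol c r.
Proof.
by move=> r0; apply: lt_le_trans (ballvol_ge c r0); rewrite exprn_gt0// divr_gt0.
Qed.

End euclidean_space.

(** * Dyadic boxes, halved in one coordinate at a time *)

Section dyadic_boxes.
Context (R : realType) (n : nat).
Local Notation Rn := 'rV[R]_n.
Local Notation mu := (leb R n).
Hypothesis n0 : (0 < n)%N.
Variable s : R.
Hypothesis s0 : 0 < s.

(** Coordinates are halved cyclically: after [k] cuts each has been halved [k %/ n] times, and the
    first [k %% n] once more. This makes the tree binary, with exact halving of volumes, while the
    sides stay within a factor 2 of one another. *)
Definition side k (i : 'I_n) : R := s / 2 ^+ (k %/ n + (i < k %% n)).

Lemma side_gt0 k i : 0 < side k i.
Proof. by rewrite divr_gt0// exprn_gt0. Qed.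

Lemma sideS k i : side k.+1 i =
  if (i : nat) == (k %% n)%N then side k i / 2 else side k i.
Proof.
have rn := ltn_pmod k n0; have i_lt := ltn_ord i; rewrite /side.
move: (divn_eq k n) rn; set q := (k %/ n)%N; set r := (k %% n)%N => kE rn.
have [rn1|rn1] := ltnP r.+1 n.
  have -> : (k.+1 %/ n)%N = q by rewrite kE -addnS divnMDl// divn_small ?addn0.
  have -> : (k.+1 %% n)%N = r.+1 by rewrite kE -addnS modnMDl modn_small.
  rewrite ltnS leq_eqVlt; case: eqVneq => [->|_] //=.
  by rewrite ltnn/= addn0 addn1 exprS invfM mulrA mulrAC.
have {rn1} rE : r.+1 = n by apply/eqP; rewrite eqn_leq rn.
have -> : (k.+1 %/ n)%N = q.+1 by rewrite kE -addnS rE -mulSnr mulnK.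
have -> : (k.+1 %% n)%N = 0%N by rewrite kE -addnS rE -mulSnr modnMl.
rewrite ltn0 addn0; case: eqVneq => [->|ir].
  by rewrite ltnn/= addn0 exprS invfM mulrA mulrAC.
by rewrite ltn_neqAle ir -ltnS rE i_lt/= addn1.
Qed.

(** Depth and lower corner. The corner is arbitrary, so the tree axioms hold for all pairs and not
    only for the descendants of one cube. *)
Definition dbox : Type := nat * Rn.

Definition dset (P : dbox) : set Rn := box P.2 (P.2 + \row_i side P.1 i).

Definition dchild (e : bool) (P : dbox) : dbox :=
  (P.1.+1, P.2 + \row_i (if e && ((i : nat) == (P.1 %% n)%N) then side P.1.+1 i else 0)).

Lemma dsetP P x : dset P x <-> forall i, P.2 ord0 i <= x ord0 i < P.2 ord0 i + side P.1 i.
Proof. by split => h i; have := h i; rewrite !mxE. Qed.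

Lemma dset_measurable P : measurable (dset P : set (leb_space R n)).
Proof. by apply: leb_measurable; exact: measurable_box. Qed.

Let cut k : 'I_n := Ordinal (ltn_pmod k n0).

Lemma dchildP e P x : dset (dchild e P) x <-> dset P x /\
  (if e then P.2 ord0 (cut P.1) + side P.1 (cut P.1) / 2 <= x ord0 (cut P.1)
   else x ord0 (cut P.1) < P.2 ord0 (cut P.1) + side P.1 (cut P.1) / 2).
Proof.
have sp := side_gt0 P.1 (cut P.1).
split.
  move=> /dsetP h; split.
    apply/dsetP => i; have := h i; rewrite /= !mxE sideS; have := side_gt0 P.1 i.
    by case: (_ == _); case: e {h} => /=; lra.
  by have := h (cut P.1); rewrite /= !mxE sideS/= eqxx; case: e {h} => /=; lra.
move=> [/dsetP h hx]; apply/dsetP => i; have := h i; rewrite /= !mxE sideS.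
case: (eqVneq (i : nat) (P.1 %% n)%N) => [ij|_]; last by rewrite andbF addr0.
have {ij} -> : i = cut P.1 by exact/val_inj.
by move: hx; case: e => /=; lra.
Qed.

Lemma dchildU P : dset P = dset (dchild false P) `|` dset (dchild true P).
Proof.
apply/seteqP; split => [x Px|x []/dchildP[]//].
have [h|h] := leP (P.2 ord0 (cut P.1) + side P.1 (cut P.1) / 2) (x ord0 (cut P.1)).
  by right; apply/dchildP.
by left; apply/dchildP.
Qed.

Lemma dchildI P : [disjoint dset (dchild false P) & dset (dchild true P)].
Proof.
apply/disj_setPS => x [/dchildP[_ h1] /dchildP[_ h2]].
by have := lt_le_trans h1 h2; rewrite ltxx.
Qed.

Lemma leb_dset P : mu (dset P) = (\prod_(i < n) side P.1 i)%:E.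
Proof.
rewrite leb_box; last by move=> i; rewrite !mxE lerDl ltW// side_gt0.
by congr EFin; apply: eq_bigr => i _; rewrite !mxE addrAC subrr add0r.
Qed.

Lemma dset_lty P : (mu (dset P) < +oo)%E.
Proof. by rewrite leb_dset ltry. Qed.

Lemma dvol_gt0 P : 0 < fine (mu (dset P)).
Proof. by rewrite leb_dset/=; apply: prodr_gt0 => i _; exact: side_gt0. Qed.

Lemma dvol_half e P : fine (mu (dset (dchild e P))) = fine (mu (dset P)) / 2.
Proof.
rewrite !leb_dset/= (bigD1 (cut P.1))//= [in RHS](bigD1 (cut P.1))//=.
rewrite sideS eqxx mulrAC; congr (_ * _ / _).
apply: eq_bigr => i /negbTE ij; rewrite sideS.
by move: ij; rewrite -val_eqE /= => ->.
Qed.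

Definition scale k : R := s / 2 ^+ (k %/ n).

Lemma scale_gt0 k : 0 < scale k. Proof. by rewrite divr_gt0// exprn_gt0. Qed.

Lemma side_le k i : side k i <= scale k.
Proof.
rewrite /side /scale ler_pM2l// lef_pV2 ?posrE ?exprn_gt0// ler_eXn2l ?ltr1n//.
exact: leq_addr.
Qed.

Lemma side_ge k i : scale k / 2 <= side k i.
Proof.
rewrite /side /scale -mulrA ler_pM2l// -invfM lef_pV2 ?posrE ?mulr_gt0 ?exprn_gt0//.
by rewrite -exprSr ler_eXn2l ?ltr1n//; case: (_ < _)%N; rewrite ?addn1 ?addn0.
Qed.

Lemma dset_sub_eball P : dset P `<=` eball P.2 (2 * n%:R * scale P.1).
Proof.
have n0R : 0 < n%:R :> R by rewrite ltr0n.
have sc := scale_gt0 P.1.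
move=> x /dsetP Px; apply: (@le_lt_trans _ _ (n%:R * scale P.1)).
  apply: enorm_le; first exact: ltW.
  by move=> i; have := Px i; have := side_le P.1 i; rewrite !mxE ler_norml; lra.
by rewrite -mulrA mulr2n mulrDl mul1r ltrDl mulr_gt0.
Qed.

(** The ball lies in a cube of side [4 * n * scale = (8 * n) * (scale / 2)], and every side of the
    box is at least [scale / 2]. *)
Lemma ballvol_dset P : ballvol P.2 (2 * n%:R * scale P.1) <= (8 * n%:R) ^+ n * fine (mu (dset P)).
Proof.
have n0R : 0 < n%:R :> R by rewrite ltr0n.
have sc := scale_gt0 P.1.
apply: le_trans (ballvol_le _ _) _; first by rewrite !mulr_ge0// ltW.
rewrite leb_dset/= (_ : 2 * (2 * n%:R * scale P.1) = (8 * n%:R) * (scale P.1 / 2)); last by field.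
rewrite exprMn ler_wpM2l ?exprn_ge0 ?mulr_ge0//.
rewrite (_ : (scale P.1 / 2) ^+ n = \prod_(i < n) (scale P.1 / 2)); last first.
  by rewrite prodr_const card_ord.
apply: ler_prod => i _; rewrite side_ge andbT; lra.
Qed.

Lemma scale_lt e : 0 < e -> exists K, forall k, (K <= k)%N -> scale k < e.
Proof.
move=> e0; have [m hm] : exists m : nat, s / e < m%:R.
  exists (Num.bound (s / e)); apply: archi_boundP; apply: divr_ge0; exact: ltW.
exists (m * n)%N => k mk; rewrite /scale ltr_pdivrMr ?exprn_gt0//.
rewrite mulrC -ltr_pdivrMr//; apply: (lt_le_trans hm).
rewrite -natrX ler_nat; apply: leq_trans (ltnW (ltn_expl m (ltnSn 1))) _.
by rewrite leq_exp2l// leq_divRL.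
Qed.

(** Inner approximation of [H] by the leaves of depth [N] contained in it. *)
Fixpoint dcover (H : set Rn) N P : set Rn :=
  if N is N'.+1 then dcover H N' (dchild false P) `|` dcover H N' (dchild true P)
  else [set x | dset P x /\ dset P `<=` H].

Lemma dcover_sub H N P : dcover H N P `<=` dset P `&` H.
Proof.
elim: N P => [|N IH] P /=; first by move=> x [Px PH]; split => //; exact: PH.
by move=> x [/IH[? ?]|/IH[? ?]]; split=> //; rewrite dchildU; [left|right].
Qed.

Lemma dcover_measurable H N P : measurable (dcover H N P : set (leb_space R n)).
Proof.
elim: N P => [|N IH] P /=; last exact: measurableU.
have [PH|PH] := pselect (dset P `<=` H).
  rewrite (_ : [set _ | _] = dset P); first exact: dset_measurable.
  by apply/seteqP; split => x // [].
by rewrite (_ : [set _ | _] = set0)//; apply/seteqP; split => x // [].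
Qed.

Lemma leaf_saturated_ext (A A' : set Rn) N P : A `&` dset P = A' `&` dset P ->
  leaf_saturated dset dchild A N P -> leaf_saturated dset dchild A' N P.
Proof.
elim: N P => [|N IH] P /seteqP AA' /=.
  move=> [] h; [left|right] => x Px.
    by have [] := AA'.1 x (conj (h x Px) Px).
  by move=> A'x; have [] := AA'.2 x (conj A'x Px) => /(h x Px).
have sub e x : dset (dchild e P) x -> dset P x by move/dchildP => -[].
by move=> [h1 h2]; split; [move: h1|move: h2]; apply: IH; apply/seteqP;
  split => x [] ? xP; split => //; [case: (AA'.1 x)|case: (AA'.2 x)|case: (AA'.1 x)|case: (AA'.2 x)] => //; split => //; exact: sub xP.
Qed.

Lemma dcover_saturated H N P : leaf_saturated dset dchild (dcover H N P) N P.
Proof.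
elim: N P => [|N IH] P /=.
  have [PH|PH] := pselect (dset P `<=` H); first by left.
  by right=> x Px [].
have dj x : dset (dchild false P) x -> dset (dchild true P) x -> False.
  by have /disj_setPS h := dchildI P; move=> ? ?; apply: (h x).
split; [apply: leaf_saturated_ext (IH (dchild false P))|apply: leaf_saturated_ext (IH (dchild true P))];
  apply/seteqP; split => x [] h Px; split=> //.
- by left.
- by case: h => // /dcover_sub[/(dj _ Px)].
- by right.
- by case: h => // /dcover_sub[Px' _]; case: (dj x).
Qed.

Lemma dcover_small H N P x : dset P x ->
  (forall P', P'.1 = (P.1 + N)%N -> dset P' x -> dset P' `<=` H) -> dcover H N P x.
Proof.
elim: N P => [|N IH] P Px hP /=; first by split => //; apply: hP => //; rewrite addn0.
move: Px; rewrite dchildU => -[] Px; [left|right]; apply: IH => // P' P'1;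
  by apply: hP; rewrite P'1 /= addnS.
Qed.

Local Notation dalg P := (@leaf_algebra _ (leb_space R n) dbox dset dchild P).

(** It suffices to treat half-spaces [x_i < t]. Inside [dset P] such a set is the union of its inner
    approximations, since the sides of the leaves tend to 0; its part outside is saturated already
    at depth 0. *)
Lemma dyadic_generate P (A : set Rn) : measurable A -> <<s dalg P >> A.
Proof.
pose D := g_sigma_algebraType (dalg P).
have mcoord (i : 'I_n) : measurable_fun setT (fun x : D => (x : Rn) ord0 i).
  apply: (measurability _ (RGenCInfty.measurableE R)) => //.
  move=> _ [_ [t ->] <-]; rewrite setTI.
  rewrite -[X in measurable X]setCK; apply: measurableC.
  pose H : set D := [set x : D | (x : Rn) ord0 i < t].
  rewrite (_ : ~` _ = (\bigcup_N dcover H N P : set D) `|` (~` dset P `&` H)).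
    apply: measurableU.
      apply: bigcupT_measurable => N; apply: sub_sigma_algebra; split.
        exact: dcover_measurable.
      by exists N; exact: dcover_saturated.
    apply: sub_sigma_algebra; split; last by exists 0%N; right=> x Px [].
    apply: measurableI; first by apply: measurableC; exact: dset_measurable.
    apply: leb_measurable; rewrite (_ : H = (fun x : Rn => x ord0 i) @^-1` `]-oo, t[).
      by rewrite -[X in measurable X]setTI; exact: measurable_coord.
    by apply/seteqP; split => x /=; rewrite in_itv.
  apply/seteqP; split => x /=; rewrite in_itv/= andbT.
    move=> /negP; rewrite -ltNge => Hx.
    have [Px|Px] := pselect (dset P x); last by right.
    left; have e0 : 0 < t - (x : Rn) ord0 i by rewrite subr_gt0.
    have [K hK] := scale_lt e0; exists K => //.
    apply: dcover_small => // P' P'1 /dsetP P'x y /dsetP P'y.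
    have := hK P'.1; rewrite P'1 leq_addl => /(_ isT); rewrite -P'1.
    by have := side_le P'.1 i; have := P'x i; have := P'y i; rewrite /H/=; lra.
  by move=> h; apply/negP; rewrite -ltNge; case: h => [[N _ /dcover_sub[]]//|[]].
have mid : measurable_fun setT (idfun : D -> Rn) by exact: measurable_fun_rV.
by move=> mA; have := mid measurableT A mA; rewrite setTI preimage_id.
Qed.

Lemma dyadic_gen P A : measurable (A : set (leb_space R n)) ->
  exists A', [/\ <<s dalg P >> A', A' `<=` A & mu (A `\` A') = 0%E].
Proof.
move=> mA.
have [N [mN N0 mAN]] := completed_measurableP (sigma_finiteT (borel_lebesgue R n)) mA.
exists (A `\` N); split; [exact: dyadic_generate|exact: subDsetl|].
have muN : mu N = 0%E by rewrite lebE.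
apply/eqP; rewrite -measure_le0 -muN; apply: le_measure; rewrite ?inE.
- apply: measurableD => //; exact: leb_measurable.
- exact: leb_measurable.
- by move=> x [Ax /not_andP[]// /contrapT].
Qed.

End dyadic_boxes.

(** * Duality in Banach function spaces *)

Lemma ler_addexp2 (R : realType) (x y C : R) : 0 <= C ->
  (forall k : nat, x <= y + C / 2 ^+ k) -> x <= y.
Proof.
move=> C0 h; apply/ler_addgt0Pr => e e0.
pose k := Num.bound (C / e).
have Ce : C / e < k%:R by apply: archi_boundP; apply: divr_ge0 => //; exact: ltW.
apply: le_trans (h k) _; rewrite lerD2l ler_pdivrMr ?exprn_gt0//.
rewrite mulrC -ler_pdivrMr//; apply: (le_trans (ltW Ce)).
by rewrite -natrX ler_nat ltnW// ltn_expl.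
Qed.

(** * Nearest points in L2 *)

Section l2_projection.
Context d (T : measurableType d) (R : realType).
Variable mu : {measure set T -> \bar R}.
Variable Q : set T.
Hypothesis mQ : measurable Q.
Hypothesis Qoo : (mu Q < +oo)%E.
Local Notation rint D f := (mu.-integrable D (EFin \o f)).
Local Notation int f := (\int[mu]_(x in Q) f x).

Definition bmeas (f : T -> R) := measurable_fun setT f /\ exists M, forall x, `|f x| <= M.

Lemma bmeas_int f : bmeas f -> rint Q f.
Proof.
move=> [mf [M fM]]; apply: (@rint_bounded _ _ _ _ _ _ M) => //.
exact: measurable_funTS.
Qed.

Lemma bmeasD f g : bmeas f -> bmeas g -> bmeas (fun x => f x + g x).
Proof.
move=> [mf [M fM]] [mg [K gK]]; split; first exact: measurable_funD.
by exists (M + K) => x; rewrite (le_trans (ler_normD _ _))// lerD.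
Qed.

Lemma bmeasM f g : bmeas f -> bmeas g -> bmeas (fun x => f x * g x).
Proof.
move=> [mf [M fM]] [mg [K gK]]; split; first exact: measurable_funM.
by exists (M * K) => x; rewrite normrM ler_pM.
Qed.

Lemma bmeas_cst c : bmeas (cst c).
Proof. by split => //; exists `|c|. Qed.

Lemma bmeasZ c f : bmeas f -> bmeas (fun x => c * f x).
Proof. exact/bmeasM/bmeas_cst. Qed.

Lemma bmeasB f g : bmeas f -> bmeas g -> bmeas (fun x => f x - g x).
Proof.
move=> bf bg; have := bmeasD bf (bmeasZ (-1) bg).
by congr bmeas; apply/funext => x; rewrite mulN1r.
Qed.

Lemma bmeas_norm f : bmeas f -> bmeas (fun x => `|f x|).
Proof.
move=> [mf [M fM]]; split; first exact: measurableT_comp.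
by exists M => x; rewrite normr_id.
Qed.

Lemma bmeas_sqr f : bmeas f -> bmeas (fun x => f x ^+ 2).
Proof. by move=> bf; have := bmeasM bf bf; under eq_fun do rewrite -expr2. Qed.

Lemma bmeas_min f g : bmeas f -> bmeas g -> bmeas (fun x => Num.min (f x) (g x)).
Proof.
move=> [mf [M fM]] [mg [K gK]]; split; first exact: measurable_minr.
exists (Num.max M K) => x; rewrite minEle; case: ifP => _; rewrite le_max ?fM//.
by rewrite gK orbT.
Qed.

Variables (f : T -> R) (m : R).
Hypothesis mf : measurable_fun setT f.
Hypothesis f0 : forall x, 0 <= f x.
Hypothesis fm : forall x, f x <= m.
Variable U : (T -> R) -> Prop.
Hypothesis U_bounds : forall u, U u -> measurable_fun setT u /\ forall x, 0 <= u x <= f x.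
Hypothesis U0 : U (cst 0).
Hypothesis U_mid : forall u v, U u -> U v -> U (fun x => (u x + v x) / 2).
Hypothesis U_le : forall u v : T -> R, U u -> measurable_fun setT v ->
  (forall x, 0 <= v x <= u x) -> U v.
Hypothesis U_sup : forall (v : nat -> T -> R) (u : T -> R), (forall k, U (v k)) ->
  measurable_fun setT u ->
  (forall x, nondecreasing_seq (v ^~ x)) -> (forall x, v ^~ x @ \oo --> u x) -> U u.

Let phi u := int (fun x => (f x - u x) ^+ 2).

Let bf : bmeas f.
Proof. by split => //; exists m => x; rewrite ger0_norm. Qed.

Let bU u : U u -> bmeas u.
Proof.
move=> /U_bounds[mu' uf]; split => //; exists m => x.
by have /andP[u0 ux] := uf x; rewrite ger0_norm// (le_trans ux).
Qed.

Let V : R := fine (mu Q).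

Lemma l2_parallelogram u v : U u -> U v ->
  int (fun x => (u x - v x) ^+ 2) =
  2 * phi u + 2 * phi v - 4 * phi (fun x => (u x + v x) / 2).
Proof.
move=> Uu Uv; have bu := bU Uu; have bv := bU Uv; have buv := bU (U_mid Uu Uv).
have h w : bmeas w -> rint Q (fun x => (f x - w x) ^+ 2).
  by move=> bw; apply: bmeas_int; apply: bmeas_sqr; exact: bmeasB.
rewrite /phi -!RintegralZl//; [|exact: h..].
rewrite -RintegralD//; [|by apply: rintZ => //; exact: h..].
rewrite -RintegralB//; [|apply: rintD => //; apply: rintZ => //; exact: h|apply: rintZ => //; exact: h].
by apply: eq_Rintegral => x _; field.
Qed.

Lemma l1_le_l2 h e : 0 < e -> bmeas h ->
  int (fun x => `|h x|) <= (e * V + e^-1 * int (fun x => h x ^+ 2)) / 2.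
Proof.
move=> e0 bh.
have h2 : rint Q (fun x => h x ^+ 2) by apply/bmeas_int/bmeas_sqr.
have ci : rint Q (cst e) by exact/bmeas_int/bmeas_cst.
rewrite /V -Rintegral_cst// -RintegralZl// -RintegralD//; last exact: rintZ.
rewrite -RintegralZr//; last by apply: rintD => //; exact: rintZ.
apply: le_Rintegral => //.
- exact/bmeas_int/bmeas_norm.
- rewrite (_ : EFin \o _ = EFin \o (fun x => 2^-1 * (e + e^-1 * h x ^+ 2))).
    by apply: rintZ => //; apply: rintD => //; exact: rintZ.
  by apply/funext => x; rewrite /= mulrC.
- move=> x _; rewrite -[h x ^+ 2]real_normK ?num_real//; move: `|h x| => a.
  have : 0 <= e^-1 * (e - a) ^+ 2 by rewrite mulr_ge0 ?sqr_ge0// invr_ge0 ltW.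
  rewrite (_ : e^-1 * _ = e - 2 * a + e^-1 * a ^+ 2); last by field; rewrite gt_eqF.
  lra.
Qed.

(** The closure properties of [U] are those that the lattice property, convexity and the Fatou
    property give to a ball of the norm. A minimizing sequence converges fast by the parallelogram
    law, and its lower limit [w] is the increasing limit of the infima [v k], each in [U] because it
    lies below [u k]. *)
Lemma l2_minimizer : exists u, U u /\ forall w, U w -> phi u <= phi w.
Proof.
pose E := [set phi u | u in U].
have E0 : has_inf E.
  split; first by exists (phi (cst 0)), (cst 0).
  by exists 0 => _ [u _ <-]; apply: Rintegral_ge0 => x _; exact: sqr_ge0.
pose delta := inf E.
have dphi u : U u -> delta <= phi u by move=> Uu; apply: ge_inf; [exact: E0.2|exists u].
(* Values within [4^-k] of the infimum make consecutive terms [2^-k]-close in L2 up to a constant,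
   hence their differences summable in L1. *)
have eta0 (k : nat) : 0 < (4 ^+ k)^-1 :> R by rewrite invr_gt0 exprn_gt0.
have seqU (k : nat) : exists u, U u /\ phi u < delta + (4 ^+ k)^-1.
  by have [_ [u Uu <-] h] := inf_adherent (eta0 k) E0; exists u.
have {seqU}[u /all_and2[Uu phiu]] := choice seqU.
pose C := (V + 4) / 2.
have C0 : 0 <= C by rewrite divr_ge0// addr_ge0// fine_ge0.
have du k : int (fun x => `|u k x - u k.+1 x|) <= C / 2 ^+ k.
  have e0 : 0 < (2 ^+ k)^-1 :> R by rewrite invr_gt0 exprn_gt0.
  apply: le_trans (l1_le_l2 e0 (bmeasB (bU (Uu k)) (bU (Uu k.+1)))) _.
  have hs : int (fun x => (u k x - u k.+1 x) ^+ 2) <= 4 / 4 ^+ k.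
    rewrite l2_parallelogram//.
    have := dphi _ (U_mid (Uu k) (Uu k.+1)); have := phiu k; have := phiu k.+1.
    have : (4 ^+ k.+1)^-1 <= (4 ^+ k)^-1 :> R.
      by rewrite lef_pV2 ?posrE ?exprn_gt0// ler_eXn2l// ltr1n.
    lra.
  have e4 : 4 ^+ k = 2 ^+ k * 2 ^+ k :> R by rewrite -exprMn; congr (_ ^+ _); ring.
  have {hs} : 2 ^+ k * int (fun x => (u k x - u k.+1 x) ^+ 2) <= 4 / 2 ^+ k.
    rewrite -ler_pdivlMl ?exprn_gt0//; apply: (le_trans hs).
    by rewrite e4 invfM mulrCA.
  rewrite invrK /C; set a := Rintegral _ _ _; set p := (2 ^+ k)^-1; lra.
clearbody C.
have u_lb x k : has_lbound (range (fun j => u (k + j)%N x)).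
  by exists 0 => _ [j _ <-]; have [_ /(_ x)/andP[]] := U_bounds (Uu (k + j)%N).
have u_ub x : has_ubound (range (u ^~ x)).
  by exists (f x) => _ [j _ <-]; have [_ /(_ x)/andP[]] := U_bounds (Uu j).
have u_lb0 x : has_lbound (range (u ^~ x)) by have := u_lb x 0%N.
pose v k x := infs (u ^~ x) k.
have vu x k j : (k <= j)%N -> v k x <= u j x.
  move=> kj; apply: ge_inf; last by exists j.
  by exists 0 => _ [i _ <-]; have [_ /(_ x)/andP[]] := U_bounds (Uu i).
have v0 x k y : (forall j, (k <= j)%N -> y <= u j x) -> y <= v k x.
  move=> h; apply: lb_le_inf; first by exists (u k x), k => /=.
  by move=> _ [j /= kj <-]; exact: h.
have mv k : measurable_fun setT (v k).
  apply: measurable_fun_infs => //.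
  by move=> j; have [] := U_bounds (Uu j).
have Uv k : U (v k).
  apply: (U_le (Uu k)) => // x; rewrite vu// andbT; apply: v0 => j _.
  by have [_ /(_ x)/andP[]] := U_bounds (Uu j).
pose w x := sup (range (v ^~ x)).
have vw x : v ^~ x @ \oo --> w x by exact: cvg_infs_sup.
have ndv x : nondecreasing_seq (v ^~ x) by exact: nondecreasing_infs.
have Uw : U w.
  apply: (U_sup Uv) => //.
  by apply: (measurable_fun_cvg (h := v)) => // x _; exact: vw.
exists w; split => // z Uz; apply: le_trans (dphi z Uz).
have m0 : 0 <= m by exact: le_trans (f0 point) (fm point).
apply: (@ler_addexp2 _ _ _ (1 + 4 * m * C)) => [|k].
  by apply: addr_ge0 => //; apply: mulr_ge0 => //; exact: mulr_ge0.
(* The drop from [u k] to any later term is at most the sum of the consecutive differences. The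
   series may diverge at some points, hence the extended reals. *)
have uvS x : ((u k x - v k x)%:E <= \sum_(j <oo) (`|u (k + j)%N x - u (k + j).+1 x|)%:E)%E.
  set S := (\sum_(j <oo) _)%E.
  have S0 : (0 <= S)%E by apply: nneseries_ge0 => j _ _; rewrite lee_fin.
  have [Soo|Sfin] := eqVneq S +oo%E; first by rewrite Soo leey.
  have SE : S = (fine S)%:E by rewrite fineK// ge0_fin_numE// ltey.
  rewrite SE lee_fin lerBlDr addrC -lerBlDr; apply: v0 => j kj.
  rewrite lerBlDr -lerBlDl -lee_fin -SE.
  apply: (@le_trans _ _ (\sum_(0 <= i < (j - k)%N) (`|u (k + i)%N x - u (k + i).+1 x|)%:E)%E).
    rewrite sumEFin lee_fin.
    rewrite -(subnKC kj); move: (j - k)%N => l; rewrite addKn.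
    elim: l => [|l IH]; first by rewrite addn0 subrr big_nil.
    rewrite big_nat_recr//= -addnS.
    by have := ler_norm (u (k + l)%N x - u (k + l.+1)%N x); rewrite addnS in IH *; lra.
  by apply: nneseries_lim_ge => i _ _; rewrite lee_fin.
have iuv : int (fun x => u k x - v k x) <= 2 * C / 2 ^+ k.
  rewrite -lee_fin Rintegral_EFin//; last by apply/bmeas_int/bmeasB; exact: bU.
  have md j : measurable_fun Q (fun x => (`|u (k + j)%N x - u (k + j).+1 x|)%:E).
    apply/measurable_EFinP/measurable_funTS.
    by have [] := bmeas_norm (bmeasB (bU (Uu (k + j)%N)) (bU (Uu (k + j).+1))).
  apply: (@le_trans _ _ (\int[mu]_(x in Q) \sum_(j <oo) (`|u (k + j)%N x - u (k + j).+1 x|)%:E)%E).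
    apply: ge0_le_integral => //.
    - by move=> x _; rewrite lee_fin subr_ge0 vu.
    - apply/measurable_EFinP/measurable_funTS.
      by have [] := bmeasB (bU (Uu k)) (bU (Uv k)).
    - by apply: ge0_emeasurable_sum => // j x _ _; rewrite lee_fin.
  rewrite integral_nneseries//.
  have C2 : 0 <= 2 * C / 2 ^+ k by apply: divr_ge0; [exact: mulr_ge0|exact: exprn_ge0].
  (* [epsilon_trick0] sums the terms [e / 2^(j+1)]; for [e = 2 * C / 2^k] these are the bounds
     [C / 2^(k+j)] of [du]. *)
  apply: le_trans (epsilon_trick0 xpredT C2).
  apply: lee_nneseries => [j _ _|j _].
    by apply: integral_ge0 => x _; rewrite lee_fin.
  rewrite -Rintegral_EFin//; last by apply/bmeas_int/bmeas_norm/bmeasB; exact: bU.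
  rewrite lee_fin; apply: le_trans (du _) _.
  rewrite natrX exprS exprD le_eqVlt; apply/orP; left; apply/eqP; field.
  by rewrite !expf_neq0.
have h1 : phi w <= phi (v k).
  have vwk x : v k x <= w x.
    apply: ub_le_sup; last by exists k.
    exists (f x) => _ [j _ <-]; apply: le_trans (vu x j j (leqnn j)) _.
    by have [_ /(_ x)/andP[]] := U_bounds (Uu j).
  apply: le_Rintegral => //; [exact/bmeas_int/bmeas_sqr/bmeasB/bU..|].
  move=> x _; have [_ /(_ x)/andP[? ?]] := U_bounds Uw.
  by rewrite lerXn2r ?nnegrE ?subr_ge0// ?lerB// (le_trans (vwk x)).
have h2 : phi (v k) <= phi (u k) + 2 * m * int (fun x => u k x - v k x).
  have iuvk : rint Q (fun x => u k x - v k x) by apply/bmeas_int/bmeasB; exact: bU.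
  rewrite /phi -RintegralZl// -RintegralD//; last 2 first.
    by apply/bmeas_int/bmeas_sqr/bmeasB => //; exact: bU.
    exact: rintZ.
  apply: le_Rintegral => //; first exact/bmeas_int/bmeas_sqr/bmeasB/bU.
    apply: rintD => //; last exact: rintZ.
    by apply/bmeas_int/bmeas_sqr/bmeasB => //; exact: bU.
  move=> x _; have [_ /(_ x)/andP[a1 a2]] := U_bounds (Uu k).
  have [_ /(_ x)/andP[a3 a4]] := U_bounds (Uv k).
  have := vu x k k (leqnn k); have := fm x.
  move: (f x) (u k x) (v k x) a1 a2 a3 a4 => a b c *.
  (* This product is [2 * m * (b - c)] minus the difference of the squares [(a - c)^2] and
     [(a - b)^2]. *)
  have : 0 <= (b - c) * (2 * m - 2 * a + b + c) by rewrite mulr_ge0//; lra.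
  rewrite !expr2; lra.
have h3 : (4 ^+ k)^-1 <= (2 ^+ k)^-1 :> R.
  by rewrite lef_pV2 ?posrE ?exprn_gt0// lerXn2r// ?nnegrE// ler_nat.
have h4 : 2 * m * int (fun x => u k x - v k x) <= 2 * m * (2 * C / 2 ^+ k).
  by rewrite ler_wpM2l// mulr_ge0.
have := phiu k; rewrite mulrDl mul1r; move: h1 h2 h3 h4; rewrite !mulrA.
move: (phi w) (phi (v k)) (phi (u k)) => a b c.
set p := (2 ^+ k)^-1.
lra.
Qed.

End l2_projection.

Lemma measurable_fun_dist d (T : measurableType d) (R : realType) (f : T -> R) (c : R) :
  measurable_fun setT f -> measurable_fun setT (fun x => `|f x - c|).
Proof. by move=> mf; apply: measurableT_comp => //; exact: measurable_funB. Qed.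

Lemma ae_imply d (T : measurableType d) (R : realType)
    (mu : {measure set T -> \bar R}) (P Q : T -> Prop) :
  (forall x, P x -> Q x) -> {ae mu, forall x, P x} -> {ae mu, forall x, Q x}.
Proof. by move=> PQ; apply: negligibleS => x /=; apply: contra_not; exact: PQ. Qed.

(* [ge0_le_integral] requires both functions to be measurable. *)
Lemma ge0_le_integral_nm d (T : measurableType d) (R : realType)
    (mu : {measure set T -> \bar R}) (f g : T -> \bar R) :
  (forall x, 0 <= f x)%E -> (forall x, f x <= g x)%E ->
  (\int[mu]_x f x <= \int[mu]_x g x)%E.
Proof.
move=> f0 fg; rewrite !ge0_integralTE//; last by move=> x; exact: le_trans (fg x).
by apply: ereal_sup_le => _ [h hf <-]; exists h => // x; exact: le_trans (fg x).
Qed.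

(** [g] will be a maximal function whose measurability is not at hand; only its minorant [s] is
    treated as a measurable function. *)
Lemma holder_indic d (T : measurableType d) (R : realType)
    (mu : {measure set T -> \bar R}) (Q : set T) (s g : T -> R) (c : R) :
  measurable Q -> measurable_fun setT s -> (forall x, 0 <= s x) -> 0 <= c ->
  {ae mu, forall x, s x <= `|g x|} ->
  (c%:E * \int[mu]_(x in Q) (s x)%:E <= \int[mu]_x `|g x * (c * \1_Q x)|%:E)%E.
Proof.
move=> mQ ms s0 c0 [N [mN N0 sN]].
have msE : measurable_fun Q (fun x : T => (s x)%:E) by exact/measurable_EFinP/measurable_funTS.
rewrite -ge0_integralZl//; last by move=> x _; rewrite lee_fin.
rewrite (@ge0_negligible_integral _ _ _ mu Q N)//; last 2 first.
- exact: emeasurable_funM.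
- by move=> x _; rewrite -EFinM lee_fin mulr_ge0.
rewrite integral_mkcond; apply: ge0_le_integral_nm => x; rewrite patchE.
  by case: ifP => // _; rewrite -EFinM lee_fin mulr_ge0.
case: ifPn => [/set_mem[Qx Nx]|_]; last by rewrite lee_fin.
rewrite -EFinM lee_fin normrM indicE mem_set// mulr1 [`|c|]ger0_norm// mulrC ler_wpM2r//.
by apply: contrapT => h; apply: Nx; exact: sN.
Qed.

(* [N] is the norm of a real function in a Banach function space and [A] its
   associate norm; only the properties used by the duality argument are assumed. *)
Section lorentz_luxemburg.
Context d (T : measurableType d) (R : realType).
Variable mu : {measure set T -> \bar R}.
Implicit Types (f g u v : T -> R).
Variables N A : (T -> R) -> \bar R.
Hypothesis N_le : forall f g : T -> R, measurable_fun setT f -> measurable_fun setT g ->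
  {ae mu, forall x, `|g x| <= `|f x|} -> (N g <= N f)%E.
Hypothesis N_scale : forall c (f : T -> R), (N f < +oo)%E ->
  N (fun x => c * f x)%R = (`|c|%:E * N f)%E.
Hypothesis N_triangle : forall f g : T -> R, measurable_fun setT f -> measurable_fun setT g ->
  (N (fun x => f x + g x)%R <= N f + N g)%E.
Hypothesis N0 : N (cst 0) = 0%E.
Hypothesis N_Fatou : forall (v : nat -> T -> R) (u : T -> R),
  (forall k, measurable_fun setT (v k)) -> measurable_fun setT u ->
  (forall k x, 0 <= v k x) -> (forall x, nondecreasing_seq (v ^~ x)) ->
  (forall x, v ^~ x @ \oo --> u x) -> (fun k => N (v k)) @ \oo --> N u.
Hypothesis A_le : forall (g : T -> R) (H : \bar R), (forall x, 0 <= g x) ->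
  (forall v : T -> R, measurable_fun setT v -> (forall x, 0 <= v x) -> (N v <= 1)%E ->
    (\int[mu]_x (g x * v x)%:E <= H)%E) -> (A g <= H)%E.
Hypothesis A_ge0 : forall g, (0 <= A g)%E.
Variable Q : set T.
Hypothesis mQ : measurable Q.
Hypothesis Qoo : (mu Q < +oo)%E.

(* The gap [f - u], with [u] the L2-closest point to [f] in the ball of radius [K],
   satisfies [int (f - u) v <= int (f - u) u] on that ball: it is a dual function
   separating [f] from the ball. *)
Lemma lorentz_luxemburg_bounded f (m K : R) : measurable_fun setT f ->
  (forall x, 0 <= f x <= m * \1_Q x) -> 0 < K ->
  (forall (g : T -> R) G, measurable_fun setT g -> (forall x, 0 <= g x <= G * \1_Q x) ->
    (A g < +oo)%E -> (\int[mu]_(x in Q) (f x * g x)%:E <= K%:E * A g)%E) ->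
  (N f <= K%:E)%E.
Proof.
move=> mf fQ K0 fg.
have m0 : 0 <= m \/ Q = set0.
  have [->|/set0P[x Qx]] := eqVneq Q set0; first by right.
  left; have /andP[f0] := fQ x; rewrite indicE mem_set// mulr1; exact: le_trans.
have f0 x : 0 <= f x by have /andP[] := fQ x.
have fm x : f x <= `|m|.
  have /andP[_ /le_trans->//] := fQ x; rewrite (le_trans (ler_norm _))// normrM.
  by rewrite ler_piMr// ger0_norm ?indicE//; case: (_ \in _).
pose U (u : T -> R) := [/\ measurable_fun setT u, forall x, 0 <= u x <= f x & (N u <= K%:E)%E].
have U0 : U (cst 0).
  split; first exact: measurable_cst.
    by move=> x; rewrite lexx f0.
  by rewrite N0 lee_fin ltW.
have Xfin (u : T -> R) : (N u <= K%:E)%E -> (N u < +oo)%E by move=> h; rewrite (le_lt_trans h)// ltry.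
have Uconv (u v : T -> R) (t : R) : 0 <= t <= 1 -> measurable_fun setT u ->
    measurable_fun setT v -> (N u <= K%:E)%E -> (N v <= K%:E)%E ->
    (N (fun x => (1 - t)%R * u x + t * v x)%R <= K%:E)%E.
  move=> /andP[t0 t1] mu' mv uK vK; apply: le_trans (N_triangle _ _) _.
  - by apply: (@measurable_funM _ _ _ _ (cst (1 - t))) => //; exact: measurable_cst.
  - by apply: (@measurable_funM _ _ _ _ (cst t)) => //; exact: measurable_cst.
  - rewrite (N_scale _ (Xfin _ uK)) (N_scale _ (Xfin _ vK)).
    rewrite !ger0_norm ?subr_ge0//.
    rewrite (_ : K%:E = ((1 - t)%:E * K%:E + t%:E * K%:E)%E); last first.
      by rewrite -!EFinM -EFinD; congr EFin; ring.
    by apply: leeD; apply: lee_wpmul2l => //; rewrite lee_fin ?subr_ge0.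
have U_mid (u v : T -> R) : U u -> U v -> U (fun x => (u x + v x) / 2).
  move=> [mu' uf uK] [mv vf vK]; split.
  - apply: (@measurable_funM _ _ _ _ _ (cst 2^-1)); last exact: measurable_cst.
    exact: measurable_funD.
  - by move=> x; have := uf x; have := vf x; lra.
  - have h : 0 <= (2^-1 : R) <= 1 by lra.
    have := Uconv u v _ h mu' mv uK vK; congr (_ <= _)%E; congr N.
    by apply/funext => x; field.
have U_le (u v : T -> R) : U u -> measurable_fun setT v ->
  (forall x, 0 <= v x <= u x) -> U v.
  move=> [mu' uf uK] mv vu; split => //.
    by move=> x; have /andP[-> vux] := vu x; have /andP[_] := uf x; exact: le_trans.
  apply: le_trans uK; apply: N_le => //; apply: aeW => x.
  by have /andP[v0 vux] := vu x; rewrite !ger0_norm// (le_trans v0).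
have U_sup (v : nat -> T -> R) (u : T -> R) : (forall k, U (v k)) ->
  measurable_fun setT u ->
  (forall x, nondecreasing_seq (v ^~ x)) -> (forall x, v ^~ x @ \oo --> u x) -> U u.
  move=> Uv mu' ndv vu; split => // [x|].
    have cv : cvg (v ^~ x @ \oo) by apply/cvg_ex; exists (u x); exact: vu.
    have /cvg_lim <- // := vu x; apply/andP; split.
      by apply: limr_ge => //; apply: nearW => k; have [_ /(_ x)/andP[]] := Uv k.
    by apply: limr_le => //; apply: nearW => k; have [_ /(_ x)/andP[]] := Uv k.
  have cvX : (fun k => N (v k)) @ \oo --> N u.
    apply: N_Fatou => //; first by move=> k; have [] := Uv k.
    by move=> k x; have [_ /(_ x)/andP[]] := Uv k.
  have /cvg_lim <- // := cvX; apply: lime_le; first by apply/cvg_ex; exists (N u).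
  by apply: nearW => k; have [] := Uv k.
have [u [Uu umin]] := @l2_minimizer _ T R mu Q mQ Qoo f `|m| mf f0 fm U
  (fun u Uu => let: And3 a b _ := Uu in conj a b) U0 U_mid U_le U_sup.
have [mu' uf uK] := Uu.
have u0 x : 0 <= u x by have /andP[] := uf x.
pose g x := f x - u x.
have bu : bmeas u.
  split => //; exists `|m| => x; rewrite ger0_norm//.
  by have /andP[_ /le_trans->] := uf x.
have bf : bmeas f by split => //; exists `|m| => x; rewrite ger0_norm.
have bg : bmeas g by exact: bmeasB.
have g0 x : 0 <= g x by rewrite subr_ge0; have /andP[] := uf x.
have gQ x : ~ Q x -> g x = 0.
  move=> nQx; have /andP[_] := fQ x; rewrite indicE memNset// mulr0 => fx0.
  have /andP[a1 a2] := uf x; rewrite /g; lra.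
have gm x : g x <= `|m| * \1_Q x.
  rewrite indicE; have [Qx|nQx] := boolP (x \in Q).
    by rewrite mulr1 (le_trans _ (fm x))// gerBl.
  by move: nQx; rewrite notin_setE => /gQ ->; rewrite mulr0.
pose H := \int[mu]_(x in Q) (g x * u x).
have H0 : 0 <= H by apply: Rintegral_ge0 => x _; exact: mulr_ge0.
have bint h : bmeas h -> mu.-integrable Q (EFin \o h) by exact: bmeas_int.
have var v : bmeas v -> (forall x, 0 <= v x) -> (N v <= K%:E)%E ->
    \int[mu]_(x in Q) (g x * v x) <= H.
  move=> bv v0 vK.
  have bvu : bmeas (fun x => v x - u x) by exact: bmeasB.
  have ib1 := bint _ (bmeasM bg bvu).
  have ib2 := bint _ (bmeas_sqr bvu).
  rewrite -subr_ge0 -oppr_le0 opprB /H -RintegralB//; [|exact/bint/bmeasM..].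
  under eq_Rintegral do rewrite -mulrBr.
  set I1 := Rintegral _ _ _.
  have key t : 0 < t -> t <= 1 ->
      2 * I1 <= t * \int[mu]_(x in Q) (v x - u x) ^+ 2.
    (* Competitor for the variational inequality: a step [t] from [u] towards [v] stays in the
       convex ball, and truncating it at [f] puts it in [U] without moving it away from [f].
       Expanding the square and letting [t] tend to 0 gives [var]. *)
    move=> t0 t1; pose w x := Num.min (f x) ((1 - t) * u x + t * v x).
    have buv : bmeas (fun x => (1 - t) * u x + t * v x).
      by apply: bmeasD; exact: bmeasZ.
    have bw : bmeas w by exact: bmeas_min.
    have uv0 x : 0 <= (1 - t) * u x + t * v x.
      by rewrite addr_ge0// mulr_ge0// ?subr_ge0// ltW.
    have w0 x : 0 <= w x by rewrite le_min f0 uv0.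
    have Uw : U w.
      split; first by have [] := bw.
        by move=> x; rewrite w0 ge_min lexx.
      have t01 : 0 <= t <= 1 by rewrite t1 ltW.
      have mv : measurable_fun setT v by have [] := bv.
      apply: le_trans (Uconv u v t t01 mu' mv uK vK); apply: N_le.
      - by have [] := buv.
      - by have [] := bw.
      - by apply: aeW => x; rewrite !ger0_norm// ge_min lexx orbT.
    have h1 := umin w Uw.
    have h2 : \int[mu]_(x in Q) (f x - w x) ^+ 2 <=
        \int[mu]_(x in Q) (g x ^+ 2 + ((- 2 * t) * (g x * (v x - u x)) +
          t ^+ 2 * (v x - u x) ^+ 2)).
      apply: le_Rintegral => //.
      - exact/bint/bmeas_sqr/bmeasB.
      - apply: bint; apply: bmeasD; first exact: bmeas_sqr.
        by apply: bmeasD; apply: bmeasZ; [exact: bmeasM|exact: bmeas_sqr].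
      - move=> x _.
        rewrite (_ : _ + (_ + _) = (g x - t * (v x - u x)) ^+ 2); last by ring.
        rewrite -[leLHS]real_normK ?num_real// -[leRHS]real_normK ?num_real//.
        rewrite lerXn2r ?nnegrE//.
        have -> : g x - t * (v x - u x) = f x - ((1 - t) * u x + t * v x).
          by rewrite /g; ring.
        rewrite /w minEle; case: ifPn => // h; by rewrite subrr normr0.
    have := le_trans h1 h2.
    rewrite RintegralD//; [|by apply/bint/bmeas_sqr|apply: bint; apply: bmeasD; apply: bmeasZ; [exact: bmeasM|exact: bmeas_sqr]].
    rewrite RintegralD//; [|apply: bint; apply: bmeasZ; exact: bmeasM|apply: bint; apply: bmeasZ; exact: bmeas_sqr].
    rewrite RintegralZl// RintegralZl// -/I1.
    rewrite (_ : \int[mu]_(x in Q) (f x - u x) ^+ 2 = \int[mu]_(x in Q) (g x ^+ 2))//.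
    move=> h3; rewrite -(ler_pM2l t0); rewrite expr2 in h3; lra.
  have I20 : 0 <= \int[mu]_(x in Q) (v x - u x) ^+ 2.
    by apply: Rintegral_ge0 => x _; exact: sqr_ge0.
  apply: (ler_addexp2 I20) => k; rewrite add0r mulrC.
  have p0 : 0 < (2 ^+ k)^-1 :> R by rewrite invr_gt0 exprn_gt0.
  have p1 : (2 ^+ k)^-1 <= 1 :> R.
    by rewrite invf_le1 ?exprn_gt0// exprn_ege1// ler1n.
  have := key _ p0 p1; have := mulr_ge0 (ltW p0) I20; lra.
(* Multiplying a function of norm at most 1 by [K] brings it into the ball, where [var] bounds its
   pairing with [g] by [H]. Truncation at height [j] supplies the boundedness that [var]
   requires. *)
have AgK : (A g <= (H / K)%:E)%E.
  apply: A_le => // v mv v0 v1.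
  pose vj (j : nat) x := Num.min (v x) j%:R.
  have vj0 j x : 0 <= vj j x by rewrite le_min v0 ler0n.
  have mvj j : measurable_fun setT (vj j) by exact: measurable_minr.
  have bvj j : bmeas (vj j).
    split => //; exists j%:R => x; rewrite ger0_norm// /vj.
    by rewrite ge_min lexx orbT.
  have vjK j : \int[mu]_(x in Q) (g x * vj j x) <= H / K.
    rewrite ler_pdivlMr// -RintegralZr//; last exact/bint/bmeasM.
    under eq_Rintegral do rewrite -mulrA [vj _ _ * K]mulrC.
    have vj1 : (N (vj j) <= 1)%E.
      apply: le_trans v1; apply: N_le => //.
      by apply: aeW => x; rewrite !ger0_norm// /vj ge_min lexx.
    apply: var; first exact: bmeasZ.
      by move=> x; rewrite mulr_ge0// ltW.
    rewrite N_scale; last by rewrite (le_lt_trans vj1)// ltry.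
    by rewrite ger0_norm ?(ltW K0)// -[leRHS]mule1 lee_wpmul2l// lee_fin ltW.
  have -> : (\int[mu]_x (g x * v x)%:E = \int[mu]_(x in Q) (g x * v x)%:E)%E.
    rewrite [RHS]integral_mkcond; apply: eq_integral => x _.
    rewrite patchE; case: ifPn => // /negP nQ; rewrite gQ ?mul0r//.
    by move=> Qx; apply: nQ; rewrite inE.
  have mgQ h : measurable_fun setT h -> measurable_fun Q (fun x => (g x * h x)%:E).
    move=> mh; apply/measurable_EFinP/measurable_funTS.
    by apply: measurable_funM => //; have [] := bg.
  have gv0 j x : Q x -> (0 <= (g x * vj j x)%:E)%E by rewrite lee_fin mulr_ge0.
  have ndgv x : Q x -> nondecreasing_seq (fun j => (g x * vj j x)%:E).
    move=> _ j k jk; rewrite lee_fin ler_wpM2l// /vj le_min ge_min lexx/=.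
    by rewrite ge_min ler_nat jk orbT.
  have cvm := cvg_monotone_convergence mQ (fun j => mgQ _ (mvj j)) gv0 ndgv.
  have -> : (\int[mu]_(x in Q) (g x * v x)%:E =
      \int[mu]_(x in Q) limn (fun j => (g x * vj j x)%:E))%E.
    apply: eq_integral => x _; apply/esym/cvg_lim => //; apply: cvg_near_cst.
    exists (Num.bound (v x)) => // j /= jv; rewrite /vj min_l//.
    by rewrite (le_trans (ltW (archi_boundP (v0 x))))// ler_nat.
  rewrite -(cvg_lim _ (cvm mu))//; apply: lime_le; first by apply/cvg_ex; eexists; exact: cvm.
  apply: nearW => j; rewrite -Rintegral_EFin//; first by rewrite lee_fin.
  exact/bint/bmeasM.
have Agoo : (A g < +oo)%E by rewrite (le_lt_trans AgK)// ltry.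
have mg : measurable_fun setT g by have [] := bg.
have gmQ x : 0 <= g x <= `|m| * \1_Q x by rewrite g0 gm.
have := fg g `|m| mg gmQ Agoo.
rewrite -Rintegral_EFin//; last exact/bint/bmeasM.
have KA : (K%:E * A g <= H%:E)%E.
  apply: le_trans (lee_wpmul2l _ AgK) _; first by rewrite lee_fin ltW.
  by rewrite -EFinM mulrCA divff ?mulr1// gt_eqF.
move=> /le_trans/(_ KA); rewrite lee_fin.
(* As [f = u + g], the duality hypothesis becomes [H + int g^2 <= H]. Hence [g] vanishes almost
   everywhere on [Q], and [f] inherits the norm bound of [u]. *)
have -> : \int[mu]_(x in Q) (f x * g x) = H + \int[mu]_(x in Q) (g x ^+ 2).
  rewrite -RintegralD//; [|exact/bint/bmeasM|exact/bint/bmeas_sqr].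
  by apply: eq_Rintegral => x _; rewrite /g; ring.
rewrite gerDl => g20.
have g2 : (\int[mu]_(x in Q) `|(g x ^+ 2)%:E| = 0)%E.
  under eq_integral do rewrite gee0_abs ?lee_fin ?sqr_ge0//.
  rewrite -Rintegral_EFin//; last exact/bint/bmeas_sqr.
  congr EFin; apply/eqP; rewrite eq_le g20/=.
  by apply: Rintegral_ge0 => x _; exact: sqr_ge0.
have mg2 : measurable_fun Q (fun x => (g x ^+ 2)%:E).
  by apply/measurable_EFinP/measurable_funTS; have [] := bmeas_sqr bg.
have aeg := (ae_eq_integral_abs mu mQ mg2).1 g2.
apply: le_trans uK; apply: N_le => //.
apply: ae_imply aeg => x gx.
have [Qx|/gQ] := pselect (Q x); last by rewrite /g => /eqP; rewrite subr_eq0 => /eqP ->.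
have /eqP := gx Qx; rewrite eqe sqrf_eq0 /g subr_eq0 => /eqP ->; exact: lexx.
Qed.

(** Truncation at height [j] and the Fatou property reduce to bounded functions. [K] is enlarged to
    [K + e] because the bounded case divides by it. *)
Lemma lorentz_luxemburg f (K : R) : measurable_fun setT f -> (forall x, 0 <= f x) ->
  (forall x, ~ Q x -> f x = 0) -> 0 <= K ->
  (forall g G, measurable_fun setT g -> (forall x, 0 <= g x <= G * \1_Q x) ->
    (A g < +oo)%E -> (\int[mu]_(x in Q) (f x * g x)%:E <= K%:E * A g)%E) ->
  (N f <= K%:E)%E.
Proof.
move=> mf f0 fQ K0 fg; apply/lee_addgt0Pr => e e0; rewrite -EFinD.
have Ke : 0 < K + e by rewrite ltr_wpDl.
pose fj (j : nat) x := Num.min (f x) j%:R.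
have mfj j : measurable_fun setT (fj j) by exact: measurable_minr.
have fj0 j x : 0 <= fj j x by rewrite le_min f0 ler0n.
have cvf : (fun j => N (fj j)) @ \oo --> N f.
  apply: N_Fatou => // x.
    move=> j k jk; rewrite /fj le_min ge_min lexx/=.
    by rewrite ge_min ler_nat jk orbT.
  apply: cvg_near_cst; exists (Num.bound (f x)) => // j /= jv; rewrite /fj min_l//.
  by rewrite (le_trans (ltW (archi_boundP (f0 x))))// ler_nat.
have /cvg_lim <- // := cvf; apply: lime_le; first by apply/cvg_ex; exists (N f).
apply: nearW => j; apply: (@lorentz_luxemburg_bounded _ j%:R) => //.
  move=> x; rewrite fj0/= indicE; have [Qx|nQx] := boolP (x \in Q).
    by rewrite mulr1 ge_min lexx orbT.
  rewrite mulr0 /fj fQ; last by rewrite notin_setE in nQx.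
  by rewrite ge_min lexx.
move=> g G mg gG Agoo.
have g0 x : 0 <= g x by have /andP[] := gG x.
apply: (@le_trans _ _ (\int[mu]_(x in Q) (f x * g x)%:E)%E).
  apply: ge0_le_integral => //.
  - by move=> x _; rewrite lee_fin mulr_ge0.
  - by apply/measurable_EFinP/measurable_funTS/measurable_funM.
  - by apply/measurable_EFinP/measurable_funTS/measurable_funM.
  - by move=> x _; rewrite lee_fin ler_wpM2r// ge_min lexx.
apply: le_trans (fg g G mg gG Agoo) _.
by rewrite lee_wpmul2r// lee_fin lerDl ltW.
Qed.

End lorentz_luxemburg.

(** * BMO functions in ball Banach function spaces *)

Section ball_Banach_theory.
Context (R : realType) (n : nat).
Local Notation Rn := 'rV[R]_n.
Local Notation T := (leb_space R n).
Local Notation mu := (leb R n).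
Implicit Types (f g u v : Rn -> R).

Definition creal f : Rn -> R[i] := fun x => (f x)%:C.

Lemma normcR (r : R) : normc (r%:C) = `|r|.
Proof. by rewrite /normc/= expr0n/= addr0 sqrtr_sqr. Qed.

Lemma normc_ge0 (z : R[i]) : 0 <= normc z.
Proof. by case: z => a b; exact: sqrtr_ge0. Qed.

Lemma lmeasurable_creal f : measurable_fun setT (f : T -> R) -> lmeasurable (creal f).
Proof. by move=> mf; split => //=; exact: measurable_cst. Qed.

Lemma lmeasurable_crealP f : lmeasurable (creal f) -> measurable_fun setT (f : T -> R).
Proof. by case. Qed.

Lemma lmeasurable_normc (h : Rn -> R[i]) : lmeasurable h ->
  measurable_fun setT ((fun x => normc (h x)) : T -> R).
Proof.
move=> [mr mi].
rewrite (_ : (fun x => normc (h x)) =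
  (fun x : T => Num.sqrt (complex.Re (h x) ^+ 2 + complex.Im (h x) ^+ 2))); last first.
  by apply/funext => x; case: (h x).
apply: (@measurableT_comp _ _ _ _ _ _ (@Num.sqrt R)).
  by apply: continuous_measurable_fun; exact: sqrt_continuous.
by apply: measurable_funD; apply: measurable_funX.
Qed.

Variable X : (Rn -> R[i]) -> \bar R.
Hypothesis hX : ball_Banach X.
Local Notation XR f := (X (creal f)).

Lemma XR_le f g : measurable_fun setT (f : T -> R) -> measurable_fun setT (g : T -> R) ->
  {ae mu, forall x, `|g x| <= `|f x|} -> (XR g <= XR f)%E.
Proof.
move=> mf mg gf; apply: (bB_lattice hX); [exact: lmeasurable_creal..|].
by apply: ae_imply gf => x; rewrite !normcR.
Qed.

Lemma XR_normc (h : Rn -> R[i]) : lmeasurable h -> XR (fun x => normc (h x)) = X h.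
Proof.
move=> mh; have mn := lmeasurable_creal (lmeasurable_normc mh).
apply/eqP; rewrite eq_le; apply/andP; split; apply: (bB_lattice hX) => //;
  by apply: aeW => x; rewrite normcR ger0_norm// normc_ge0.
Qed.

Lemma XR_scale c f : (XR f < +oo)%E -> XR (fun x => c * f x) = (`|c|%:E * XR f)%E.
Proof.
move=> fX; rewrite -normcR -(bB_scale hX)//; congr X; apply/funext => x.
by rewrite /creal rmorphM.
Qed.

Lemma XR_triangle f g : measurable_fun setT (f : T -> R) -> measurable_fun setT (g : T -> R) ->
  (XR (fun x => f x + g x)%R <= XR f + XR g)%E.
Proof.
move=> mf mg; have := bB_triangle hX (lmeasurable_creal mf) (lmeasurable_creal mg).
by rewrite (_ : (fun x => creal f x + creal g x) = creal (fun x => f x + g x))//;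
  apply/funext => x; rewrite /creal rmorphD.
Qed.

Lemma XR_ball_lty c r : 0 < r -> (XR \1_(eball c r) < +oo)%E.
Proof. exact: bB_ball. Qed.

Lemma XR0 : XR (cst 0) = 0%E.
Proof.
have := XR_scale 0 (XR_ball_lty (0 : Rn) ltr01).
rewrite normr0 mul0e => <-; congr X; apply/funext => x.
by rewrite /creal/= mul0r.
Qed.

Lemma XR_indic_gt0 (Q : set Rn) : measurable (Q : set T) -> (0 < mu Q)%E -> (0 < XR \1_Q)%E.
Proof.
move=> mQ Q0; rewrite lt0e (bB_ge0 hX) andbT; apply/eqP => /(bB_definite hX) h.
have : mu.-negligible Q.
  apply: negligibleS h => x Qx /=; rewrite /creal indicE mem_set// => /eqP.
  by rewrite eq_complex/= oner_eq0.
by move/(measure_negligible mQ) => Q0'; rewrite Q0' ltxx in Q0.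
Qed.

Local Notation AR g := (associate_norm X (creal g)).

Lemma associate_le g (H : \bar R) : (forall x, 0 <= g x) ->
  (forall v, measurable_fun setT (v : T -> R) -> (forall x, 0 <= v x) -> (XR v <= 1)%E ->
    (\int[mu]_x (g x * v x)%:E <= H)%E) -> (AR g <= H)%E.
Proof.
move=> g0 gH; apply: ge_ereal_sup => _ [h /= Xh <-].
have mh : lmeasurable h by apply: (bB_measurable hX); rewrite Xh ltry.
under eq_integral do rewrite normcM normcR ger0_norm//.
apply: gH; [exact: lmeasurable_normc|by move=> x; exact: normc_ge0|].
by rewrite XR_normc// Xh.
Qed.

(** The associate norm is tested on the indicator of [Q] divided by its norm; hence the need for
    that norm to be positive and finite. *)
Lemma associate_holder (g s : Rn -> R) (Q : set Rn) : measurable (Q : set T) ->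
  (0 < XR \1_Q)%E -> (XR \1_Q < +oo)%E ->
  measurable_fun setT (s : T -> R) -> (forall x, 0 <= s x) ->
  {ae mu, forall x, s x <= `|g x|} ->
  (\int[mu]_(x in Q) (s x)%:E <= XR \1_Q * AR g)%E.
Proof.
move=> mQ Q0 Qoo ms s0 sg.
pose r := fine (XR \1_Q).
have rE : XR \1_Q = r%:E by rewrite fineK// ge0_fin_numE// ltW.
have r0 : 0 < r by rewrite -lte_fin -rE.
have X1 : XR (fun x => r^-1 * \1_Q x) = 1%E.
  by rewrite XR_scale// rE -EFinM ger0_norm ?invr_ge0 ?ltW// mulVf// gt_eqF.
rewrite rE -lee_pdivrMl//.
apply: le_ereal_sup_tmp; eexists; first by exists (creal (fun x => r^-1 * \1_Q x)).
have ri0 : 0 <= r^-1 by rewrite invr_ge0 ltW.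
apply: le_trans (holder_indic mQ ms s0 ri0 sg) _.
rewrite le_eqVlt; apply/orP; left; apply/eqP; apply: eq_integral => x _.
by rewrite normcM !normcR -normrM.
Qed.

End ball_Banach_theory.

(** * BMO on dyadic boxes and its estimate in X *)

Section bmo_boxes.
Context (R : realType) (n : nat).
Local Notation Rn := 'rV[R]_n.
Local Notation T := (leb_space R n).
Local Notation mu := (leb R n).
Hypothesis n0 : (0 < n)%N.
Implicit Types (c a : Rn) (r s : R).

Lemma lebm_eball c r : measurable (eball c r : set T).
Proof. by apply: leb_measurable; exact: measurable_eball. Qed.

Lemma maximal_ge0 (f : Rn -> R[i]) x : (0 <= maximal f x)%E.
Proof.
apply: (@le_trans _ _ (ball_mean x 1 (fun y => (normc (f y))%:E))).
  apply: mule_ge0; first by rewrite lee_fin invr_ge0 fine_ge0.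
  by apply: integral_ge0 => y _; rewrite lee_fin normc_ge0.
apply: ereal_sup_ubound; exists x, 1; split => //.
rewrite /eball/= subrr /enorm; rewrite big1 ?sqrtr0// => i _.
by rewrite mxE expr0n.
Qed.

Variable beta : Rn -> R.
Hypothesis hb : BMO (creal beta).

Lemma bmo_measurable : measurable_fun setT (beta : T -> R).
Proof. by case: hb => -[/lmeasurable_crealP]. Qed.

Lemma bmo_int_ball c r : 0 < r -> mu.-integrable (eball c r) (EFin \o beta).
Proof.
move=> r0; apply/integrableP; split.
  by apply/measurable_EFinP/measurable_funTS; exact: bmo_measurable.
case: hb => -[_ /(_ c r r0) h] _; apply: le_lt_trans h.
by under [X in (_ <= X)%E]eq_integral do rewrite normcR.
Qed.

Lemma bmo_int (A : set Rn) c r : measurable (A : set T) -> 0 < r -> A `<=` eball c r ->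
  mu.-integrable A (EFin \o beta).
Proof.
move=> mA r0 Ac; apply: (rintS _ mA Ac); first exact: lebm_eball.
exact: bmo_int_ball.
Qed.

Definition bmo : R := fine (BMO_norm (creal beta)).

Definition bavg c r : R := (ballvol c r)^-1 * \int[mu]_(x in eball c r) beta x.

Lemma ball_avgE c r : ball_avg c r (creal beta) = (bavg c r)%:C.
Proof.
rewrite /ball_avg /cintegral /bavg rmorphM; congr (_ * _).
apply/eqP; rewrite eq_complex/= eqxx/=; apply/eqP.
by rewrite /Rintegral integral0_eq.
Qed.

Lemma BMO_normP c r : 0 < r ->
  ((ballvol c r)^-1%:E * \int[mu]_(x in eball c r) `|beta x - bavg c r|%:E
    <= BMO_norm (creal beta))%E.
Proof.
move=> r0; apply: ereal_sup_ubound; exists c, r; split => //.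
rewrite /ball_mean; congr (_ * _)%E; apply: eq_integral => x _.
by rewrite ball_avgE -rmorphB normcR.
Qed.

Lemma BMO_normE : BMO_norm (creal beta) = bmo%:E.
Proof.
rewrite fineK// ge0_fin_numE; first by case: hb.
apply: le_trans (BMO_normP 0 ltr01); rewrite mule_ge0//.
  by rewrite lee_fin invr_ge0 fine_ge0.
by apply: integral_ge0 => x _; rewrite lee_fin.
Qed.

Lemma bmo_ge0 : 0 <= bmo.
Proof.
rewrite -lee_fin -BMO_normE; apply: le_trans (BMO_normP 0 ltr01); rewrite mule_ge0//.
  by rewrite lee_fin invr_ge0 fine_ge0.
by apply: integral_ge0 => x _; rewrite lee_fin.
Qed.

Lemma rint_eball_cst c r (k : R) : mu.-integrable (eball c r) (EFin \o cst k).
Proof. by apply: rint_cst; [exact: lebm_eball|exact: eball_lty]. Qed.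

Lemma bmo_int_dist c r k : 0 < r ->
  mu.-integrable (eball c r) (EFin \o (fun x => `|beta x - k|)).
Proof.
move=> r0; apply: rint_norm; apply: rintB; first exact: lebm_eball.
  exact: bmo_int_ball.
exact: rint_eball_cst.
Qed.

Lemma bmo_ball c r : 0 < r ->
  \int[mu]_(x in eball c r) `|beta x - bavg c r| <= bmo * ballvol c r.
Proof.
move=> r0; have v0 := ballvol_gt0 n0 c r0.
have := BMO_normP c r0; rewrite BMO_normE -Rintegral_EFin.
- by rewrite -EFinM lee_fin mulrC ler_pdivrMr.
- exact: lebm_eball.
- exact: bmo_int_dist.
Qed.

Lemma bmo_subset (A : set Rn) c r : measurable (A : set T) -> 0 < r -> A `<=` eball c r ->
  \int[mu]_(x in A) `|beta x - bavg c r| <= bmo * ballvol c r.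
Proof.
move=> mA r0 Ac; apply: le_trans (bmo_ball c r0).
apply: Rintegral_le_subset => //; [exact: lebm_eball|exact: bmo_int_dist].
Qed.

Variable s : R.
Hypothesis s0 : 0 < s.
Local Notation dset := (@dset R n s).
Local Notation K8 := ((8 * n%:R) ^+ n : R).

Lemma bmo_int_dset (P : dbox R n) : mu.-integrable (dset P) (EFin \o beta).
Proof.
apply: (@bmo_int _ P.2 (2 * n%:R * scale n s P.1)); first exact: dset_measurable.
  by rewrite !mulr_gt0 ?ltr0n ?scale_gt0.
exact: dset_sub_eball.
Qed.

(** [K8] compares the box with a ball around it, and the factor 2 pays for replacing the average
    over the ball by that over the box. *)
Lemma tosc_bmo (P : dbox R n) :
  tosc mu dset beta P <= 2 * K8 * bmo * fine (mu (dset P)).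
Proof.
have r0 : 0 < 2 * n%:R * scale n s P.1 by rewrite !mulr_gt0 ?ltr0n ?scale_gt0.
apply: le_trans (tosc_le _ _ _ (bavg P.2 (2 * n%:R * scale n s P.1)) _) _.
- by move=> P'; exact: dset_measurable.
- by move=> P'; exact: dset_lty.
- by move=> P'; exact: dvol_gt0.
- exact: bmo_int_dset.
have h1 := bmo_subset (dset_measurable s P) r0 (@dset_sub_eball _ _ n0 _ s0 P).
have h2 := ler_wpM2l bmo_ge0 (ballvol_dset n0 s0 P).
lra.
Qed.

Lemma maximal_box (g : Rn -> R) (M : R) (P : dbox R n) x :
  measurable_fun setT (g : T -> R) -> (forall x, 0 <= g x) -> (forall x, g x <= M) ->
  dset P x -> ((tavg mu dset g P)%:E <= K8%:E * maximal (creal g) x)%E.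
Proof.
move=> mg g0 gM Px; set r := 2 * n%:R * scale n s P.1.
have r0 : 0 < r by rewrite !mulr_gt0 ?ltr0n ?scale_gt0.
have PB : dset P `<=` eball P.2 r by exact: dset_sub_eball.
have gi : mu.-integrable (eball P.2 r) (EFin \o g).
  apply: (@rint_bounded _ _ _ _ _ _ M); [exact: lebm_eball|exact: eball_lty|exact: measurable_funTS|].
  by move=> y _; rewrite ger0_norm.
have v0 := ballvol_gt0 n0 P.2 r0.
have V0 := dvol_gt0 s0 P.
apply: (@le_trans _ _ (K8%:E * ((ballvol P.2 r)^-1 * \int[mu]_(y in eball P.2 r) g y)%:E)%E).
  rewrite -EFinM lee_fin /tavg ler_pdivrMr//.
  have := Rintegral_le_subset (lebm_eball P.2 r) (dset_measurable s P) PB gi (fun y _ => g0 y).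
  move/le_trans; apply.
  set I := Rintegral _ _ _.
  rewrite (_ : _ * _ * _ = (K8 * fine (mu (dset P))) / ballvol P.2 r * I); last by ring.
  rewrite ler_peMl//; first by apply: Rintegral_ge0.
  by rewrite ler_pdivlMr// mul1r; exact: ballvol_dset.
apply: lee_wpmul2l; first by rewrite lee_fin exprn_ge0// mulr_ge0.
apply: ereal_sup_ubound; exists P.2, r; split => //; first exact: PB.
rewrite /ball_mean EFinM; congr (_ * _)%E.
rewrite Rintegral_EFin//; last exact: lebm_eball.
by apply: eq_integral => y _; rewrite normcR ger0_norm.
Qed.

Variable X : (Rn -> R[i]) -> \bar R.
Hypothesis hX : ball_Banach X.
Local Notation XR f := (X (creal f)).
Local Notation AR g := (associate_norm X (creal g)).

Lemma XR_cube_gt0 (Q : set Rn) : measurable (Q : set T) -> (0 < fine (mu Q)) -> (0 < XR \1_Q)%E.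
Proof.
move=> mQ Q0; apply: XR_indic_gt0 => //.
rewrite lt0e measure_ge0 andbT; apply/eqP => h; by rewrite h ltxx in Q0.
Qed.

Lemma XR_sub_ball_lty (Q : set Rn) c r : measurable (Q : set T) -> 0 < r ->
  Q `<=` eball c r -> (XR \1_Q < +oo)%E.
Proof.
move=> mQ r0 Qc; apply: le_lt_trans (XR_ball_lty hX c r0).
apply: (XR_le hX); [apply: measurable_indic; exact: lebm_eball|exact: measurable_indic|].
apply: aeW => x; rewrite !indicE; have [Qx|nQx] := boolP (x \in Q).
  by rewrite mem_set//; apply: Qc; exact: set_mem.
by rewrite normr0.
Qed.

Lemma associate_ge0 (g : Rn -> R) : (0 <= AR g)%E.
Proof.
have X0 : (0 < XR \1_(eball (0%R : Rn) 1))%E.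
  by apply: XR_cube_gt0; [exact: lebm_eball|exact: ballvol_gt0].
have := @associate_holder R n X hX g (cst 0) (eball 0 1) (lebm_eball 0 1) X0 (XR_ball_lty hX 0 ltr01).
rewrite integral0 => h; have : (0 <= XR \1_(eball (0%R : Rn) 1) * AR g)%E.
  by apply: h; [exact: measurable_cst|by []|by apply: aeW => x /=].
by rewrite pmule_rge0.
Qed.

Variable C : R.
Hypothesis C0 : 0 < C.
Hypothesis hC : forall f, lmeasurable f -> (associate_norm X f < +oo)%E ->
  {ae mu, forall x, (maximal f x < +oo)%E} /\
  (associate_norm X (fun x => (fine (maximal f x))%:C) <= C%:E * associate_norm X f)%E.

Lemma dset_XR_lty (P : dbox R n) : (XR \1_(dset P) < +oo)%E.
Proof.
apply: (@XR_sub_ball_lty _ P.2 (2 * n%:R * scale n s P.1)); first exact: dset_measurable.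
  by rewrite !mulr_gt0 ?ltr0n ?scale_gt0.
exact: dset_sub_eball.
Qed.

(** Lorentz-Luxemburg duality combined with [tree_duality]. With [kappa = 2 * K8 * bmo] and
    [W = K8 * C] times the two norms, the constant is [12 * 2 * K8 * K8 = 24 * K8^2]. *)
Lemma bmo_XR (P : dbox R n) :
  (XR (fun x => `|beta x - tavg mu dset beta P| * \1_(dset P) x)%R <=
    (24 * K8 ^+ 2 * C * bmo)%:E * XR \1_(dset P))%E.
Proof.
have mQ := dset_measurable s P.
have XQoo := dset_XR_lty P.
have XQ0 : (0 < XR \1_(dset P))%E by apply: XR_cube_gt0 => //; exact: dvol_gt0.
set w := fine (XR \1_(dset P)).
have wE : XR \1_(dset P) = w%:E by rewrite fineK// ge0_fin_numE// ltW.
have w0 : 0 <= w by rewrite fine_ge0// ltW.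
have K80 : 0 < K8 by rewrite exprn_gt0// mulr_gt0// ltr0n.
rewrite wE -EFinM.
have mbeta := bmo_measurable.
have mdist : measurable_fun setT (fun x : T => `|beta x - tavg mu dset beta P|).
  exact: measurable_fun_dist.
apply: (@lorentz_luxemburg _ T R mu (fun f => XR f) (fun g => AR g) _ _ _ _ _ _ _ (dset P)).
- exact: XR_le.
- exact: XR_scale.
- exact: XR_triangle.
- exact: XR0.
- move=> v u mv mu' v0 ndv vu.
  apply: (bB_Fatou hX _ _ _).2; [|exact: lmeasurable_creal|].
    by move=> k; exact: lmeasurable_creal.
  by apply: aeW => x; split => // k; exact: v0.
- exact: associate_le.
- exact: associate_ge0.
- exact: mQ.
- exact: dset_lty.
- by apply: measurable_funM; [exact: mdist|exact: measurable_indic].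
- by move=> x; rewrite mulr_ge0.
- by move=> x Px; rewrite indicE memNset ?mulr0.
- by rewrite !mulr_ge0 ?bmo_ge0 ?sqr_ge0// ltW.
move=> g G mg gG Agoo.
have g0 x : 0 <= g x by have /andP[] := gG x.
have gM x : g x <= `|G|.
  have /andP[_ /le_trans->//] := gG x; rewrite (le_trans (ler_norm _))// normrM.
  by rewrite ler_piMr// ger0_norm ?indicE//; case: (_ \in _).
set Ag := fine (AR g).
have AgE : AR g = Ag%:E by rewrite fineK// ge0_fin_numE// associate_ge0.
have [aefin Mle] := hC (lmeasurable_creal mg) Agoo.
pose mx x := fine (maximal (creal g) x).
(* [t] is the integrand of [treemax]. Divided by [K8] it is at most [M g] almost everywhere on the
   box, so pairing with the indicator and the boundedness of M on X' bound its integral at every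
   depth [N]. *)
have tm N : treemax mu dset (dchild s) g N P 0 <= K8 * (w * (C * Ag)).
  have [t [mt [M tM] t0 tv ->]] := @treemaxP _ T R mu _ dset (dchild s)
    (@dset_measurable R n s) (dchildU n0 s0) (dchildI n0 s0) (dset_lty s0) g N P 0.
  pose t' x := K8^-1 * t x.
  have mt' : measurable_fun setT (t' : T -> R).
    by apply: (@measurable_funM _ _ _ _ (cst K8^-1 : T -> R)) => //; exact: measurable_cst.
  have t'0 x : 0 <= t' x by rewrite mulr_ge0// invr_ge0 ltW.
  pose t'' x := t' x * \1_(dset P) x.
  have ti : mu.-integrable (dset P) (EFin \o t).
    by apply: (@rint_bounded _ _ _ _ _ _ M) => //; [exact: dset_lty|exact: measurable_funTS].
  have aet : {ae mu, forall x, t'' x <= `|mx x|}.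
    apply: ae_imply aefin => x xoo; rewrite /t'' indicE.
    have [/set_mem Px|_] := boolP (x \in dset P); last by rewrite mulr0.
    rewrite mulr1 /t'; have [->|[P' P'x ->]] := tv x Px; first by rewrite mulr0.
    have := maximal_box mg g0 gM P'x.
    rewrite -[maximal _ _]fineK.
      rewrite -EFinM lee_fin => h; rewrite ler_pdivrMl//.
      by apply: (le_trans h); apply: ler_wpM2l; [exact: ltW|exact: ler_norm].
    by rewrite ge0_fin_numE// maximal_ge0.
  have := associate_holder hX mQ XQ0 XQoo _ _ aet.
  have mt'' : measurable_fun setT (t'' : T -> R).
    by apply: measurable_funM => //; exact: measurable_indic.
  move=> /(_ mt''); have t''0 x : 0 <= t'' x by rewrite mulr_ge0.
  move=> /(_ t''0) h; rewrite -ler_pdivrMl// -RintegralZl// -lee_fin Rintegral_EFin//; last exact: rintZ.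
  apply: le_trans (_ : _ <= w%:E * (C%:E * Ag%:E))%E _; last by rewrite -!EFinM.
  rewrite -AgE -wE.
  apply: le_trans (lee_wpmul2l _ Mle); last exact: ltW.
  apply: le_trans h; rewrite le_eqVlt; apply/orP; left; apply/eqP.
  apply: eq_integral => x Px; rewrite /t'' /t' indicE Px mulr1//.
have dens : leaf_dense mu dset (dchild s) P beta.
  apply: leaf_dense_integrable.
  - exact: dset_measurable.
  - exact: dchildU.
  - exact: dchildI.
  - exact: dset_lty.
  - exact: dvol_gt0.
  - exact: dyadic_gen.
  - exact: bmo_int_dset.
have kappa0 : 0 <= 2 * K8 * bmo by rewrite !mulr_ge0 ?bmo_ge0// ltW.
have := tree_duality (@dset_measurable R n s) (dchildU n0 s0) (dchildI n0 s0) (dset_lty s0)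
  (dvol_gt0 s0) (dvol_half n0 s0) bmo_int_dset mg g0 gM dens kappa0 tosc_bmo tm.
rewrite AgE -EFinM => h.
rewrite (_ : (\int[mu]_(x in _) _ = \int[mu]_(x in dset P) (`|beta x - tavg mu dset beta P| * g x)%:E)%E); last first.
  by apply: eq_integral => x Px; rewrite indicE Px mulr1.
rewrite -Rintegral_EFin//.
  by rewrite lee_fin (le_trans h)// le_eqVlt; apply/orP; left; apply/eqP; ring.
apply: (@rintMb _ _ _ _ _ _ _ `|G|) => //; last first.
- by move=> x _; rewrite ger0_norm.
- exact: measurable_funTS.
- apply: rint_norm; apply: rintB => //; first exact: bmo_int_dset.
  by apply: rint_cst => //; exact: dset_lty.
Qed.

End bmo_boxes.

Section rintegral_bounds.
Context d (T : measurableType d) (R : realType) (mu : {measure set T -> \bar R}).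

Lemma fine_measureD (A B : set T) : measurable A -> measurable B -> A `<=` B ->
  (mu B < +oo)%E -> fine (mu (B `\` A)) = fine (mu B) - fine (mu A).
Proof.
move=> mA mB AB Boo; rewrite measureD// setIidr// fineB//.
  by rewrite ge0_fin_numE.
by rewrite ge0_fin_numE//; apply: le_lt_trans Boo; apply: le_measure; rewrite ?inE.
Qed.

Lemma rint_ae_ge (D : set T) (f : T -> R) (k : R) : measurable D ->
  mu.-integrable D (EFin \o f) -> measurable_fun D f -> (forall x, 0 <= f x) -> 0 <= k ->
  {ae mu, forall x, D x -> k <= f x} -> k * fine (mu D) <= \int[mu]_(x in D) f x.
Proof.
move=> mD fi mf f0 k0 kf; rewrite -lee_fin Rintegral_EFin//.
apply: (@le_trans _ _ (\int[mu]_(x in D) k%:E)%E).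
  rewrite integral_cst// EFinM; apply: lee_wpmul2l; first by rewrite lee_fin.
  have [Doo|Doo] := eqVneq (mu D) +oo%E; first by rewrite Doo /= leey.
  by rewrite fineK// ge0_fin_numE// ltey.
apply: ae_ge0_le_integral => //.
- by move=> x _; rewrite lee_fin.
- by apply/measurable_EFinP.
Qed.

End rintegral_bounds.

(** * Norms of indicators of cubes *)

Section cube_growth.
Context (R : realType) (n : nat).
Local Notation Rn := 'rV[R]_n.
Local Notation T := (leb_space R n).
Local Notation mu := (leb R n).
Hypothesis n0 : (0 < n)%N.
Let n0R : 0 < n%:R :> R. Proof. by rewrite ltr0n. Qed.
Implicit Types (c : Rn) (h : R).

Lemma cube_measurable c h : measurable (cube c h : set T).
Proof. by apply: leb_measurable; exact: measurable_box. Qed.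

Lemma cube_vol c h : 0 <= h -> fine (mu (cube c h)) = (2 * h) ^+ n.
Proof. by move=> h0; rewrite leb_cube. Qed.

Lemma cube_int1 c h : 0 <= h -> \int[mu]_(x in cube c h) \1_(cube c h) x = (2 * h) ^+ n :> R.
Proof.
move=> h0; have mQ := cube_measurable c h.
by rewrite /Rintegral integral_indic// setIid cube_vol.
Qed.

Lemma cube_lty c h : 0 <= h -> (mu (cube c h) < +oo)%E.
Proof. by move=> h0; rewrite leb_cube// ltry. Qed.

Lemma cube_sub_ball c h : 0 < h -> cube c h `<=` eball c (2 * n%:R * h).
Proof.
move=> h0; apply: cube_sub_eball; first exact: ltW.
by rewrite -mulrA mulr2n mulrDl mul1r ltrDl mulr_gt0.
Qed.

Lemma cubeS c h k : 0 <= h -> h <= k -> cube c h `<=` cube c k.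
Proof. by move=> h0 hk x /cubeP xh; apply/cubeP => i; have := xh i; lra. Qed.

Lemma maximal_cube (f : Rn -> R) (M : R) (A : set Rn) c h x :
  measurable_fun setT (f : T -> R) -> (forall x, 0 <= f x) -> (forall x, f x <= M) ->
  measurable (A : set T) -> A `<=` cube c h -> 0 < h -> cube c h x ->
  ((\int[mu]_(y in A) f y)%:E <= ((4 * n%:R * h) ^+ n)%:E * maximal (creal f) x)%E.
Proof.
move=> mf f0 fM mA Ac h0 xc; set r := 2 * n%:R * h.
have r0 : 0 < r by rewrite !mulr_gt0.
have AB : A `<=` eball c r by apply: subset_trans Ac _; exact: cube_sub_ball.
have fi : mu.-integrable (eball c r) (EFin \o f).
  apply: (@rint_bounded _ _ _ _ _ _ M); [exact: lebm_eball|exact: eball_lty|exact: measurable_funTS|].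
  by move=> y _; rewrite ger0_norm.
have v0 := ballvol_gt0 n0 c r0.
set I := \int[mu]_(y in eball c r) f y.
have I0 : 0 <= I by apply: Rintegral_ge0.
apply: (@le_trans _ _ (((4 * n%:R * h) ^+ n)%:E * ((ballvol c r)^-1 * I)%:E)%E).
  rewrite -EFinM lee_fin.
  apply: le_trans (Rintegral_le_subset (lebm_eball c r) mA AB fi (fun y _ => f0 y)) _.
  rewrite mulrA ler_peMl// ler_pdivlMr// mul1r.
  have := ballvol_le c (ltW r0).
  by rewrite (_ : 2 * r = 4 * n%:R * h)// /r; ring.
apply: lee_wpmul2l; first by rewrite lee_fin exprn_ge0// !mulr_ge0// ltW.
apply: ereal_sup_ubound; exists c, r; split => //; first exact: (cube_sub_ball h0 xc).
rewrite /ball_mean EFinM; congr (_ * _)%E.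
rewrite Rintegral_EFin//; last exact: lebm_eball.
by apply: eq_integral => y _; rewrite normcR ger0_norm.
Qed.

Variable X : (Rn -> R[i]) -> \bar R.
Hypothesis hX : ball_Banach X.
Local Notation XR f := (X (creal f)).
Variable C : R.
Hypothesis C0 : 0 < C.
Hypothesis hC : forall f, lmeasurable f -> (X f < +oo)%E ->
  {ae mu, forall x, (maximal f x < +oo)%E} /\
  (X (fun x => (fine (maximal f x))%:C) <= C%:E * X f)%E.

(** Functions of finite norm in X are measurable, and [hC] makes the norm of the maximal function
    finite. *)
Lemma fine_maximal_measurable (f : Rn -> R) : measurable_fun setT (f : T -> R) ->
  (XR f < +oo)%E -> measurable_fun setT ((fun x => fine (maximal (creal f) x)) : T -> R).
Proof.
move=> mf foo; have [_ h] := hC (lmeasurable_creal mf) foo.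
apply: lmeasurable_crealP; apply: (bB_measurable hX).
apply: (le_lt_trans h); rewrite lte_mul_pinfty//; first by rewrite lee_fin ltW.
Qed.

Lemma fine_maximal_ge (f : Rn -> R) x (t : R) :
  (maximal (creal f) x < +oo)%E -> (t%:E <= maximal (creal f) x)%E ->
  t <= fine (maximal (creal f) x).
Proof. by move=> foo; rewrite -lee_fin fineK// ge0_fin_numE// maximal_ge0. Qed.

Lemma cube_XR_lty c h : 0 < h -> (XR \1_(cube c h) < +oo)%E.
Proof.
move=> h0; apply: (@XR_sub_ball_lty _ _ _ hX _ c (2 * n%:R * h)).
- exact: cube_measurable.
- by rewrite !mulr_gt0.
- exact: cube_sub_ball.
Qed.

(** Mass [m] inside the cube forces [M f >= m / (4 * n * h)^n] on the whole cube, so the indicator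
    is dominated by a multiple of [M f]. *)
Lemma cube_XR_le (f : Rn -> R) (M m : R) (A : set Rn) c h :
  measurable_fun setT (f : T -> R) -> (forall x, 0 <= f x) -> (forall x, f x <= M) ->
  (XR f < +oo)%E -> measurable (A : set T) -> A `<=` cube c h -> 0 < h ->
  0 < m -> m <= \int[mu]_(y in A) f y ->
  (XR \1_(cube c h) <= ((4 * n%:R * h) ^+ n / m * C)%:E * XR f)%E.
Proof.
move=> mf f0 fM foo mA Ac h0 m0 mI.
have [aeoo Mle] := hC (lmeasurable_creal mf) foo.
have mmax := fine_maximal_measurable mf foo.
set a := (4 * n%:R * h) ^+ n / m.
have a0 : 0 < a by rewrite divr_gt0// exprn_gt0// !mulr_gt0.
have maxoo : (XR (fun x => fine (maximal (creal f) x)) < +oo)%E.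
  by apply: (le_lt_trans Mle); rewrite lte_mul_pinfty// lee_fin ltW.
apply: (@le_trans _ _ (XR (fun x => a * fine (maximal (creal f) x)))).
  apply: (XR_le hX); [|by apply: measurable_indic; exact: cube_measurable|].
    by apply: (@measurable_funM _ _ _ _ (cst a : T -> R)) => //; exact: measurable_cst.
  apply: ae_imply aeoo => x xoo; rewrite indicE.
  have [/set_mem xc|_] := boolP (x \in cube c h); last by rewrite normr0.
  rewrite normr1 ger0_norm; last first.
    by apply: mulr_ge0; [exact: ltW|rewrite fine_ge0// maximal_ge0].
  rewrite -ler_pdivrMl// mulr1; apply: fine_maximal_ge => //.
  have := maximal_cube mf f0 fM mA Ac h0 xc.
  rewrite -[maximal _ _]fineK ?ge0_fin_numE ?maximal_ge0// -EFinM !lee_fin.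
  move=> /(le_trans mI); rewrite /a invf_div ler_pdivrMr ?exprn_gt0 ?mulr_gt0//.
  by rewrite mulrC.
rewrite (XR_scale hX a maxoo) ger0_norm; last exact: ltW.
by rewrite (EFinM a C) -muleA; apply: lee_wpmul2l => //; rewrite lee_fin ltW.
Qed.

Lemma half_pow_le : 2^-1 <= 1 - (2 ^+ n)^-1 :> R.
Proof.
have : (2 ^+ n)^-1 <= 2^-1 :> R; last by lra.
by rewrite lef_pV2 ?posrE ?exprn_gt0// -[leLHS]expr1 ler_eXn2l// ltr1n.
Qed.

(* The minimum with 1 makes [M 1_Q] bounded, hence locally integrable, before [M] is
   applied a second time. *)
Lemma cube_XR_log c h (L : nat) : 0 < h -> (0 < L)%N ->
  (XR \1_(cube c (2 ^+ L * h)) <=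
   (2 * (2 * n%:R) ^+ (2 * n) * C ^+ 2 / L%:R * 2 ^+ (L * n))%:E * XR \1_(cube c h))%E.
Proof.
move=> h0 L0.
pose Q j := cube c (2 ^+ j * h).
have hj j : 0 < 2 ^+ j * h by rewrite mulr_gt0// exprn_gt0.
have mQ j : measurable (Q j : set T) by exact: cube_measurable.
pose f0 := fun x => fine (maximal (creal \1_(cube c h)) x).
pose f x := Num.min (f0 x) 1.
have mi : measurable_fun setT (\1_(cube c h) : T -> R).
  by apply: measurable_indic; exact: cube_measurable.
have ioo := cube_XR_lty c h0.
have mf0 : measurable_fun setT (f0 : T -> R) by exact: fine_maximal_measurable.
have [aeoo Mle] := hC (lmeasurable_creal mi) ioo.
have f00 x : 0 <= f0 x by rewrite fine_ge0// maximal_ge0.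
have mf : measurable_fun setT (f : T -> R).
  by apply: measurable_minr => //; exact: measurable_cst.
have f_ge0 x : 0 <= f x by rewrite le_min f00 ler01.
have f_le1 x : f x <= 1 by rewrite ge_min lexx orbT.
have Xf : (XR f <= C%:E * XR \1_(cube c h))%E.
  apply: le_trans Mle; apply: (XR_le hX) => //; apply: aeW => x.
  rewrite [leLHS]ger0_norm; last exact: f_ge0.
  rewrite [leRHS]ger0_norm; last exact: f00.
  by rewrite /f ge_min lexx.
have foo : (XR f < +oo)%E.
  by apply: (le_lt_trans Xf); rewrite lte_mul_pinfty// lee_fin ltW.
(* On [Q j] one has [M 1_Q >= (2 * h)^n / (4 * n * 2^j * h)^n = gam / 2^(j * n)]. Since [gam <= 1],
   truncation at 1 does not affect this bound. *)
pose gam : R := ((2 * n%:R) ^+ n)^-1.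
have gam0 : 0 < gam by rewrite invr_gt0 exprn_gt0// mulr_gt0.
have gam1 : gam <= 1.
  rewrite invf_le1 ?exprn_gt0 ?mulr_gt0// exprn_ege1//.
  have : 1 <= n%:R :> R by rewrite ler1n.
  lra.
have flow j : {ae mu, forall x, Q j x -> gam / (2 ^+ j) ^+ n <= f x}.
  apply: ae_imply aeoo => x xoo Qx.
  have p1 : ((2 ^+ j) ^+ n)^-1 <= 1 :> R.
    rewrite invf_le1; last by rewrite !exprn_gt0.
    by apply: exprn_ege1; apply: exprn_ege1; rewrite ler1n.
  rewrite le_min; apply/andP; split; last first.
    by rewrite mulr_ile1// ?invr_ge0 ?exprn_ge0// ltW.
  apply: fine_maximal_ge => //.
  have i01 x' : 0 <= \1_(cube c h) x' :> R by [].
  have i11 x' : \1_(cube c h) x' <= 1 :> R by rewrite indicE; case: (_ \in _).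
  have cc : cube c h `<=` Q j.
    by apply: cubeS; [exact: ltW|apply: ler_peMl; [exact: ltW|apply: exprn_ege1; rewrite ler1n]].
  have := maximal_cube mi i01 i11 (cube_measurable c h) cc (hj j) Qx.
  rewrite (cube_int1 _ (ltW h0)).
  have -> : maximal (creal \1_(cube c h)) x = (f0 x)%:E.
    by rewrite fineK// ge0_fin_numE// maximal_ge0.
  rewrite -EFinM !lee_fin => hh.
  rewrite -(ler_pM2l (_ : 0 < (4 * n%:R * (2 ^+ j * h)) ^+ n)); last first.
    by rewrite exprn_gt0// !mulr_gt0// exprn_gt0.
  apply: le_trans hh; rewrite /gam -!exprVn -!exprMn le_eqVlt; apply/orP; left; apply/eqP.
  by congr (_ ^+ n); rewrite exprVn; field; rewrite ?expf_neq0 ?gt_eqF.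
have fi j : mu.-integrable (Q j) (EFin \o f).
  apply: (@rint_bounded _ _ _ _ _ _ 1); [exact: mQ|by apply: cube_lty; exact: ltW|exact: measurable_funTS|].
  by move=> y _; rewrite ger0_norm.
(* The volume of a shell grows as fast as the lower bound for [f] decays, so each shell adds at
   least the same mass. The 1/2 bounds from below the proportion [1 - 2^-n] of the larger cube
   filled by the shell. *)
have int_ge j : j%:R * (gam * (2 * h) ^+ n / 2) <= \int[mu]_(x in Q j) f x.
  elim: j => [|j IH]; first by rewrite mul0r; apply: Rintegral_ge0.
  have QS : Q j `<=` Q j.+1.
    by apply: cubeS; [exact: ltW|rewrite ler_pM2r// ler_eXn2l// ltr1n].
  have mD : measurable (Q j.+1 `\` Q j : set T) by exact: measurableD.
  have vD : fine (mu (Q j.+1 `\` Q j)) = (2 * (2 ^+ j.+1 * h)) ^+ n * (1 - (2 ^+ n)^-1).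
    rewrite fine_measureD//; last by apply: cube_lty; exact: ltW.
    rewrite !cube_vol ?ltW// mulrBr mulr1 exprS; congr (_ - _).
    by rewrite -exprVn -exprMn; congr (_ ^+ n); field.
  have QU : Q j.+1 = Q j `|` (Q j.+1 `\` Q j) by rewrite setDUK.
  rewrite QU Rintegral_setU; [|exact: mQ|exact: mD|by rewrite -QU; exact: fi|]; last first.
    by apply/disj_setPS => x [? []].
  rewrite -natr1 mulrDl mul1r; apply: lerD => //.
  have k0 : 0 <= gam / (2 ^+ j.+1) ^+ n by rewrite divr_ge0 ?exprn_ge0// ltW.
  apply: le_trans (rint_ae_ge mD _ _ f_ge0 k0 _).
  - rewrite vD mulrA.
    have -> : gam / (2 ^+ j.+1) ^+ n * (2 * (2 ^+ j.+1 * h)) ^+ n = gam * (2 * h) ^+ n.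
      rewrite [2 * (_ * h)]mulrCA exprMn mulrA divfK//.
    apply: ler_wpM2l; last exact: half_pow_le.
    by rewrite mulr_ge0 ?(ltW gam0)// exprn_ge0// mulr_ge0// ltW.
  - by apply: (rintS (mQ j.+1) mD _ (fi j.+1)); exact: subDsetl.
  - exact: measurable_funTS.
  - by apply: ae_imply (flow j.+1) => x fx [Qx _]; exact: fx.
have L0R : 0 < L%:R :> R by rewrite ltr0n.
have h2 : 0 < (2 * h) ^+ n by rewrite exprn_gt0// mulr_gt0.
have m0 : 0 < L%:R * (gam * (2 * h) ^+ n / 2) by rewrite mulr_gt0// divr_gt0// mulr_gt0.
have := cube_XR_le mf f_ge0 f_le1 foo (mQ L) (@subset_refl _ _) (hj L) m0 (int_ge L).
move/le_trans; apply.
apply: le_trans (lee_wpmul2l _ Xf) _.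
  by rewrite lee_fin mulr_ge0 ?(ltW C0)// divr_ge0 ?(ltW m0)// exprn_ge0// !mulr_ge0// ltW.
rewrite muleA -EFinM le_eqVlt; apply/orP; left; apply/eqP; congr (_%:E * _)%E.
rewrite (_ : 4 * n%:R * (2 ^+ L * h) = (2 * n%:R) * 2 ^+ L * (2 * h)); last by ring.
rewrite (exprMn n (2 * n%:R * 2 ^+ L)) (exprMn n (2 * n%:R) (2 ^+ L)) /gam [(2 * n)%N]mulnC (exprM _ n 2) (exprM _ L n).
move: h2 => /lt0r_neq0; set H := (2 * h) ^+ n => H0.
set N := (2 * n%:R) ^+ n; have N0 : N != 0 by rewrite expf_neq0// mulf_neq0// gt_eqF.
by field; rewrite N0 H0 gt_eqF.
Qed.

Lemma cube_XR_double : exists2 L : nat, (0 < L)%N & forall c h, 0 < h ->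
  (XR \1_(cube c (2 ^+ L * h)) <= (2 ^+ (L * n) / 2)%:E * XR \1_(cube c h))%E.
Proof.
set K := 2 * (2 * n%:R) ^+ (2 * n) * C ^+ 2.
have K0 : 0 <= K by rewrite !mulr_ge0 ?exprn_ge0 ?mulr_ge0// ltW.
(* [L > 2 * K] makes the factor [K / L] of [cube_XR_log] at most 1/2. *)
pose L := (Num.bound (2 * K)).+1.
have hL : 2 * K < L%:R.
  apply: lt_trans (archi_boundP _) _; first by rewrite mulr_ge0.
  by rewrite ltr_nat.
exists L => // c h h0; apply: le_trans (cube_XR_log c h0 (ltn0Sn _)) _.
apply: lee_wpmul2r; first exact: (bB_ge0 hX).
rewrite lee_fin -/K -/L mulrC ler_pM2l ?exprn_gt0//.
by rewrite ler_pdivrMr ?ltr0n//; lra.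
Qed.

Lemma cube_XR_iter (L : nat) c h (m : nat) : 0 < h ->
  (forall c h, 0 < h ->
    (XR \1_(cube c (2 ^+ L * h)) <= (2 ^+ (L * n) / 2)%:E * XR \1_(cube c h))%E) ->
  (XR \1_(cube c (2 ^+ (m * L) * h)) <= ((2 ^+ (L * n) / 2) ^+ m)%:E * XR \1_(cube c h))%E.
Proof.
move=> h0 dbl; elim: m => [|m IH]; first by rewrite mul0n expr0 mul1r expr0 mul1e.
rewrite mulSn exprD -mulrA; apply: le_trans (dbl _ _ _) _; first by rewrite mulr_gt0// exprn_gt0.
rewrite exprS (EFinM (_ / _)) -muleA; apply: lee_wpmul2l IH.
by rewrite lee_fin divr_ge0// exprn_ge0.
Qed.

(** [M 1_F] is at least a multiple of [th] on the cube. This converts norms of cubes into the norm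
    of [1_F] demanded by the conclusion. *)
Lemma cube_XR_portion (F : set Rn) c h (th : R) : measurable (F : set T) -> F `<=` cube c h ->
  0 < h -> 0 < th -> th * (2 * h) ^+ n <= fine (mu F) ->
  (XR \1_(cube c h) <= ((2 * n%:R) ^+ n / th * C)%:E * XR \1_F)%E.
Proof.
move=> mF Fc h0 th0 hF.
have h2 : 0 < (2 * h) ^+ n by rewrite exprn_gt0// mulr_gt0.
have i01 x : 0 <= \1_F x :> R by [].
have i11 x : \1_F x <= 1 :> R by rewrite indicE; case: (_ \in _).
have Foo : (XR \1_F < +oo)%E.
  apply: le_lt_trans (cube_XR_lty c h0); apply: (XR_le hX).
  - by apply: measurable_indic; exact: cube_measurable.
  - exact: measurable_indic.
  apply: aeW => x; rewrite !indicE; have [Qx|nQx] := boolP (x \in F).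
    by rewrite mem_set//; apply: Fc; exact: set_mem.
  by rewrite normr0.
have m0 : 0 < th * (2 * h) ^+ n by rewrite mulr_gt0.
have mI : th * (2 * h) ^+ n <= \int[mu]_(y in F) \1_F y.
  by rewrite /Rintegral integral_indic// setIid.
have := cube_XR_le (measurable_indic mF) i01 i11 Foo mF Fc h0 m0 mI.
move/le_trans; apply; rewrite le_eqVlt; apply/orP; left; apply/eqP; congr (_%:E * _)%E.
rewrite (_ : 4 * n%:R * h = (2 * n%:R) * (2 * h)); last by ring.
rewrite exprMn; set H := (2 * h) ^+ n in h2 *; set N := (2 * n%:R) ^+ n.
by field; rewrite !gt_eqF.
Qed.

End cube_growth.

Section mean_distance.
Context d (T : measurableType d) (R : realType) (mu : {measure set T -> \bar R}).
Implicit Types (D E : set T) (f : T -> R).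

Lemma rint_distD D f a a' : measurable D -> (mu D < +oo)%E -> mu.-integrable D (EFin \o f) ->
  \int[mu]_(x in D) `|f x - a| <=
    \int[mu]_(x in D) `|f x - a'| + `|a' - a| * fine (mu D).
Proof.
move=> mD Doo fi.
have ia := rint_cst a mD Doo; have ia' := rint_cst a' mD Doo.
have ib := rint_cst `|a' - a| mD Doo.
have id1 := rint_norm (rintB mD fi ia); have id2 := rint_norm (rintB mD fi ia').
rewrite -Rintegral_cst// -RintegralD//.
apply: le_Rintegral => //; first exact: rintD.
by move=> x _ /=; rewrite -[f x - a](subrKA a') ler_normD.
Qed.

Lemma rint_mean_dist D E f a : measurable D -> measurable E -> E `<=` D ->
  (mu D < +oo)%E -> 0 < fine (mu E) -> mu.-integrable D (EFin \o f) ->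
  `|(\int[mu]_(x in E) f x) / fine (mu E) - a| * fine (mu E) <= \int[mu]_(x in D) `|f x - a|.
Proof.
move=> mD mE ED Doo E0 fi.
have Eoo : (mu E < +oo)%E.
  by apply: le_lt_trans Doo; apply: le_measure; rewrite ?inE.
have fE := rintS mD mE ED fi.
apply: le_trans (Rintegral_le_subset mD mE ED (rint_norm (rintB mD fi (rint_cst a mD Doo))) _); last by [].
rewrite -[X in _ * X](ger0_norm (ltW E0)) -normrM mulrBl divfK ?gt_eqF//.
rewrite -Rintegral_cst// -RintegralB//; last exact: rint_cst.
by apply: le_normr_Rintegral => //; apply: rintB => //; exact: rint_cst.
Qed.

End mean_distance.

(** * Means over dilated cubes and the decay estimate *)

Section cube_oscillation.
Context (R : realType) (n : nat).
Local Notation Rn := 'rV[R]_n.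
Local Notation T := (leb_space R n).
Local Notation mu := (leb R n).
Hypothesis n0 : (0 < n)%N.
Variable beta : Rn -> R.
Hypothesis hb : BMO (creal beta).
Local Notation K8 := ((8 * n%:R) ^+ n : R).
Implicit Types (c : Rn) (h : R).

Definition cavg c h : R := (\int[mu]_(x in cube c h) beta x) / fine (mu (cube c h)).

Let P0 c h : dbox R n := (0%N, \row_i (c ord0 i - h)).

(** A cube is the root of the tree whose initial side is [2 * h], so the estimates on boxes apply to
    it. *)
Lemma cube_dset c h : cube c h = dset (2 * h) (P0 c h).
Proof.
rewrite /cube /dset /box; apply/seteqP; split => x /= xP i; have := xP i;
  by rewrite !mxE /side div0n mod0n /= expr0 divr1 -addrA (_ : - h + 2 * h = h)//; ring.
Qed.

Lemma cavgE c h : cavg c h = tavg mu (dset (2 * h)) beta (P0 c h).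
Proof. by rewrite /cavg /tavg cube_dset. Qed.

Lemma cube_int c h : 0 < h -> mu.-integrable (cube c h) (EFin \o beta).
Proof.
by move=> h0; rewrite cube_dset; apply: bmo_int_dset => //; rewrite mulr_gt0.
Qed.

Lemma cube_osc c h : 0 < h ->
  \int[mu]_(x in cube c h) `|beta x - cavg c h| <= 2 * K8 * bmo beta * (2 * h) ^+ n.
Proof.
move=> h0; have := @tosc_bmo _ _ n0 _ hb (2 * h) _ (P0 c h).
by rewrite -(cube_vol c (ltW h0)) cavgE cube_dset; apply; rewrite mulr_gt0.
Qed.

Lemma cavg_double c h : 0 < h -> `|cavg c (2 * h) - cavg c h| <= 2 ^+ n * (2 * K8 * bmo beta).
Proof.
move=> h0; have h20 : 0 < 2 * h by rewrite mulr_gt0.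
have v0 : 0 < (2 * h) ^+ n by rewrite exprn_gt0.
have := @rint_mean_dist _ _ _ mu _ _ beta (cavg c (2 * h)) (cube_measurable c (2 * h))
  (cube_measurable c h) _ (cube_lty c (ltW h20)) _ (cube_int c h20).
rewrite (cube_vol c (ltW h0)) => /(_ _ v0) H.
rewrite -(ler_pM2r v0) distrC [cavg c h]/cavg (cube_vol c (ltW h0)); apply: le_trans (H _) _.
  by apply: cubeS; [exact: ltW|lra].
apply: le_trans (cube_osc c h20) _.
by rewrite (exprMn n 2 (2 * h)) le_eqVlt; apply/orP; left; apply/eqP; ring.
Qed.

Lemma cavg_iter c h (m : nat) : 0 < h ->
  `|cavg c (2 ^+ m * h) - cavg c h| <= m%:R * (2 ^+ n * (2 * K8 * bmo beta)).
Proof.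
move=> h0; elim: m => [|m IH]; first by rewrite expr0 mul1r subrr normr0 mul0r.
have -> : 2 ^+ m.+1 * h = 2 * (2 ^+ m * h) by rewrite exprS mulrA.
apply: le_trans (ler_distD (cavg c (2 ^+ m * h)) _ _) _.
rewrite -[m.+1%:R]natr1 (mulrDl m%:R 1) mul1r [leRHS]addrC; apply: lerD => //.
by apply: cavg_double; rewrite mulr_gt0// exprn_gt0.
Qed.

Lemma cube_osc_far (F : set Rn) c h (m : nat) : 0 < h -> measurable (F : set T) -> F `<=` cube c h ->
  \int[mu]_(x in F) `|beta x - cavg c (2 ^+ m * h)| <=
  (1 + m%:R) * (2 * 2 ^+ n * K8 * bmo beta) * (2 * h) ^+ n.
Proof.
move=> h0 mF Fc.
have mQ := cube_measurable c h; have Qoo := cube_lty c (ltW h0).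
have bi := cube_int c h0.
have B0 : 0 <= bmo beta by exact: bmo_ge0.
have K0 : 0 <= K8 by rewrite exprn_ge0// mulr_ge0.
apply: (@le_trans _ _ (\int[mu]_(x in cube c h) `|beta x - cavg c (2 ^+ m * h)|)).
  apply: Rintegral_le_subset => //.
  by apply: rint_norm; apply: rintB => //; exact: rint_cst.
apply: le_trans (rint_distD _ (cavg c h) mQ Qoo bi) _.
rewrite (cube_vol c (ltW h0)).
have := cube_osc c h0; have := cavg_iter c m h0; rewrite distrC.
set V := (2 * h) ^+ n; have V0 : 0 <= V by rewrite exprn_ge0// mulr_ge0// ltW.
move=> /(ler_wpM2r V0) h1 h2; apply: (le_trans (lerD h2 h1)).
rewrite -subr_ge0 (_ : _ - _ = (2 ^+ n - 1) * (2 * K8 * bmo beta * V)); last by ring.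
rewrite mulr_ge0//; first by rewrite subr_ge0; apply: exprn_ege1; rewrite ler1n.
by rewrite !mulr_ge0.
Qed.

Variable X : (Rn -> R[i]) -> \bar R.
Hypothesis hX : ball_Banach X.
Local Notation XR f := (X (creal f)).
Variable C' : R.
Hypothesis C'0 : 0 < C'.
Hypothesis hC' : forall f, lmeasurable f -> (associate_norm X f < +oo)%E ->
  {ae mu, forall x, (maximal f x < +oo)%E} /\
  (associate_norm X (fun x => (fine (maximal f x))%:C) <= C'%:E * associate_norm X f)%E.

Lemma bmo_XR_cube c h : 0 < h ->
  (XR (fun x => `|beta x - cavg c h| * \1_(cube c h) x)%R <=
    (24 * K8 ^+ 2 * C' * bmo beta)%:E * XR \1_(cube c h))%E.
Proof.
move=> h0; rewrite cavgE cube_dset; apply: bmo_XR => //; by rewrite mulr_gt0.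
Qed.

Variable C : R.
Hypothesis C0 : 0 < C.
Hypothesis hC : forall f, lmeasurable f -> (X f < +oo)%E ->
  {ae mu, forall x, (maximal f x < +oo)%E} /\
  (X (fun x => (fine (maximal f x))%:C) <= C%:E * X f)%E.

(* The decay: one growth step [h -> 2^L h] multiplies volumes by [2^(L n)] but the
   norm of the indicator by at most half of that. *)
Lemma bmo_XR_far (th : R) : 0 < th -> exists L : nat, exists K : R, [/\ (0 < L)%N, 0 < K &
  forall (F : set Rn) c h (m : nat), 0 < h -> measurable (F : set T) -> F `<=` cube c h ->
  th * (2 * h) ^+ n <= fine (mu F) ->
  forall a, a = cavg c (2 ^+ (m * L) * h) ->
  (XR (fun x => (fine (mu F) * `|beta x - a| +
         \int[mu]_(y in F) `|beta y - a|) * \1_(cube c (2 ^+ (m * L) * h)) x)%R <=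
   (K * (2 * h) ^+ n * (1 + m%:R) * (2 ^+ (L * n) / 2) ^+ m * bmo beta)%:E * XR \1_F)%E].
Proof.
move=> th0; have [L L0 dbl] := cube_XR_double n0 hX C0 hC.
(* The first summand comes from [bmo_XR_cube], the second from telescoping over [m * L] doublings
   with [1 + m * L <= L * (1 + m)]. [K2] comes from replacing the cube by [F]. *)
pose K1 : R := 24 * K8 ^+ 2 * C' + 2 * 2 ^+ n * K8 * L%:R.
pose K2 : R := (2 * n%:R) ^+ n / th * C.
have n0R : 0 < n%:R :> R by rewrite ltr0n.
have L0R : 1 <= L%:R :> R by rewrite ler1n.
have K80 : 0 < K8 by rewrite exprn_gt0// mulr_gt0.
have K10 : 0 < K1.
  apply: addr_gt0; first by apply: mulr_gt0 => //; apply: mulr_gt0 => //; exact: exprn_gt0.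
  apply: mulr_gt0; last by rewrite ltr0n.
  by apply: mulr_gt0 => //; apply: mulr_gt0 => //; exact: exprn_gt0.
have K20 : 0 < K2 by rewrite mulr_gt0// divr_gt0// exprn_gt0// mulr_gt0.
have B0 : 0 <= bmo beta by exact: bmo_ge0.
exists L, (K1 * K2); split => //; first exact: mulr_gt0.
move=> F c h m h0 mF Fc hF a aE.
set H := 2 ^+ (m * L) * h; have H0 : 0 < H by rewrite mulr_gt0// exprn_gt0.
have mQ := cube_measurable c H; have Qoo := cube_XR_lty n0 hX c H0.
set V := (2 * h) ^+ n; have V0 : 0 <= V by rewrite exprn_ge0// mulr_ge0// ltW.
set I := \int[mu]_(y in F) `|beta y - a|.
have I0 : 0 <= I by apply: Rintegral_ge0.
have FV : fine (mu F) <= V.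
  rewrite /V -(cube_vol c (ltW h0)); apply: fine_le.
  - by rewrite ge0_fin_numE//; apply: le_lt_trans (cube_lty c (ltW h0)); apply: le_measure; rewrite ?inE//; exact: cube_measurable.
  - by rewrite ge0_fin_numE//; apply: cube_lty; exact: ltW.
  - by apply: le_measure; rewrite ?inE//; exact: cube_measurable.
have mdist : measurable_fun setT (fun x : T => `|beta x - a| * \1_(cube c H) x).
  apply: measurable_funM; last exact: measurable_indic.
  by apply: measurable_fun_dist; exact: bmo_measurable.
have hA := bmo_XR_cube c H0; rewrite -/H -aE in hA.
have Aoo : (XR (fun x => `|beta x - a| * \1_(cube c H) x)%R < +oo)%E.
  by apply: (le_lt_trans hA); rewrite lte_mul_pinfty// lee_fin !mulr_ge0 ?sqr_ge0// ltW.
have mcst (k : R) : measurable_fun setT (cst k : T -> R) by exact: measurable_cst.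
apply: (@le_trans _ _ (XR (fun x => (fine (mu F) * (`|beta x - a| * \1_(cube c H) x))%R) +
   XR (fun x => (I * \1_(cube c H) x)%R))%E).
  rewrite (_ : (fun x => _) = (fun x => fine (mu F) * (`|beta x - a| * \1_(cube c H) x) +
    I * \1_(cube c H) x)); last by apply/funext => x; rewrite mulrDl mulrA.
  apply: (XR_triangle hX).
    by apply: (@measurable_funM _ _ _ _ (cst _ : T -> R)).
  by apply: (@measurable_funM _ _ _ _ (cst _ : T -> R)) => //; exact: measurable_indic.
rewrite (XR_scale hX _ Aoo) (XR_scale hX _ Qoo) (ger0_norm I0) ger0_norm ?fine_ge0//.
have XQ0 : (0 <= XR \1_(cube c H))%E by exact: (bB_ge0 hX).
have hI : I <= (1 + (m * L)%:R) * (2 * 2 ^+ n * K8 * bmo beta) * V.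
  by rewrite /I aE; exact: cube_osc_far.
apply: (@le_trans _ _ ((K1 * V * (1 + m%:R) * bmo beta)%:E * XR \1_(cube c H))%E).
  apply: (@le_trans _ _ (V%:E * ((24 * K8 ^+ 2 * C' * bmo beta)%:E * XR \1_(cube c H)) +
     ((1 + (m * L)%:R) * (2 * 2 ^+ n * K8 * bmo beta) * V)%:E * XR \1_(cube c H))%E).
    apply: leeD; last by apply: lee_wpmul2r => //; rewrite lee_fin.
    by apply: lee_pmul => //; exact: (bB_ge0 hX).
  rewrite muleA -EFinM -ge0_muleDl; [|by rewrite lee_fin !mulr_ge0 ?sqr_ge0// ltW..].
  apply: lee_wpmul2r => //; rewrite -EFinD lee_fin natrM.
  have e1 : 0 <= 24 * K8 ^+ 2 * C' * m%:R by rewrite !mulr_ge0 ?sqr_ge0// ltW.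
  have e2 : 0 <= 2 * 2 ^+ n * K8 * (L%:R - 1).
    by rewrite mulr_ge0 ?subr_ge0// !mulr_ge0// ltW.
  have e3 : 0 <= V * bmo beta by rewrite mulr_ge0.
  rewrite -subr_ge0.
  rewrite (_ : _ - _ = V * bmo beta * (24 * K8 ^+ 2 * C' * m%:R + 2 * 2 ^+ n * K8 * (L%:R - 1))).
    by rewrite mulr_ge0// addr_ge0.
  by rewrite /K1; ring.
have := le_trans (cube_XR_iter c m h0 dbl)
  (lee_wpmul2l _ (cube_XR_portion n0 hX C0 hC mF Fc h0 th0 hF)).
rewrite muleA -EFinM => hB.
have q0 : 0 <= (2 ^+ (L * n) / 2) ^+ m :> R by rewrite exprn_ge0// divr_ge0// exprn_ge0.
apply: le_trans (lee_wpmul2l _ (hB _)) _.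
- have e1 : 0 <= 1 + m%:R :> R by rewrite addr_ge0.
  by rewrite lee_fin; apply: mulr_ge0 => //; apply: mulr_ge0 => //; apply: mulr_ge0 => //; exact: ltW.
- by rewrite lee_fin.
rewrite muleA -EFinM le_eqVlt; apply/orP; left; apply/eqP; congr (_%:E * _)%E.
by rewrite /K2; ring.
Qed.

End cube_oscillation.

(** * The commutator on an annulus *)

Section parametric_integral.
Context (R : realType).

(** Completeness makes [f] measurable as soon as it agrees almost everywhere with [g], so the rough
    integrand needs no measurability proof of its own. *)
Lemma Rintegral_ae_complete d (T : measurableType d) (mu : {measure set T -> \bar R})
    (f g : T -> R) : measure_is_complete mu -> measurable_fun setT g ->
  {ae mu, forall x, f x = g x} -> \int[mu]_x f x = \int[mu]_x g x.
Proof.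
move=> cmu mg fg; congr fine.
have mgE : measurable_fun setT (EFin \o g) by exact/measurable_EFinP.
have gfE : ae_eq mu setT (EFin \o g) (EFin \o f).
  by apply: ae_imply fg => x /= ->.
by apply: ae_eq_integral => //; [exact: ae_measurable_fun gfE mgE|apply: ae_imply fg => x /= ->].
Qed.

Lemma measurable_Rintegral_param d1 d2 (T1 : measurableType d1) (T2 : measurableType d2)
    (m2 : {sigma_finite_measure set T2 -> \bar R}) (phi : T1 * T2 -> R) :
  measurable_fun setT phi -> measurable_fun setT (fun x => \int[m2]_y phi (x, y)).
Proof.
move=> mphi; apply: measurableT_comp => //.
have mE : measurable_fun setT (EFin \o phi) by exact/measurable_EFinP.
under eq_fun do rewrite integralE.
apply: emeasurable_funB.
  have := @measurable_fun_fubini_tonelli_F _ _ _ _ _ m2 _ (measurable_funepos mE) (fun=> funepos_ge0 _ _).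
  by apply: eq_measurable_fun => x _; rewrite /fubini_F; apply: eq_integral => y _; rewrite !(funeposE, funenegE).
have := @measurable_fun_fubini_tonelli_F _ _ _ _ _ m2 _ (measurable_funeneg mE) (fun=> funeneg_ge0 _ _).
by apply: eq_measurable_fun => x _; rewrite /fubini_F; apply: eq_integral => y _; rewrite !(funeposE, funenegE).
Qed.

(** The two integrals combine into one of [k y * (b0 - beta y)], and the triangle inequality passes
    through [a]. *)
Lemma commutator_bound d (T : measurableType d) (mu : {measure set T -> \bar R})
    (F : set T) (k beta : T -> R) (B a b0 : R) : measurable F -> (mu F < +oo)%E ->
  measurable_fun F k -> (forall y, F y -> `|k y| <= B) -> mu.-integrable F (EFin \o beta) ->
  `|b0 * (\int[mu]_(y in F) k y) - \int[mu]_(y in F) (k y * beta y)| <=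
    B * (fine (mu F) * `|b0 - a| + \int[mu]_(y in F) `|beta y - a|).
Proof.
move=> mF Foo mk kB bi.
have ki : mu.-integrable F (EFin \o k) by apply: (rint_bounded mF Foo mk kB).
have kbi : mu.-integrable F (EFin \o (fun y => k y * beta y)).
  apply: (@eq_integrable _ _ _ _ _ mF (EFin \o (fun y => beta y * k y))).
    by move=> y _; rewrite /= mulrC.
  exact: (rintMb mF bi mk kB).
have bai := rintB mF bi (rint_cst a mF Foo).
have c0i := rint_cst `|b0 - a| mF Foo.
rewrite -RintegralZl// -RintegralB//; last exact: rintZ.
apply: le_trans (le_normr_Rintegral _ _) _ => //; first by apply: rintB => //; exact: rintZ.
rewrite [_ * `|b0 - a|]mulrC -Rintegral_cst//.
rewrite -RintegralD//; last exact: rint_norm.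
rewrite -RintegralZl//; last by apply: rintD => //; exact: rint_norm.
apply: le_Rintegral => //.
- by apply: rint_norm; apply: rintB => //; exact: rintZ.
- by apply: rintZ => //; apply: rintD => //; exact: rint_norm.
move=> y Fy /=; rewrite mulrC -mulrBr normrM; apply: ler_pM => //; first exact: kB.
by rewrite (distrC (beta y)); exact: ler_distD.
Qed.

End parametric_integral.

(** * A Borel version of the rough kernel *)

Section rough_kernel.
Context (R : realType) (n : nat).
Local Notation Rn := 'rV[R]_n.
Local Notation T := (leb_space R n).
Local Notation mu := (leb R n).
Local Notation lebB := (borel_lebesgue R n).
Hypothesis n0 : (0 < n)%N.

Lemma leb_complete : measure_is_complete mu.
Proof. exact: measure_is_complete_caratheodory. Qed.

Lemma measurable_diff : measurable_fun setT (fun p : Rn * Rn => p.1 - p.2).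
Proof.
apply: measurable_fun_rV => i.
rewrite (_ : (fun p => _) = (fun p : Rn * Rn => p.1 ord0 i - p.2 ord0 i)); last first.
  by apply/funext => p; rewrite !mxE.
apply: measurable_funB; apply: (measurableT_comp (measurable_coord i)).
  exact: measurable_fst.
exact: measurable_snd.
Qed.

(** [f] is measurable only for the completion. Setting it to 0 on a Borel null set leaves each
    integral unchanged and makes the integrand jointly Borel, so Tonelli for the Borel measure
    applies. *)
Lemma conv_measurable (k f : Rn -> R) : measurable_fun setT k ->
  measurable_fun setT (f : T -> R) ->
  measurable_fun setT ((fun x => \int[mu]_y (k (x - y) * f y)) : T -> R).
Proof.
move=> mk mf.
have [N [mN N0 mfN]] := completed_measurable_funP (sigma_finiteT lebB) mf.
have mphi : measurable_fun setT
    (fun p : Rn * Rn => k (p.1 - p.2) * (f p.2 * \1_(~` N) p.2)).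
  apply: measurable_funM; first exact: (measurableT_comp mk measurable_diff).
  exact: (measurableT_comp mfN measurable_snd).
have := measurable_Rintegral_param lebB mphi.
move/(completed_measurable_fun (mu := lebB)); apply: eq_measurable_fun.
suff intE (x : Rn) : \int[lebB]_y (k (x - y) * (f y * \1_(~` N) y)) =
  \int[mu]_y (k (x - y) * f y) by move=> x _; exact: intE.
have mphix : measurable_fun setT (fun y : Rn => k (x - y) * (f y * \1_(~` N) y)).
  exact: (measurableT_comp mphi (pair1_measurable x)).
transitivity (\int[mu]_y (k (x - y) * (f y * \1_(~` N) y))).
  apply/esym; by rewrite /Rintegral completed_integral//; exact/measurable_EFinP.
apply/esym/Rintegral_ae_complete; [exact: leb_complete|exact: completed_measurable_fun|].
apply/completed_negligibleP; exists N; split => // y /= h; apply: contrapT => Ny; apply: h.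
by rewrite indicE mem_set// mulr1.
Qed.

Lemma enorm0 : enorm (0 : Rn) = 0.
Proof. by rewrite /enorm big1 ?sqrtr0// => i _; rewrite mxE expr0n. Qed.

Lemma enorm_unitv (z : Rn) : z != 0 -> enorm z *: unitv z = z.
Proof.
move=> z0; rewrite /unitv scalerA mulfV ?scale1r//.
by apply: contra_neq z0; exact: enorm0P.
Qed.

Lemma sphere_unitv (z : Rn) : z != 0 -> sphere (unitv z).
Proof.
move=> z0; have e0 : enorm z != 0 by apply: contra_neq z0; exact: enorm0P.
by rewrite /sphere/= enormZ ger0_norm ?invr_ge0 ?enorm_ge0// mulVf.
Qed.

Lemma unitvZ (t : R) (z : Rn) : 0 < t -> unitv (t *: z) = unitv z.
Proof.
move=> t0; rewrite /unitv enormZ gtr0_norm// scalerA invfM mulrAC mulVf ?mul1r//.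
by rewrite gt_eqF.
Qed.

Lemma measurable_sphere : measurable (@sphere R n).
Proof.
rewrite (_ : @sphere R n = @enorm R n @^-1` [set 1]).
  by rewrite -[X in measurable X]setTI; exact: measurable_enorm.
by apply/seteqP; split.
Qed.

Lemma borel_area_sigma_finite : sigma_finite setT (borel_area R n).
Proof.
exists (fun=> setT); first by rewrite bigcup_const.
move=> _; split => //; rewrite /borel_area/= /mscale/= lte_mul_pinfty ?lee_fin//.
rewrite /cone_measure /pushforward /mrestr preimage_setT setTI.
apply: (@le_lt_trans _ _ (lebB (eball (0 : Rn) 1))).
  apply: le_measure; rewrite ?inE; [exact: measurable_punctured_ball|exact: measurable_eball|].
  by move=> z /andP[_]; rewrite /eball/= subr0.
by rewrite -lebE; [exact: eball_lty|exact: measurable_eball].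
Qed.

(** By construction of the surface measure, the part of the cone over [N] in the punctured unit ball
    is null; its dilations by [2^k] cover the cone. *)
Lemma cone_null (N : set Rn) : measurable N -> borel_area R n N = 0%E ->
  lebB.-negligible [set z | z != 0 /\ N (unitv z)].
Proof.
move=> mN; rewrite /borel_area/= /mscale/= => /eqP; rewrite mule_eq0.
rewrite eqe pnatr_eq0 gtn_eqF//= => /eqP; rewrite /cone_measure /pushforward /mrestr.
set A := _ `&` _ => A0.
have mA : measurable A.
  apply: measurableI; last exact: measurable_punctured_ball.
  by rewrite -[X in measurable X]setTI; exact: measurable_unitv.
apply: (@negligibleS _ _ _ _ (\bigcup_k (affine (2 ^+ k)^-1 (0 : Rn) @^-1` A))).
  move=> z [z0 Nz]; have e0 : 0 < enorm z.
    by rewrite lt0r enorm_ge0 andbT; apply: contra_neq z0; exact: enorm0P.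
  have p2 k : 0 < (2 ^+ k)^-1 :> R by rewrite invr_gt0 exprn_gt0.
  exists (Num.bound (enorm z)) => //; rewrite /affine/= add0r; split.
    by rewrite /= unitvZ.
  rewrite /punctured_ball/= enormZ gtr0_norm// mulr_gt0//= mulrC ltr_pdivrMr ?exprn_gt0// mul1r.
  apply: lt_trans (archi_boundP (ltW e0)) _.
  by rewrite -natrX ltr_nat ltn_expl.
apply: negligible_bigcup => k.
apply/negligibleP; first exact: measurable_affine_preimage.
have t0 : (2 ^+ k)^-1 != 0 :> R by rewrite invr_eq0 expf_neq0.
by apply: etrans (borel_lebesgue_affine 0 t0 mA) _; rewrite A0 mule0.
Qed.

Variable Omega : Rn -> R[i].
Hypothesis OI : Linfty_sphere Omega.
Hypothesis OH : homogeneous0 Omega.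

Lemma sphere_component (w : Rn -> R) :
  measurable_fun (@sphere R n : set (area_space R n)) (w : area_space R n -> R) ->
  exists N, [/\ measurable N, borel_area R n N = 0%E &
    measurable_fun setT (fun z => w z * \1_(@sphere R n) z * \1_(~` N) z)].
Proof.
move=> mw; apply: (completed_measurable_funP borel_area_sigma_finite).
have mS : measurable (@sphere R n : set (area_space R n)).
  by apply: completed_measurable; exact: measurable_sphere.
have := (measurable_restrictT (T1 := area_space R n) w mS).1 mw; apply: eq_measurable_fun => z _.
by rewrite patchE indicE; case: ifP => _; rewrite ?mulr1 ?mulr0.
Qed.

Lemma normc_geRe (w : R[i]) : `|complex.Re w| <= normc w.
Proof. by case: w => a b; rewrite -sqrtr_sqr ler_sqrt ?addr_ge0 ?sqr_ge0// lerDl sqr_ge0. Qed.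

Lemma normc_geIm (w : R[i]) : `|complex.Im w| <= normc w.
Proof. by case: w => a b; rewrite -sqrtr_sqr ler_sqrt ?addr_ge0 ?sqr_ge0// lerDr sqr_ge0. Qed.

Lemma Re_divC (w : R[i]) (r : R) : complex.Re (w / r%:C) = complex.Re w / r /\
  complex.Im (w / r%:C) = complex.Im w / r.
Proof.
rewrite -fmorphV; case: w => a b /=; split; first by rewrite mulr0 subr0.
by rewrite mulr0 add0r.
Qed.

(* The null set off which [Omega] is bounded and coincides with a Borel function
   lifts to a null cone of [R^n]. *)
Lemma borel_kernel : exists2 M : R, 0 < M & forall D : R, 0 < D ->
  exists Z (k1 k2 : Rn -> R), [/\ lebB.-negligible Z,
    measurable_fun setT k1 /\ measurable_fun setT k2,
    forall z, ~ Z z -> D <= enorm z ->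
      complex.Re (Defs.kernel Omega z) = k1 z /\ complex.Im (Defs.kernel Omega z) = k2 z,
    forall z, `|k1 z| <= M / D ^+ n &
    forall z, `|k2 z| <= M / D ^+ n].
Proof.
case: OI => -[/sphere_component[N1 [mN1 N10 mf1]] /sphere_component[N2 [mN2 N20 mf2]]].
move=> [M0 /completed_negligibleP[N3 [mN3 N30 bN3]]].
pose N := N1 `|` N2 `|` N3.
have mN : measurable N by apply: measurableU => //; exact: measurableU.
have N0 : borel_area R n N = 0%E.
  apply/negligibleP => //; apply: negligibleU; last by apply/negligibleP.
  by apply: negligibleU; apply/negligibleP.
pose M := `|M0| + 1.
have M_gt0 : 0 < M by rewrite ltr_wpDl.
exists M => // D D0.
exists [set z | z != 0 /\ N (unitv z)].
pose S := (@sphere R n) `\` N.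
(* The kernel is cut to 0 over the bad directions and where [|z| < D]; the second cut is what gives
   a global bound [M / D^n]. *)
pose kk (w : Rn -> R) z := w (unitv z) * \1_S (unitv z) * (\1_[set z | D <= enorm z] z * (enorm z)^-1 ^+ n).
have mS : measurable S by apply: measurableD => //; exact: measurable_sphere.
have mkk (w : Rn -> R) (N' : set Rn) : N' `<=` N ->
    measurable_fun setT (fun z => w z * \1_(@sphere R n) z * \1_(~` N') z) ->
    measurable_fun setT (kk w).
  move=> N'N mw.
  have mD : measurable [set z : Rn | D <= enorm z].
    rewrite (_ : [set _ | _] = @enorm R n @^-1` `[D, +oo[).
      by rewrite -[X in measurable X]setTI; exact: measurable_enorm.
    by apply/seteqP; split => z /=; rewrite in_itv/= andbT.
  rewrite (_ : kk w = fun z =>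
      (fun z => w z * \1_(@sphere R n) z * \1_(~` N') z) (unitv z) *
      \1_(~` N) (unitv z) * (\1_[set z | D <= enorm z] z * (enorm z `^ (-1)) ^+ n)); last first.
    apply/funext => z; rewrite /kk powR_inv1 ?enorm_ge0//; congr (_ * _).
    rewrite -!mulrA; congr (_ * _); rewrite !indicE /S in_setD !in_setC.
    have [Nu|Nu] := boolP (unitv z \in N); first by rewrite andbF !mulr0.
    rewrite (_ : unitv z \in N' = false) ?mulr1 ?andbT//.
    by apply: contraNF Nu => /set_mem/N'N/mem_set.
  apply: measurable_funM; first apply: measurable_funM.
  - exact: (measurableT_comp mw (@measurable_unitv R n)).
  - have mi : measurable_fun setT (\1_(~` N) : Rn -> R).
      by apply: measurable_indic; exact: measurableC.
    exact: (measurableT_comp mi (@measurable_unitv R n)).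
  apply: measurable_funM; first exact: measurable_indic.
  apply: measurable_funX.
  exact: (measurableT_comp (measurable_powR (-1)) (@measurable_enorm R n)).
exists (kk (fun z => complex.Re (Omega z))), (kk (fun z => complex.Im (Omega z))).
have bkk (w : Rn -> R) : (forall z, `|w z| <= normc (Omega z)) ->
  forall z, `|kk w z| <= M / D ^+ n.
  move=> wO z; rewrite /kk !indicE.
  have [/set_mem[Su Nu]|_] := boolP (unitv z \in S); last first.
    by rewrite mulr0 mul0r normr0 divr_ge0 ?exprn_ge0// ltW.
  have [/set_mem/= Dz|_] := boolP (z \in _); last first.
    by rewrite mul0r mulr0 normr0 divr_ge0 ?exprn_ge0// ltW.
  rewrite mulr1 mul1r normrM -exprVn; apply: ler_pM => //.
    have : normc (Omega (unitv z)) <= M0.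
      by apply: contrapT => h; apply: Nu; right; apply: bN3 => /= /(_ Su).
    move/(le_trans (wO _)) => h; apply: (le_trans h).
    by rewrite (le_trans (ler_norm _))// lerDl.
  have z0 := lt_le_trans D0 Dz.
  rewrite ger0_norm ?exprn_ge0 ?invr_ge0 ?enorm_ge0//.
  by rewrite lerXn2r ?nnegrE ?invr_ge0 ?enorm_ge0 ?(ltW D0)// lef_pV2.
split; [exact: cone_null| | | |].
- by split; [apply: (mkk _ N1) mf1|apply: (mkk _ N2) mf2]; move=> z ?; [left; left|left; right].
- move=> z nZ Dz; have z0 : z != 0.
    by apply: contraTneq Dz => ->; rewrite enorm0 -ltNge.
  have Su := sphere_unitv z0.
  have Nu : ~ N (unitv z) by move=> ?; apply: nZ.
  have e0 : 0 < enorm z by exact: lt_le_trans Dz.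
  have -> : Defs.kernel Omega z = Omega (unitv z) / (enorm z ^+ n)%:C.
    by rewrite /Defs.kernel -{1}(enorm_unitv z0) OH.
  rewrite (Re_divC _ _).1 (Re_divC _ _).2 /kk !indicE.
  have -> : unitv z \in S by apply: mem_set.
  have -> : z \in [set z1 : Rn | D <= enorm z1] by apply: mem_set.
  by rewrite !mulr1 !mul1r exprVn.
- by apply: bkk => z; exact: normc_geRe.
- by apply: bkk => z; exact: normc_geIm.
Qed.

End rough_kernel.

(** * The commutator away from the support of its argument *)

Section commutator_annulus.
Context (R : realType) (n : nat).
Local Notation Rn := 'rV[R]_n.
Local Notation T := (leb_space R n).
Local Notation mu := (leb R n).
Local Notation lebB := (borel_lebesgue R n).

Lemma normc_le (w : R[i]) : normc w <= `|complex.Re w| + `|complex.Im w|.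
Proof.
case: w => a b; rewrite -[leRHS]ger0_norm ?addr_ge0// -sqrtr_sqr ler_sqrt ?sqr_ge0//=.
by rewrite sqrrD !real_normK ?num_real// lerD2r lerDl mulrn_wge0// mulr_ge0.
Qed.

Lemma negligible_reflect (Z : set Rn) x : lebB.-negligible Z -> lebB.-negligible [set y | Z (x - y)].
Proof.
move=> [A [mA A0 ZA]].
have N1 : -1 != 0 :> R by rewrite oppr_eq0 oner_eq0.
exists (affine (-1) x @^-1` A); split.
- exact: measurable_affine_preimage.
- by apply: etrans (borel_lebesgue_affine x N1 mA) _; rewrite A0 mule0.
- by move=> y /= /ZA; rewrite /affine scaleN1r.
Qed.

Variable Omega : Rn -> R[i].

(** A truncation at [eps < D] removes no point of [F], so the truncated integrals are constant near
    0 and the limit is their common value. *)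
Lemma singular_integral_far (f : Rn -> R) (F : set Rn) (D : R) x : 0 < D ->
  (forall y, ~ F y -> f y = 0) -> (forall y, F y -> D <= enorm (x - y)) ->
  singular_integral Omega (creal f) x =
  (\int[mu]_y (complex.Re (Defs.kernel Omega (x - y)) * f y)) +i*
  (\int[mu]_y (complex.Im (Defs.kernel Omega (x - y)) * f y)).
Proof.
move=> D0 fF FD; rewrite /singular_integral.
have part (p : R[i] -> R) : (forall w (r : R), p (w * r%:C) = p w * r) -> forall eps, eps < D ->
    \int[mu]_(y in [set y | eps < enorm (x - y)]) p (Defs.kernel Omega (x - y) * creal f y) =
    \int[mu]_y (p (Defs.kernel Omega (x - y)) * f y).
  move=> pM eps epsD; rewrite /Rintegral; congr fine; rewrite integral_mkcond.
  apply: eq_integral => y _; rewrite patchE /creal pM.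
  case: ifPn => // /negP h; rewrite fF ?mulr0// => /FD Dy; apply: h; apply/mem_set.
  exact: lt_le_trans Dy.
have ReM (w : R[i]) (r : R) : complex.Re (w * r%:C) = complex.Re w * r.
  by case: w => a b /=; rewrite mulr0 subr0.
have ImM (w : R[i]) (r : R) : complex.Im (w * r%:C) = complex.Im w * r.
  by case: w => a b /=; rewrite mulr0 add0r.
have nD : \forall eps \near 0^'+, eps < D by exact: nbhs_right_lt.
congr (_ +i* _); apply: lim_near_cst => //.
  by near=> eps; apply: (part _ ReM); near: eps.
by near=> eps; apply: (part _ ImM); near: eps.
Unshelve. all: by end_near. Qed.

Variable beta : Rn -> R.
Hypothesis hb : BMO (creal beta).
Variables (F A : set Rn) (D : R).
Hypothesis D0 : 0 < D.
Hypothesis mF : measurable (F : set T).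
Hypothesis mA : measurable (A : set T).
Hypothesis Foo : (mu F < +oo)%E.
Hypothesis bF : mu.-integrable F (EFin \o beta).
Hypothesis AF : forall x y, A x -> F y -> D <= enorm (x - y).

Section component.
Variables (p : Rn -> R) (k : Rn -> R) (Z : set Rn) (B : R).
Hypothesis nZ : lebB.-negligible Z.
Hypothesis mk : measurable_fun setT k.
Hypothesis pk : forall z, ~ Z z -> D <= enorm z -> p z = k z.
Hypothesis kB : forall z, `|k z| <= B.

Let mbeta : measurable_fun setT (beta : T -> R). Proof. exact: bmo_measurable. Qed.
Let fb y := beta y * \1_F y.
Let mfb : measurable_fun setT (fb : T -> R).
Proof. by apply: measurable_funM => //; exact: measurable_indic. Qed.
Let m1 : measurable_fun setT (\1_F : T -> R).
Proof. exact: measurable_indic. Qed.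

Lemma measurable_reflect x : measurable_fun setT ((fun y => k (x - y)) : T -> R).
Proof.
apply: (completed_measurable_fun (mu := lebB)).
have h : measurable_fun setT (fun p : Rn * Rn => k (p.1 - p.2)).
  exact: (measurableT_comp mk (@measurable_diff R n)).
exact: (measurableT_comp h (pair1_measurable x)).
Qed.

(** Here [p] is the real or the imaginary part of the kernel and [k] its Borel version. They can
    differ only on the reflected null set, as points of [F] lie at distance at least [D] and the
    integrand vanishes elsewhere. *)
Lemma component_ae x (f : Rn -> R) : A x -> measurable_fun setT (f : T -> R) ->
  (forall y, ~ F y -> f y = 0) ->
  \int[mu]_y (p (x - y) * f y) = \int[mu]_y (k (x - y) * f y).
Proof.
move=> Ax mf fF; apply: Rintegral_ae_complete; first exact: leb_complete.
  by apply: measurable_funM; [exact: measurable_reflect|exact: mf].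
apply/completed_negligibleP; apply: negligibleS (negligible_reflect x nZ) => y /= h.
apply: contrapT => nZy; apply: h; have [Fy|nFy] := pselect (F y).
  by rewrite pk//; exact: AF.
by rewrite fF// !mulr0.
Qed.

Let J x := beta x * (\int[mu]_y (p (x - y) * \1_F y)) - \int[mu]_y (p (x - y) * fb y).

Lemma component_measurable : measurable_fun setT ((fun x => J x * \1_A x) : T -> R).
Proof.
have h : measurable_fun setT ((fun x => (beta x * (\int[mu]_y (k (x - y) * \1_F y)) -
    \int[mu]_y (k (x - y) * fb y)) * \1_A x) : T -> R).
  apply: measurable_funM; last exact: measurable_indic.
  apply: measurable_funB; last exact: (conv_measurable mk mfb).
  by apply: measurable_funM; [exact: mbeta|exact: (conv_measurable mk m1)].
move: h; apply: eq_measurable_fun => x _; rewrite indicE.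
have [/set_mem Ax|_] := boolP (x \in A); last by rewrite !mulr0.
rewrite /J !component_ae// => y Fy.
  by rewrite /fb indicE memNset ?mulr0.
by rewrite indicE memNset.
Qed.

Lemma component_bound x (a : R) : A x ->
  `|J x| <= B * (fine (mu F) * `|beta x - a| + \int[mu]_(y in F) `|beta y - a|).
Proof.
move=> Ax; rewrite /J !component_ae//; last 2 first.
- by move=> y Fy; rewrite /fb indicE memNset ?mulr0.
- by move=> y Fy; rewrite indicE memNset.
have -> : \int[mu]_y (k (x - y) * \1_F y) = \int[mu]_(y in F) k (x - y).
  rewrite /Rintegral; congr fine; rewrite [RHS]integral_mkcond; apply: eq_integral => y _.
  by rewrite patchE indicE; case: ifP; rewrite ?mulr1 ?mulr0.
have -> : \int[mu]_y (k (x - y) * fb y) = \int[mu]_(y in F) (k (x - y) * beta y).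
  rewrite /Rintegral; congr fine; rewrite [RHS]integral_mkcond; apply: eq_integral => y _.
  by rewrite patchE /fb indicE; case: ifP; rewrite ?mulr1 ?mulr0.
apply: commutator_bound; [exact: mF|exact: Foo| |by move=> y _; exact: kB|exact: bF].
by apply: measurable_funTS; exact: measurable_reflect.
Qed.

End component.

Variable M : R.
Hypothesis hM : exists Z (k1 k2 : Rn -> R), [/\ lebB.-negligible Z,
    measurable_fun setT k1 /\ measurable_fun setT k2,
    forall z, ~ Z z -> D <= enorm z ->
      complex.Re (Defs.kernel Omega z) = k1 z /\ complex.Im (Defs.kernel Omega z) = k2 z,
    forall z, `|k1 z| <= M / D ^+ n &
    forall z, `|k2 z| <= M / D ^+ n].

Lemma commutatorE x : A x -> commutator (creal beta) Omega (cindic F) x =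
  (beta x * (\int[mu]_y (complex.Re (Defs.kernel Omega (x - y)) * \1_F y)) -
    \int[mu]_y (complex.Re (Defs.kernel Omega (x - y)) * (beta y * \1_F y))) +i*
  (beta x * (\int[mu]_y (complex.Im (Defs.kernel Omega (x - y)) * \1_F y)) -
    \int[mu]_y (complex.Im (Defs.kernel Omega (x - y)) * (beta y * \1_F y))).
Proof.
move=> Ax; rewrite /commutator.
have -> : (fun y => creal beta y * cindic F y) = creal (fun y => beta y * \1_F y).
  by apply/funext => y; rewrite /creal rmorphM.
rewrite (@singular_integral_far \1_F F D)//; last 2 first.
- by move=> y Fy; rewrite indicE memNset.
- by move=> y; exact: AF.
rewrite (@singular_integral_far (fun y => beta y * \1_F y) F D)//; last 2 first.
- by move=> y Fy; rewrite indicE memNset ?mulr0.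
- by move=> y; exact: AF.
by apply/eqP; rewrite eq_complex/= !mul0r subr0 addr0 !eqxx.
Qed.

(** Real and imaginary parts are estimated separately, hence the factor 2. *)
Lemma commutator_annulus : lmeasurable (fun x => commutator (creal beta) Omega (cindic F) x * cindic A x) /\
  forall a x, A x -> normc (commutator (creal beta) Omega (cindic F) x) <=
    2 * M / D ^+ n * (fine (mu F) * `|beta x - a| + \int[mu]_(y in F) `|beta y - a|).
Proof.
have [Z [k1 [k2 [nZ [mk1 mk2] kE k1B k2B]]]] := hM.
have k1E z : ~ Z z -> D <= enorm z -> complex.Re (Defs.kernel Omega z) = k1 z.
  by move=> ? ?; exact: (kE z _ _).1.
have k2E z : ~ Z z -> D <= enorm z -> complex.Im (Defs.kernel Omega z) = k2 z.
  by move=> ? ?; exact: (kE z _ _).2.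
split.
  have m1 := component_measurable nZ mk1 k1E; have m2 := component_measurable nZ mk2 k2E.
  split; [move: m1|move: m2]; apply: eq_measurable_fun => x _; rewrite /cindic indicE.
    have [/set_mem Ax|_] := boolP (x \in A); last by rewrite !mulr0.
    by rewrite !mulr1 commutatorE.
  have [/set_mem Ax|_] := boolP (x \in A); last by rewrite !mulr0.
  by rewrite !mulr1 commutatorE.
move=> a x Ax; apply: le_trans (normc_le _) _; rewrite (commutatorE Ax).
have b1 := component_bound nZ mk1 k1E k1B a Ax.
have b2 := component_bound nZ mk2 k2E k2B a Ax.
apply: (le_trans (lerD b1 b2)).
by rewrite le_eqVlt; apply/orP; left; apply/eqP; ring.
Qed.

End commutator_annulus.

(** * Geometry of the annulus and the number of growth steps *)

Section annulus_geometry.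
Context (R : realType) (n : nat).
Local Notation Rn := 'rV[R]_n.
Local Notation T := (leb_space R n).
Local Notation mu := (leb R n).
Hypothesis n0 : (0 < n)%N.

Lemma real_creal (b : Rn -> R[i]) : (forall x, b x \is Num.real) ->
  b = creal (fun x => complex.Re (b x)).
Proof.
move=> hb; apply/funext => x; have := hb x; rewrite /creal realE.
case: (b x) => u v; rewrite !lecE/= => /orP[]/andP[/eqP v0 _]; congr (_ +i* _).
  by [].
by [].
Qed.

(** A coordinatewise triangle inequality gives [|x - x0| <= n * (|x - y| + (1 + 2 * k) * r0)]. The
    threshold on [P] makes the second term at most half of [P * r0]. *)
Lemma far_distance (x0 x1 x y : Rn) (r0 k P : R) : 0 < r0 -> 0 <= k ->
  enorm (x1 - x0) = 2 * k * r0 -> eball x1 r0 y ->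
  P * r0 <= enorm (x - x0) -> 2 * n%:R * (1 + 2 * k) <= P ->
  P * r0 / (2 * n%:R) <= enorm (x - y).
Proof.
move=> r00 k0 x10 yx1 Px nkP; have n0R : 0 < n%:R :> R by rewrite ltr0n.
have kr : 0 <= k * r0 by rewrite mulr_ge0// ltW.
have e0 := enorm_ge0 (x - y).
have h : enorm (x - x0) <= n%:R * (enorm (x - y) + (1 + 2 * k) * r0).
  apply: enorm_le; first by lra.
  move=> i; have h1 := coord_le_enorm (x - y) i; have h2 := coord_le_enorm (x1 - x0) i.
  have h3 := le_lt_trans (coord_le_enorm _ i) yx1.
  move: h1 h2 h3; rewrite x10 !mxE !ler_norml !ltr_norml.
  by move=> /andP[? ?] /andP[? ?] /andP[? ?]; apply/andP; split; lra.
rewrite ler_pdivrMr ?mulr_gt0//.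
have := le_trans Px h; have := ler_wpM2r (ltW r00) nkP; lra.
Qed.

Lemma eball_shift_sub_cube (x0 x1 : Rn) (r0 k : R) : enorm (x1 - x0) = 2 * k * r0 ->
  eball x1 r0 `<=` cube x0 ((2 * k + 1) * r0).
Proof.
move=> x10 y yx1; apply/cubeP => i; have h2 := coord_le_enorm (x1 - x0) i.
have h3 := le_lt_trans (coord_le_enorm _ i) yx1.
move: h2 h3; rewrite x10 !mxE !ler_norml !ltr_norml.
by move=> /andP[? ?] /andP[? ?]; apply/andP; split; lra.
Qed.

(** [m] is one more than the integer part of [(d + 1) / L]. So [m * L] lies between [d + 1] and
    [d + 1 + L]: the cube reaches past the annulus and overshoots by a bounded factor, while
    [m >= d / L] yields the decay. Also [1 + m <= d + 3 <= 4 * d]. *)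
Lemma step_count (d : R) (L : nat) : (0 < L)%N -> 1 <= d ->
  exists m : nat, [/\ 2 `^ (d + 1) <= 2 ^+ (m * L), 1 + m%:R <= 4 * d &
    (2 ^+ (L * n) / 2) ^+ m <= (2 `^ d) ^+ n * 2 ^+ ((1 + L) * n) * 2 `^ (- (d / L%:R)) :> R].
Proof.
move=> L0 d1; have L0R : 0 < L%:R :> R by rewrite ltr0n.
have L1R : 1 <= L%:R :> R by rewrite ler1n.
have x0 : 0 <= (d + 1) / L%:R by rewrite divr_ge0 ?addr_ge0// ltW// (lt_le_trans ltr01).
have /andP[t1 t2] := truncn_itv x0; set t := Num.truncn _ in t1 t2.
move: t1; rewrite ler_pdivlMr// => t1; move: (t2); rewrite ltr_pdivrMr// => t3.
have pow2 (j : nat) : 2 ^+ j = 2 `^ j%:R :> R by rewrite powR_mulrn.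
exists t.+1; split.
- by rewrite pow2 natrM; apply: ler_powR; [rewrite ler1n|exact: ltW].
- have : t%:R <= d + 1 by apply: le_trans t1; rewrite ler_peMr.
  by rewrite -natr1; lra.
rewrite expr_div_n; apply: ler_pM; rewrite ?exprn_ge0//.
- rewrite -exprM mulnAC exprM (exprM _ (1 + L)%N) -exprMn lerXn2r ?nnegrE ?exprn_ge0//.
  rewrite !pow2 -powRD; last by rewrite pnatr_eq0 implybT.
  apply: ler_powR; first by rewrite ler1n.
  by rewrite natrM -natr1 natrD; lra.
- rewrite pow2 -powRN; apply: ler_powR; first by rewrite ler1n.
  rewrite lerN2; apply: le_trans (ltW t2).
  by rewrite ler_pM2r ?invr_gt0// lerDl.
Qed.

End annulus_geometry.

(** The bound [10 * sqrt n < k0] controls the dimension, [n <= k0^2], so a threshold expressed by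
    [k0] alone serves all admissible [n]. *)
Lemma radius_threshold (R : realType) (k0 : R) : exists2 d0 : R, 1 <= d0 &
  forall (n : nat) d, 10 * Num.sqrt n%:R < k0 -> d0 <= d ->
    0 < k0 /\ 2 * n%:R * (1 + 2 * k0) <= 2 `^ d.
Proof.
pose B := `|2 * k0 ^+ 2 * (1 + 2 * k0)|.
exists (Num.bound B).+1%:R; first by rewrite ler1n.
move=> n d nk dB; have s0 := sqrtr_ge0 (n%:R : R).
have k0_gt0 : 0 < k0 by apply: le_lt_trans nk; rewrite mulr_ge0.
split => //; have nk2 : n%:R <= k0 ^+ 2.
  have h : 0 <= 10 * Num.sqrt n%:R :> R by rewrite mulr_ge0.
  rewrite -(sqr_sqrtr (ler0n R n)); move: s0 nk h; set s := Num.sqrt _ => s0 nk h.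
  by rewrite lerXn2r ?nnegrE//; lra.
apply: (@le_trans _ _ B).
  apply: le_trans (ler_norm _); apply: ler_wpM2r; first by lra.
  by rewrite ler_pM2l.
apply: ltW; apply: lt_le_trans (archi_boundP (normr_ge0 _)) _.
apply: (@le_trans _ _ (2 `^ (Num.bound B).+1%:R)); last by apply: ler_powR; rewrite ?ler1n.
rewrite powR_mulrn// -natrX ler_nat.
by apply: ltnW; apply: ltn_trans (ltn_expl _ (ltnSn 1)) _; rewrite ltn_exp2l.
Qed.

(** The order of the quantifiers encodes the dependence of the constants: [d0] is fixed from [k0]
    alone, and [C] and [delta] before the ball, the configuration and [d]. *)
Theorem proposition3p16 (R : realType) (k0 : R) :
  exists2 d0 : R, 0 < d0 &
  forall (n : nat) (b Omega : 'rV[R]_n -> R[i])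
    (X : ('rV[R]_n -> R[i]) -> \bar R) (lambda eps0 : R),
  (0 < n)%N ->
  BMO b -> (forall x, b x \is Num.real) ->
  ball_Banach X -> maximal_bounded X -> maximal_bounded (associate_norm X) ->
  Linfty_sphere Omega -> homogeneous0 Omega ->
  cintegral (area R n) (@sphere R n) Omega = 0 ->
  (exists L : set 'rV[R]_n,
    [/\ sphere_open L, L !=set0 & constant_sign L Omega]) ->
  0 < lambda < 1 -> 0 < eps0 -> 10 * Num.sqrt n%:R < k0 ->
  exists C delta : R, [/\ 0 < C, 0 < delta &
    forall (x0 x1 : 'rV[R]_n) (r0 : R) (E F : set 'rV[R]_n)
      (G : set ('rV[R]_n * 'rV[R]_n)) (d : R),
    0 < r0 ->
    admissible b Omega lambda eps0 k0 x0 r0 x1 E F G ->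
    0 < d -> d0 <= d ->
    (X (fun x => commutator b Omega (cindic F) x *
          cindic (eball x0 (2 `^ (d + 1) * r0) `\` eball x0 (2 `^ d * r0)) x)%R <=
     (C * 2 `^ (- (delta * d * n%:R)) * d)%R%:E * BMO_norm b * X (cindic F))%E].
Proof.
have [d0 d01 hd0] := radius_threshold k0.
exists d0; first exact: lt_le_trans d01.
move=> n b Omega X lambda eps0 n0 hb breal hX [CX CX0 hCX] [CA CA0 hCA] OI OH _ _ _ _ nk.
have [k00 _] := hd0 n d0 nk (lexx _).
move: hb; rewrite (real_creal breal); set beta := fun x => complex.Re (b x) => hb.
have n0R : 0 < n%:R :> R by rewrite ltr0n.
have [M M0 hM] := borel_kernel n0 OI OH.
(* Lower bound for the proportion of the cube filled by [F]: half of a ball of volume at least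
   [(r0 / n)^n], against a cube about [x0] of half-side [(2 * k0 + 1) * r0] containing that ball. *)
pose th : R := 2^-1 * (2 * n%:R * (2 * k0 + 1)) ^- n.
have k1 : 0 < 2 * k0 + 1 by lra.
have th0 : 0 < th by rewrite mulr_gt0// invr_gt0 exprn_gt0// !mulr_gt0.
have [L [K [L0 K0 hK]]] := bmo_XR_far n0 hb hX CA0 hCA CX0 hCX th0.
have L0R : 0 < L%:R :> R by rewrite ltr0n.
(* The 8 is the 2 of [commutator_annulus] times the 4 of [1 + m <= 4 * d]; the last power of 2 pays
   for the overshoot in [step_count]. *)
pose C : R := 8 * M * K * (2 * n%:R) ^+ n * (2 * (2 * k0 + 1)) ^+ n * 2 ^+ ((1 + L) * n).
exists C, (L%:R * n%:R)^-1; split.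
- by rewrite !mulr_gt0// exprn_gt0// !mulr_gt0.
- by rewrite invr_gt0 mulr_gt0.
move=> x0 x1 r0 E F G d r00 [x10 _ [mF Fx1 volF] _ _] d_gt0 dd0.
have d1 : 1 <= d by exact: le_trans dd0.
have [_ hP] := hd0 n d nk dd0.
set P := 2 `^ d in hP *; have P0 : 0 < P by exact: powR_gt0.
pose D := P * r0 / (2 * n%:R).
have D0 : 0 < D by rewrite divr_gt0// mulr_gt0.
set A := eball x0 _ `\` _.
have mA : measurable (A : set (leb_space R n)).
  by apply: measurableD; exact: lebm_eball.
have AF x y : A x -> F y -> D <= enorm (x - y).
  move=> [_ /negP]; rewrite -leNgt => Px Fy.
  exact: (far_distance n0 r00 (ltW k00) x10 (Fx1 _ Fy) Px hP).
have Foo : (leb R n F < +oo)%E.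
  apply: le_lt_trans (eball_lty x1 r0); apply: le_measure; rewrite ?inE//.
  exact: lebm_eball.
have bF := bmo_int hb mF r00 Fx1.
have [mcomm comm_le] := commutator_annulus hb D0 mF mA Foo bF AF (hM D D0).
have [m [m1 m2 m3]] := step_count n L0 d1.
pose h := (2 * k0 + 1) * r0.
have h0 : 0 < h by exact: mulr_gt0.
have FQ : F `<=` cube x0 h by apply: subset_trans Fx1 _; exact: eball_shift_sub_cube.
have thF : th * (2 * h) ^+ n <= fine (leb R n F).
  rewrite volF ballvolE//= ; apply: le_trans (ler_wpM2l _ (ballvol_ge n0 x1 r00)); last by [].
  have -> : th * (2 * h) ^+ n = 2^-1 * (r0 / n%:R) ^+ n; last by [].
  rewrite /th -(mulrA 2^-1) -[_ ^- n]exprVn -[_ ^+ n * _]exprMn; congr (_ * _ ^+ n).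
  by rewrite /h; field; rewrite !gt_eqF.
pose a := cavg beta x0 (2 ^+ (m * L) * h).
have := hK F x0 h m h0 mF FQ thF a erefl.
set Q := cube x0 _.
pose g x := (fine (leb R n F) * `|beta x - a| + \int[leb R n]_(y in F) `|beta y - a|) * \1_Q x.
rewrite -/g => hg.
have AQ : A `<=` Q.
  move=> x [xA _]; have := @eball_sub_cube _ _ _ _ _ xA.
  apply: cubeS; first by rewrite mulr_ge0 ?powR_ge0// ltW.
  apply: ler_pM => //; first exact: ltW.
  by rewrite /h; apply: ler_peMl; [exact: ltW|lra].
have XF : (X (creal \1_F) < +oo)%E by exact: (XR_sub_ball_lty hX mF r00 Fx1).
have B0 : 0 <= bmo beta by exact: bmo_ge0.
have c0 : 0 <= 2 * M / D ^+ n by rewrite divr_ge0 ?exprn_ge0 ?mulr_ge0// ltW.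
have mg : measurable_fun setT (g : leb_space R n -> R).
  apply: measurable_funM; last by apply: measurable_indic; exact: cube_measurable.
  apply: measurable_funD; last exact: measurable_cst.
  apply: measurable_funM; first exact: measurable_cst.
  by apply: measurable_fun_dist; exact: bmo_measurable.
apply: (@le_trans _ _ (X (creal (fun x => 2 * M / D ^+ n * g x)))).
  apply: (bB_lattice hX); [|exact: mcomm|].
    apply: lmeasurable_creal.
    apply: (@measurable_funM _ _ _ _ (cst _ : leb_space R n -> R)); last exact: mg.
    exact: measurable_cst.
  apply: aeW => x; rewrite normcM normcR /cindic normcR /g [\1_A x]indicE.
  have [/set_mem Ax|_] := boolP (x \in A); last by rewrite normr0 mulr0.
  rewrite indicE (mem_set (AQ x Ax)) normr1 !mulr1.
  by apply: le_trans (comm_le a x Ax) _; exact: ler_norm.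
have goo : (X (creal g) < +oo)%E.
  apply: le_lt_trans hg _; rewrite lte_mul_pinfty// lee_fin.
  apply: mulr_ge0 => //; apply: mulr_ge0; last by rewrite exprn_ge0// divr_ge0// exprn_ge0.
  apply: mulr_ge0; last exact: addr_ge0.
  apply: mulr_ge0; first exact: ltW.
  by apply: exprn_ge0; apply: mulr_ge0 => //; exact: ltW.
rewrite (XR_scale hX _ goo) (ger0_norm c0) (BMO_normE hb).
apply: le_trans (lee_wpmul2l _ hg) _; first by rewrite lee_fin.
rewrite muleA -!EFinM; apply: lee_wpmul2r; first exact: (bB_ge0 hX).
rewrite lee_fin.
have -> : (L%:R * n%:R)^-1 * d * n%:R = d / L%:R by field; rewrite !gt_eqF.
set e := 2 `^ (- _) in m3 *; set q := (_ / 2) ^+ m in m3 *.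
have q0 : 0 <= q by rewrite exprn_ge0// divr_ge0// exprn_ge0.
have mq : (1 + m%:R) * q <= 4 * d * (P ^+ n * 2 ^+ ((1 + L) * n) * e).
  by apply: ler_pM; [exact: addr_ge0|exact: q0|exact: m2|exact: m3].
(* The powers of [r0] cancel. The kernel decay [P^-n] left from [D^-n] then cancels the growth [P^n]
   in [mq], and [e] is the only decay that survives. *)
have c1E : 2 * M / D ^+ n * K * (2 * h) ^+ n =
    2 * M * K * (2 * n%:R) ^+ n * (2 * (2 * k0 + 1)) ^+ n / P ^+ n.
  rewrite /D (mulrA 2) (exprMn n _ r0) expr_div_n (exprMn n P).
  have r1 : r0 ^+ n != 0 by rewrite expf_neq0// gt_eqF.
  have p1 : P ^+ n != 0 by rewrite expf_neq0// gt_eqF.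
  have n1 : (2 * n%:R) ^+ n != 0 :> R by rewrite expf_neq0// gt_eqF// mulr_gt0.
  by field; rewrite r1 p1 n1.
have c1_ge0 : 0 <= 2 * M / D ^+ n * K * (2 * h) ^+ n.
  by apply: mulr_ge0; [apply: mulr_ge0 => //; exact: ltW|apply: exprn_ge0; apply: mulr_ge0 => //; exact: ltW].
have := ler_wpM2r B0 (ler_wpM2l c1_ge0 mq).
rewrite {2}c1E => hle; apply: le_trans (le_trans hle _).
  by rewrite le_eqVlt; apply/orP; left; apply/eqP; ring.
have p1 : P ^+ n != 0 by rewrite expf_neq0// gt_eqF.
by rewrite /C le_eqVlt; apply/orP; left; apply/eqP; field.
Qed.
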